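(* Let $q>1$ and $\zeta,\eta\in\mathbb{T}$. For $v\in\mathfrak{D}_{q,\zeta,\eta}$ put $\mathsf{E}_{q,\zeta,\eta}v=\Phi(\mathsf{G}v,v)$. Then $$\mathcal{A}_{q,\zeta,\eta}=\begin{cases}\mathsf{E}_{q,\zeta,\eta}\big(\mathfrak{D}_{q,\zeta,\eta}\big),&(\zeta,\eta)\ne(1,1),\\ \mathbb{C}\Psi_q\oplus\mathsf{E}_{q,1,1}\big(\mathfrak{D}_{q,1,1}\big),&(\zeta,\eta)=(1,1),\end{cases}$$ where $\Psi_q=\Phi(\rho_q,0)$. Moreover, for every $v\in\mathfrak{D}_{q,\zeta,\eta}$, $$\|v\|_{\mathfrak{D}}\le\|\mathsf{E}_{q,\zeta,\eta}v\|_{L^1(\mathbb{R}_+)}\le 2\|v\|_{\mathfrak{D}}.$$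
   Context: $\mathbb{R}_+=(0,\infty)$, $\mathbb{T}=\{z\in\mathbb{C}:|z|=1\}$. Identities between $L^1$ functions hold a.e.; a function given on a subinterval of $\mathbb{R}_+$ is extended by zero outside it. Normalized pre-annihilator: writing $\zeta=e^{2\pi i s}$, $\eta=e^{2\pi i\tau}$ with $s,\tau\in\mathbb{R}$, $\mathcal{A}_{q,\zeta,\eta}$ is the set of $F\in L^1(\mathbb{R}_+)$ with $\int_{\mathbb{R}_+}F(x)e^{2\pi i(m+s)x}dx=0$ and $\int_{\mathbb{R}_+}F(x)e^{2\pi i(n+\tau)q/x}dx=0$ for all $m,n\in\mathbb{Z}$ (independent of the choice of $s,\tau$). If $q=\alpha\gamma$, $\zeta=e^{\pi i\theta_1/\alpha}$, $\eta=e^{\pi i\theta_2/\gamma}$, this is the image under $f\mapsto F$, $F(x)=\alpha^{-1}f(x/\alpha)$, of the set of $f\in L^1(\mathbb{R}_+)$ with $\int f(t)e^{\pi i(2m\alpha+\theta_1)t}dt=0=\int f(t)e^{\pi i(2n\gamma+\theta_2)/t}dt$ for all $m,n\in\mathbb{Z}$. Operators: for $\omega\in\mathbb{T}$, $$(\mathcal{L}_{\omega,q}h)(x)=\sum_{n\ge1}\omega^n\frac{q}{(n+x)^2}h\Big(\frac{q}{n+x}\Big)\quad(h\in L^1((0,1)),\ 0<x<1),$$ $(J_qh)(x)=\frac{q}{x^2}h(q/x)$ on $L^1(\mathbb{R}_+)$, and $(S_\omega h)(x)=\sum_{n\ge1}\omega^nh(x+n)$ for $0<x<1$. Put $Q=\mathcal{L}_{\zeta,q}\mathcal{L}_{\eta,q}$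 on $X=L^1((0,1))$; for $v\in Y=L^1((1,q))$ put $Av=-S_\zeta v+\mathcal{L}_{\zeta,q}(S_\eta J_qv)\in X$; for $h\in L^1((0,q))$ put $B_{\eta,q}h=-J_q[S_\eta(J_qh)]$, where the bracket is a function on $(0,1)$ extended by zero. Set $\Phi(F_0,v)=F_0+v+B_{\eta,q}(F_0+v)$ for $F_0\in X$, $v\in Y$. Green domain: $\mathsf{G}_Nv=\sum_{j=0}^{N-1}Q^jAv$; $\mathfrak{D}_{q,\zeta,\eta}=\{v\in Y:(\mathsf{G}_Nv)_{N\ge1}\text{ converges in }X\}$; $\mathsf{G}v=\lim_{N\to\infty}\mathsf{G}_Nv$ in $X$ for $v\in\mathfrak{D}_{q,\zeta,\eta}$; $\|v\|_{\mathfrak{D}}=\|v\|_1+\|\mathsf{G}v\|_1$. $\rho_q$ denotes the unique function in $BV((0,1))$ with $\mathcal{L}_{1,q}\rho_q=\rho_q$, $\rho_q>0$ a.e. and $\int_0^1\rho_q\,dx=1$. *)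

(* Defs.v *)
From HB Require Import structures.
From mathcomp Require Import all_boot all_order all_algebra.
From mathcomp Require Import all_classical all_reals all_analysis.
From mathcomp Require Import complex.

Set Implicit Arguments.
Unset Strict Implicit.
Unset Printing Implicit Defensive.

Import Order.TTheory GRing.Theory Num.Theory.
Import numFieldNormedType.Exports.

Local Open Scope classical_set_scope.
Local Open Scope complex_scope.
Local Open Scope ring_scope.

(** Elements of L^1(D), for D a subset of the line, are represented by
    functions [R -> R[i]] that vanish outside D; two representatives of the
    same class are equal almost everywhere on the line. *)

Section Spaces.
Variable R : realType.
Local Notation mu := (@lebesgue_measure R).
Local Notation C := R[i].

Definition Rpos : set R := `]0, +oo[.
Definition Iunit : set R := `]0, 1[.

Definition zext (D : set R) (f : R -> C) : R -> C :=
  fun x => if x \in D then f x else 0.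

Definition cintegrable (f : R -> C) : Prop :=
  mu.-integrable setT (fun x => (complex.Re (f x))%:E) /\
  mu.-integrable setT (fun x => (complex.Im (f x))%:E).

Definition cintegral (D : set R) (f : R -> C) : C :=
  (\int[mu]_(x in D) complex.Re (f x)) +i* (\int[mu]_(x in D) complex.Im (f x)).

Definition L1on (D : set R) : set (R -> C) :=
  [set f | cintegrable f /\ forall x, ~ D x -> f x = 0].

Definition L1norm (f : R -> C) : \bar R :=
  (\int[mu]_x (complex.Re `|f x|)%:E)%E.

Definition eqae (f g : R -> C) : Prop := ae_eq mu setT f g.

(** S and T represent the same set of classes of functions modulo equality
    almost everywhere. *)
Definition same_classes (S T : set (R -> C)) : Prop :=
  (forall f, S f -> exists2 g, T g & eqae f g) /\
  (forall g, T g -> exists2 f, S f & eqae g f).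

(** exp(i t) *)
Definition cis (t : R) : C := cos t +i* sin t.

(** Sum of [u n] over [n >= 1], real and imaginary parts separately; the value
    is unspecified when the series diverges, which for the operators below
    happens only on a null set. *)
Definition csum1 (u : nat -> C) : C :=
  limn (fun N => \sum_(1 <= n < N.+1) complex.Re (u n)) +i*
  limn (fun N => \sum_(1 <= n < N.+1) complex.Im (u n)).

End Spaces.

Section Operators.
Variable R : realType.
Local Notation mu := (@lebesgue_measure R).
Local Notation C := R[i].

Definition Lop (omega : C) (q : R) (h : R -> C) : R -> C :=
  zext (@Iunit R) (fun x => csum1 (fun n =>
    omega ^+ n * (q / (n%:R + x) ^+ 2)%:C * h (q / (n%:R + x)))).

Definition Jop (q : R) (h : R -> C) : R -> C :=
  zext (@Rpos R) (fun x => (q / x ^+ 2)%:C * h (q / x)).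

Definition Sop (omega : C) (h : R -> C) : R -> C :=
  zext (@Iunit R) (fun x => csum1 (fun n => omega ^+ n * h (x + n%:R))).

Definition Qop (q : R) (zeta eta : C) (h : R -> C) : R -> C :=
  Lop zeta q (Lop eta q h).

Definition Aop (q : R) (zeta eta : C) (v : R -> C) : R -> C :=
  fun x => - Sop zeta v x + Lop zeta q (Sop eta (Jop q v)) x.

Definition Bop (q : R) (eta : C) (h : R -> C) : R -> C :=
  fun x => - Jop q (Sop eta (Jop q h)) x.

Definition Phi (q : R) (eta : C) (F0 v : R -> C) : R -> C :=
  fun x => F0 x + v x + Bop q eta (F0 \+ v) x.

Definition GreenN (q : R) (zeta eta : C) (N : nat) (v : R -> C) : R -> C :=
  fun x => \sum_(0 <= j < N) iter j (Qop q zeta eta) (Aop q zeta eta v) x.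

Definition is_green (q : R) (zeta eta : C) (v g : R -> C) : Prop :=
  L1on (@Iunit R) g /\
  (fun N => L1norm (GreenN q zeta eta N v \- g)) @ \oo --> 0%E.

Definition green_domain (q : R) (zeta eta : C) : set (R -> C) :=
  [set v | L1on `]1, q[ v /\ exists g, is_green q zeta eta v g].

(** A representative of the limit, which is unique almost everywhere. *)
Definition Green (q : R) (zeta eta : C) (v : R -> C) : R -> C :=
  xget (fun=> 0) [set g | is_green q zeta eta v g].

Definition normD (q : R) (zeta eta : C) (v : R -> C) : \bar R :=
  (L1norm v + L1norm (Green q zeta eta v))%E.

Definition Eop (q : R) (zeta eta : C) (v : R -> C) : R -> C :=
  Phi q eta (Green q zeta eta v) v.

(** The set is independent of the choice of the arguments s and tau. *)
Definition preann (q : R) (zeta eta : C) : set (R -> C) :=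
  [set F | L1on (@Rpos R) F /\ exists s tau : R,
    [/\ zeta = cis (2 * pi * s), eta = cis (2 * pi * tau),
        (forall m : int, cintegral (@Rpos R)
           (fun x => F x * cis (2 * pi * (m%:~R + s) * x)) = 0) &
        (forall n : int, cintegral (@Rpos R)
           (fun x => F x * cis (2 * pi * (n%:~R + tau) * (q / x))) = 0)]].

Definition BVunit (f : R -> R) : Prop :=
  exists M : R, forall a b : R, 0 < a -> a <= b -> b < 1 ->
    (total_variation a b f <= M%:E)%E.

Definition is_inv_density (q : R) (r : R -> R) : Prop :=
  let rC := fun x => (r x)%:C in
  [/\ L1on (@Iunit R) rC, BVunit r, eqae (Lop 1 q rC) rC,
      {ae mu, forall x, Iunit x -> 0 < r x} &
      \int[mu]_(x in @Iunit R) r x = 1].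

(** A representative of the invariant density, unique almost everywhere. *)
Definition rho (q : R) : R -> R := xget (fun=> 0) [set r | is_inv_density q r].

(** Only used for [zeta = eta = 1]. *)
Definition Psi (q : R) : R -> C :=
  Phi q 1 (fun x => (rho q x)%:C) (fun=> 0).

End Operators.

(* Main.v *)
Require Import Defs.
From HB Require Import structures.
From mathcomp Require Import all_boot all_order all_algebra.
From mathcomp Require Import all_classical all_reals all_analysis.
From mathcomp Require Import measurable_realfun complex.
From mathcomp Require Import ring lra.

Set Implicit Arguments.
Unset Strict Implicit.
Unset Printing Implicit Defensive.

Import Order.TTheory GRing.Theory Num.Theory.
Import numFieldNormedType.Exports.

Local Open Scope classical_set_scope.
Local Open Scope complex_scope.
Local Open Scope ring_scope.

(** Both orthogonality conditions are identities for periodizations.  By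
    uniqueness of Fourier coefficients, F is orthogonal to the characters
    exp (2 i pi (m + s) x) if and only if F x + sum_(n >= 1) zeta ^ n F (x + n)
    vanishes for almost every x in ]0, 1[, and the inversion x |-> q / x carries
    the second family of characters to the first ([preannP]).  The identity for
    eta determines F beyond q from its restrictions h to ]0, 1[ and v to ]1, q[,
    that is, F = Phi h v, and the identity for zeta then reads h = Q h + A v
    ([preann_decomp], [preann_Phi]).  Summing this equation,
    GreenN N v = h - Q^N h ([GreenN_telescope]), so that all depends on Q^N h.

    If (zeta, eta) <> (1, 1) then Q^N h tends to 0 in L1 ([Q_vanish]), hence the
    Green limit of v exists and equals h.  If (zeta, eta) = (1, 1) this holds for
    h of mean zero ([Lop1_vanish]), hence Q^N h tends to the multiple of the
    invariant density rho with the same integral, and h is the Green limit of v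
    plus this multiple.  Conversely the Green limit g of v satisfies
    g = Q g + A v ([green_fixed]).  The norm estimates and the directness of the
    sum come from the disjointness of the supports of h, v and of the part of
    Phi h v beyond q, whose norm is at most that of h + v ([Phi_norm]).

    The decay of Q^N h is proved without compactness.  The operators do not
    increase the L1 norm, so h may be taken of bounded variation ([bvle_dense]).
    For such functions a single step reduces the variation by a factor
    [rate] < 1 up to a multiple of the L1 norm ([lasota_yorke]).  It remains to
    find a definite loss of L1 norm when the variation of h is at most M times
    the norm.  Then h is nearly constant and not small on one of K equal
    intervals ([flat_interval]), and since the Gauss-type map x |-> q / x mod 1
    is expanding, this interval contains the image of ]0, 1[ under an inverse
    branch ([exists_cylinder]).  Every point of ]0, 1[ therefore sees this value
    of h.  If a twist w <> 1 occurs, two neighbouring letters in front of this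
    branch show the value with phases of ratio w, and part of the two terms
    cancels ([twisted_gain]).  In the absence of twists the positive and the
    negative part of a real function of mean zero both spread over ]0, 1[, and
    their overlap cancels ([untwisted_gain]).  Loss and variation inequality
    together give a contraction in the norm |h|_1 + k var h ([bv_contraction]).
    The same contraction makes the iterates of the constant 1 converge
    uniformly, and their limit is an invariant density
    ([is_inv_density_exists]). *)

(** * Modulus of complex numbers *)

(** The modulus as a real number; the norm of the complex field takes its values
    in the complex field itself. *)
Notation nc z := (complex.Re `|z|).

Section ComplexNorm.
Variable R : realType.
Implicit Types z w : R[i].

Lemma nc_normE z : `|z| = (nc z)%:C.
Proof. by rewrite normc_def. Qed.

Lemma nc_ge0 z : 0 <= nc z.
Proof. by have := normr_ge0 z; rewrite {1}nc_normE (lecR 0). Qed.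

Lemma nc0 : nc (0 : R[i]) = 0.
Proof. by rewrite normr0. Qed.

Lemma nc1 : nc (1 : R[i]) = 1.
Proof. by rewrite normr1. Qed.

Lemma nc0_eq0 z : nc z = 0 -> z = 0.
Proof. by move=> z0; apply/normr0_eq0; rewrite nc_normE z0. Qed.

Lemma ncM z w : nc (z * w) = nc z * nc w.
Proof.
apply: (@complexI R); rewrite -nc_normE normrM.
by rewrite [LHS](congr2 *%R (nc_normE z) (nc_normE w)) -rmorphM.
Qed.

Lemma ncN z : nc (- z) = nc z.
Proof. by rewrite normrN. Qed.

Lemma ncB z w : nc (z - w) = nc (w - z).
Proof. by rewrite distrC. Qed.

Lemma ncD z w : nc (z + w) <= nc z + nc w.
Proof.
rewrite -lecR -nc_normE rmorphD /=.
by apply: le_trans (ler_normD z w) _; rewrite -!nc_normE.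
Qed.

Lemma ncR (x : R) : nc (x%:C) = `|x|.
Proof. by rewrite normc_def /= expr0n addr0 sqrtr_sqr. Qed.

Lemma ncX z n : nc (z ^+ n) = nc z ^+ n.
Proof. by elim: n => [|n IH]; rewrite ?expr0 ?nc1// !exprS ncM IH. Qed.

Lemma Re_le_nc z : `|complex.Re z| <= nc z.
Proof. by have := normc_ge_Re z; rewrite [X in _ <= X]nc_normE lecR. Qed.

Lemma Im_le_nc z : `|complex.Im z| <= nc z.
Proof.
rewrite normc_def /= -sqrtr_sqr ler_wsqrtr// lerDr sqr_ge0//.
Qed.

Lemma nc_le z : nc z <= `|complex.Re z| + `|complex.Im z|.
Proof.
rewrite {1}[z]complexE.
apply: le_trans (ncD _ _) _; rewrite ncM !ncR; rewrite lerD2l.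
by rewrite normc_def /= expr0n expr1n add0r sqrtr1 mul1r.
Qed.

Lemma nc_sum (I : Type) (r : seq I) (P : pred I) (F : I -> R[i]) :
  nc (\sum_(i <- r | P i) F i) <= \sum_(i <- r | P i) nc (F i).
Proof.
elim/big_ind2 : _ => [|x1 x2 y1 y2 h1 h2|//]; first by rewrite nc0.
by apply: le_trans (ncD _ _) _; rewrite lerD.
Qed.

Lemma ncBD z w : nc z <= nc (z - w) + nc w.
Proof. by rewrite -{1}(subrK w z) ncD. Qed.

Lemma nc_unit z : `|z| = 1 -> nc z = 1.
Proof. by move=> ->. Qed.

Lemma cReD z w : complex.Re (z + w) = complex.Re z + complex.Re w.
Proof. by case: z; case: w. Qed.
Lemma cImD z w : complex.Im (z + w) = complex.Im z + complex.Im w.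
Proof. by case: z; case: w. Qed.
Lemma cReN z : complex.Re (- z) = - complex.Re z.
Proof. by case: z. Qed.
Lemma cImN z : complex.Im (- z) = - complex.Im z.
Proof. by case: z. Qed.
Lemma cReM z w : complex.Re (z * w) =
  complex.Re z * complex.Re w - complex.Im z * complex.Im w.
Proof. by case: z; case: w. Qed.
Lemma cImM z w : complex.Im (z * w) =
  complex.Re z * complex.Im w + complex.Im z * complex.Re w.
Proof. by case: z; case: w. Qed.
Lemma cRe_sum (I : Type) (r : seq I) (P : pred I) (F : I -> R[i]) :
  complex.Re (\sum_(i <- r | P i) F i) = \sum_(i <- r | P i) complex.Re (F i).
Proof. by elim/big_rec2 : _ => //= i y1 y2 _ <-; rewrite cReD. Qed.
Lemma cIm_sum (I : Type) (r : seq I) (P : pred I) (F : I -> R[i]) :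
  complex.Im (\sum_(i <- r | P i) F i) = \sum_(i <- r | P i) complex.Im (F i).
Proof. by elim/big_rec2 : _ => //= i y1 y2 _ <-; rewrite cImD. Qed.

Lemma complex_ext z w : complex.Re z = complex.Re w ->
  complex.Im z = complex.Im w -> z = w.
Proof. by case: z => a b; case: w => c d /= -> ->. Qed.

End ComplexNorm.

(** * Integrable complex functions *)

Section L1basics.
Variable R : realType.
Local Notation mu := (@lebesgue_measure R).
Local Notation C := R[i].
Implicit Types f g : R -> C.

Let ae_filter : Filter (almost_everywhere mu) :=
  ae_filter_ringOfSetsType mu.

Lemma aeS (P Q : R -> Prop) : (forall x, P x -> Q x) ->
  {ae mu, forall x, P x} -> {ae mu, forall x, Q x}.
Proof. by move=> PQ; apply: (@filterS _ _ ae_filter). Qed.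

Lemma aeS2 (P1 P2 Q : R -> Prop) : (forall x, P1 x -> P2 x -> Q x) ->
  {ae mu, forall x, P1 x} -> {ae mu, forall x, P2 x} -> {ae mu, forall x, Q x}.
Proof. by move=> PQ; apply: (@filterS2 _ _ ae_filter). Qed.

Definition cmeas f := measurable_fun [set: R] (fun x => complex.Re (f x)) /\
  measurable_fun [set: R] (fun x => complex.Im (f x)).

Lemma cmeas_cst (c : C) : cmeas (fun=> c).
Proof. by split; exact: measurable_cst. Qed.

Lemma cmeasD f g : cmeas f -> cmeas g -> cmeas (fun x => f x + g x).
Proof.
by move=> [f1 f2] [g1 g2]; split;
  [under eq_fun do rewrite cReD|under eq_fun do rewrite cImD];
  apply: measurable_funD.
Qed.

Lemma cmeasN f : cmeas f -> cmeas (fun x => - f x).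
Proof.
by move=> [f1 f2]; split;
  [under eq_fun do rewrite cReN|under eq_fun do rewrite cImN];
  apply: measurableT_comp.
Qed.

Lemma cmeasB f g : cmeas f -> cmeas g -> cmeas (fun x => f x - g x).
Proof. by move=> mf mg; apply: cmeasD => //; exact: cmeasN. Qed.

Lemma cmeasM f g : cmeas f -> cmeas g -> cmeas (fun x => f x * g x).
Proof.
move=> [f1 f2] [g1 g2]; split;
  [under eq_fun do rewrite cReM|under eq_fun do rewrite cImM].
  by apply: measurable_funB; apply: measurable_funM.
by apply: measurable_funD; apply: measurable_funM.
Qed.

Lemma cmeasR (f : R -> R) : measurable_fun [set: R] f ->
  cmeas (fun x => (f x)%:C).
Proof. by move=> mf; split => //=; exact: measurable_cst. Qed.

Lemma cmeas_comp f (t : R -> R) : measurable_fun [set: R] t -> cmeas f ->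
  cmeas (fun x => f (t x)).
Proof.
by move=> mt [f1 f2]; split;
 [exact: (measurableT_comp f1)|exact: (measurableT_comp f2)].
Qed.

Lemma cmeas_sum (I : Type) (r : seq I) (P : pred I) (F : I -> R -> C) :
  (forall i, cmeas (F i)) -> cmeas (fun x => \sum_(i <- r | P i) F i x).
Proof.
move=> mF; elim: r => [|i r IH].
  by under eq_fun do rewrite big_nil; exact: cmeas_cst.
under eq_fun do rewrite big_cons; case: (P i) => //.
exact: cmeasD.
Qed.

Lemma Re_zext (D : set R) f :
  (fun x => complex.Re (zext D f x)) = (fun x => complex.Re (f x)) \_ D.
Proof. by apply/funext => x; rewrite /zext patchE; case: ifP. Qed.
Lemma Im_zext (D : set R) f :
  (fun x => complex.Im (zext D f x)) = (fun x => complex.Im (f x)) \_ D.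
Proof. by apply/funext => x; rewrite /zext patchE; case: ifP. Qed.

Lemma cmeas_zext (D : set R) f : measurable D -> cmeas f -> cmeas (zext D f).
Proof.
move=> mD [f1 f2]; split; rewrite ?Re_zext ?Im_zext;
 by apply/(measurable_restrictT _ mD); exact: measurable_funS measurableT _ _.
Qed.

Lemma measurable_nc f : cmeas f -> measurable_fun [set: R] (fun x => nc (f x)).
Proof.
move=> [f1 f2].
rewrite (_ : (fun x => _) = (fun x => Num.sqrt (complex.Re (f x) ^+ 2 + complex.Im (f x) ^+ 2))).
  apply: measurableT_comp.
    by apply: continuous_measurable_fun; exact: sqrt_continuous.
  by apply: measurable_funD; apply: measurable_funX.
by apply/funext => x; rewrite normc_def.
Qed.

Lemma cintegrable_cmeas f : cintegrable f -> cmeas f.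
Proof.
by move=> [f1 f2]; split; apply/measurable_EFinP; exact: measurable_int f1 || exact: measurable_int f2.
Qed.

Lemma emeasurable_nc f : cmeas f -> measurable_fun [set: R] (fun x => (nc (f x))%:E).
Proof. by move=> mf; apply/measurable_EFinP; exact: measurable_nc. Qed.

Lemma emeasurable_Re f : cmeas f ->
  measurable_fun [set: R] (fun x => (complex.Re (f x))%:E).
Proof. by move=> [mf _]; apply/measurable_EFinP. Qed.

Lemma emeasurable_Im f : cmeas f ->
  measurable_fun [set: R] (fun x => (complex.Im (f x))%:E).
Proof. by move=> [_ mf]; apply/measurable_EFinP. Qed.

Let mabsRe f : cmeas f ->
  measurable_fun [set: R] (fun x => `|(complex.Re (f x))%:E|%E).
Proof. by move=> mf; apply: measurableT_comp => //; exact: emeasurable_Re. Qed.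

Let mabsIm f : cmeas f ->
  measurable_fun [set: R] (fun x => `|(complex.Im (f x))%:E|%E).
Proof. by move=> mf; apply: measurableT_comp => //; exact: emeasurable_Im. Qed.

Lemma cintegrableP f : cintegrable f <-> cmeas f /\ (L1norm f < +oo)%E.
Proof.
split=> [fi|[mf foo]].
  have mf := cintegrable_cmeas fi; split=> //; case: fi => fi1 fi2.
  apply: (@le_lt_trans _ _ (\int[mu]_x (`|(complex.Re (f x))%:E| + `|(complex.Im (f x))%:E|))%E).
    apply: ge0_le_integral => //=.
    - by move=> x _; rewrite lee_fin nc_ge0.
    - exact: emeasurable_nc.
    - by apply: emeasurable_funD; [exact: mabsRe|exact: mabsIm].
    - by move=> x _; rewrite -EFinD lee_fin nc_le.
  rewrite ge0_integralD//=.
  - by apply: lte_add_pinfty; [case/integrableP: fi1|case/integrableP: fi2].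
  - exact: mabsRe.
  - exact: mabsIm.
split; apply/integrableP; split; [exact: emeasurable_Re| |exact: emeasurable_Im|].
  apply: le_lt_trans foo; apply: ge0_le_integral => //=.
  - exact: mabsRe.
  - exact: emeasurable_nc.
  - by move=> x _; rewrite lee_fin Re_le_nc.
apply: le_lt_trans foo; apply: ge0_le_integral => //=.
- exact: mabsIm.
- exact: emeasurable_nc.
- by move=> x _; rewrite lee_fin Im_le_nc.
Qed.

Lemma L1norm_ge0 f : (0 <= L1norm f)%E.
Proof. by apply: integral_ge0 => x _; rewrite lee_fin nc_ge0. Qed.

Definition l1 f : R := fine (L1norm f).

Lemma l1_ge0 f : 0 <= l1 f.
Proof. exact/fine_ge0/L1norm_ge0. Qed.

Lemma L1normE f : cintegrable f -> L1norm f = (l1 f)%:E.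
Proof.
by move=> /cintegrableP[_ foo]; rewrite fineK// ge0_fin_numE// L1norm_ge0.
Qed.

Lemma L1norm_le_ae f g : cmeas f -> cmeas g ->
  {ae mu, forall x, nc (f x) <= nc (g x)} -> (L1norm f <= L1norm g)%E.
Proof.
move=> mf mg fg; apply: ae_ge0_le_integral => //.
- by move=> x _; rewrite lee_fin nc_ge0.
- exact: emeasurable_nc.
- by move=> x _; rewrite lee_fin nc_ge0.
- exact: emeasurable_nc.
- by apply: aeS fg => x h _; rewrite lee_fin.
Qed.

Lemma cintegrable_le_ae f g : cmeas f -> cintegrable g ->
  {ae mu, forall x, nc (f x) <= nc (g x)} -> cintegrable f.
Proof.
move=> mf /cintegrableP[mg goo] fg; apply/cintegrableP; split => //.
exact: le_lt_trans (L1norm_le_ae mf mg fg) goo.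
Qed.

Lemma cintegrable_le f g : cmeas f -> cintegrable g ->
  (forall x, nc (f x) <= nc (g x)) -> cintegrable f.
Proof. by move=> mf ig fg; apply: (cintegrable_le_ae mf ig); exact: aeW. Qed.

Lemma eqae_sym f g : eqae f g -> eqae g f.
Proof. by apply: aeS => x h _; rewrite h. Qed.

Lemma eqae_trans f g h : eqae f g -> eqae g h -> eqae f h.
Proof. by apply: aeS2 => x fg gh _; rewrite fg// gh. Qed.

Lemma eqae_refl f : eqae f f.
Proof. exact: aeW. Qed.

Lemma eqaeT f g : eqae f g <-> {ae mu, forall x, f x = g x}.
Proof. by split; apply: aeS => x; [exact|]. Qed.

Lemma L1norm_eqae f g : cmeas f -> cmeas g -> eqae f g -> L1norm f = L1norm g.
Proof.
by move=> mf mg fg; apply/eqP; rewrite eq_le; apply/andP; split;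
  apply: L1norm_le_ae => //; apply: aeS fg => x h; rewrite h.
Qed.

Lemma l1_eqae f g : cmeas f -> cmeas g -> eqae f g -> l1 f = l1 g.
Proof. by move=> mf mg fg; rewrite /l1 (L1norm_eqae mf mg fg). Qed.

Lemma L1normD f g : cmeas f -> cmeas g ->
  (L1norm (fun x => f x + g x)%R <= L1norm f + L1norm g)%E.
Proof.
move=> mf mg; rewrite /L1norm -ge0_integralD//=; first last.
- exact: emeasurable_nc.
- by move=> x _; rewrite lee_fin nc_ge0.
- exact: emeasurable_nc.
- by move=> x _; rewrite lee_fin nc_ge0.
apply: ge0_le_integral => //.
- by move=> x _; rewrite lee_fin nc_ge0.
- by apply: emeasurable_nc; exact: cmeasD.
- by apply: emeasurable_funD; exact: emeasurable_nc.
- by move=> x _; rewrite -EFinD lee_fin ncD.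
Qed.

Lemma L1normN f : L1norm (fun x => - f x) = L1norm f.
Proof. by rewrite /L1norm; under eq_integral do rewrite normrN. Qed.

Lemma L1normM (c : C) f : cmeas f -> L1norm (fun x => c * f x) = ((nc c)%:E * L1norm f)%E.
Proof.
move=> mf; rewrite /L1norm -ge0_integralZl_EFin ?nc_ge0//.
- by apply: eq_integral => x _; rewrite ncM EFinM.
- by move=> x _; rewrite lee_fin nc_ge0.
- exact: emeasurable_nc.
Qed.

Lemma cintegrable0 : cintegrable (fun=> 0 : C).
Proof. by split; exact: integrable0. Qed.

Lemma cintegrableD f g : cintegrable f -> cintegrable g ->
  cintegrable (fun x => f x + g x).
Proof.
move=> /cintegrableP[mf fi] /cintegrableP[mg gi]; apply/cintegrableP.
split; first exact: cmeasD.
by apply: le_lt_trans (L1normD _ _) _ => //; exact: lte_add_pinfty.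
Qed.

Lemma cintegrableN f : cintegrable f -> cintegrable (fun x => - f x).
Proof.
move=> /cintegrableP[mf fi]; apply/cintegrableP.
by split; [exact: cmeasN|rewrite L1normN].
Qed.

Lemma cintegrableB f g : cintegrable f -> cintegrable g ->
  cintegrable (fun x => f x - g x).
Proof. by move=> fi gi; apply: cintegrableD => //; exact: cintegrableN. Qed.

Lemma cintegrableZ (c : C) f : cintegrable f -> cintegrable (fun x => c * f x).
Proof.
move=> fi; have mf := cintegrable_cmeas fi; apply/cintegrableP; split.
  by apply: cmeasM => //; exact: cmeas_cst.
by rewrite L1normM// L1normE// -EFinM ltry.
Qed.

Lemma cintegrable_sum (I : Type) (r : seq I) (P : pred I) (F : I -> R -> C) :
  (forall i, cintegrable (F i)) -> cintegrable (fun x => \sum_(i <- r | P i) F i x).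
Proof.
move=> mF; elim: r => [|i r IH].
  by under eq_fun do rewrite big_nil; exact: cintegrable0.
under eq_fun do rewrite big_cons; case: (P i) => //.
exact: cintegrableD.
Qed.

Lemma cintegrable_mulb (c : R) f g : cmeas f -> (forall x, nc (f x) <= c) ->
  cintegrable g -> cintegrable (fun x => f x * g x).
Proof.
move=> mf fc gi; have c0 : 0 <= c by apply: le_trans (nc_ge0 _) (fc 0).
apply: (@cintegrable_le _ (fun x => c%:C * g x)).
- by apply: cmeasM => //; exact: cintegrable_cmeas.
- exact: cintegrableZ.
- by move=> x; rewrite !ncM ncR (ger0_norm c0) ler_wpM2r// nc_ge0.
Qed.

Lemma cintegrable_zext (D : set R) f : measurable D -> cintegrable f ->
  cintegrable (zext D f).
Proof.
move=> mD fi; apply: (cintegrable_le _ fi).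
  exact/cmeas_zext/cintegrable_cmeas.
by move=> x; rewrite /zext; case: ifP => // _; rewrite nc0 nc_ge0.
Qed.

Lemma l1D f g : cintegrable f -> cintegrable g ->
  l1 (fun x => f x + g x) <= l1 f + l1 g.
Proof.
move=> fi gi; rewrite -lee_fin EFinD -!L1normE//; last exact: cintegrableD.
by apply: L1normD; exact: cintegrable_cmeas.
Qed.

Lemma l1N f : l1 (fun x => - f x) = l1 f.
Proof. by rewrite /l1 L1normN. Qed.

Lemma l1B f g : cintegrable f -> cintegrable g ->
  l1 (fun x => f x - g x) <= l1 f + l1 g.
Proof.
by move=> fi gi; rewrite -(l1N g); apply: l1D => //; exact: cintegrableN.
Qed.

Lemma l1Z (c : C) f : cintegrable f -> l1 (fun x => c * f x) = nc c * l1 f.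
Proof.
move=> fi; apply: EFin_inj; rewrite -L1normE; last exact: cintegrableZ.
by rewrite L1normM ?L1normE//; exact: cintegrable_cmeas.
Qed.

Lemma l1_0 : l1 (fun=> 0) = 0.
Proof.
by rewrite /l1 /L1norm; under eq_integral do rewrite nc0; rewrite integral0.
Qed.

Lemma l1_eq0 f : cintegrable f -> l1 f = 0 -> eqae f (fun=> 0).
Proof.
move=> fi f0; have mf := cintegrable_cmeas fi.
have : (\int[mu]_x `|(nc (f x))%:E| = 0)%E.
  rewrite -[RHS](_ : L1norm f = 0%E); last by rewrite (L1normE fi) f0.
  by apply: eq_integral => x _; rewrite gee0_abs// lee_fin nc_ge0.
move/(ae_eq_integral_abs mu measurableT (emeasurable_nc mf)).
by apply: aeS => x /(_ I)[] /nc0_eq0.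
Qed.

Lemma integrable_nc (h : R -> C) : cintegrable h ->
  mu.-integrable [set: R] (EFin \o (fun x => nc (h x))).
Proof.
move=> hi; have mh := cintegrable_cmeas hi.
apply/integrableP; split; first exact: emeasurable_nc.
under eq_integral do rewrite gee0_abs ?lee_fin ?nc_ge0//.
by rewrite -/(L1norm h) L1normE// ltry.
Qed.

End L1basics.

(** * Changes of variables on the line *)

Section ChangeOfVariables.
Variable R : realType.
Local Notation mu := (@lebesgue_measure R).
Variables (w T : R -> R).
Hypotheses (w0 : forall x, 0 <= w x) (mw : measurable_fun [set: R] w)
  (mT : measurable_fun [set: R] T).
Local Open Scope ereal_scope.

Definition density_image (A : set (measurableTypeR R)) : \bar R :=
  \int[mu]_(x in T @^-1` A) (w x)%:E.

Let mT' : @measurable_fun _ _ (measurableTypeR R) (measurableTypeR R) setT T.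
Proof. exact: mT. Qed.

Let mTA (A : set (measurableTypeR R)) : measurable A -> measurable (T @^-1` A).
Proof. by move=> mA; rewrite -[X in measurable X]setTI; exact: mT. Qed.

Let di0 : density_image set0 = 0.
Proof. by rewrite /density_image preimage_set0 integral_set0. Qed.

Let di_ge0 A : 0 <= density_image A.
Proof. by apply: integral_ge0 => x _; rewrite lee_fin. Qed.

Let di_sigma_additive : semi_sigma_additive density_image.
Proof.
move=> F mF tF mUF; rewrite /density_image; apply: cvg_toP.
  apply: ereal_nondecreasing_is_cvgn => m n mn.
  apply: lee_sum_nneg_natr => // k _ _.
  by apply: integral_ge0 => /= x Fkx; rewrite lee_fin.
rewrite preimage_bigcup ge0_integral_bigcup//=.
- by move=> k; exact: (mTA (mF k)).
- by apply: measurable_funTS; apply/measurable_EFinP.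
- by move=> x _; rewrite lee_fin.
- by apply/trivIsetP => i j _ _ ij; rewrite -preimage_setI;
    move/trivIsetP : tF => /(_ i j I I ij) ->; rewrite preimage_set0.
Qed.

HB.instance Definition _ := isMeasure.Build _ _ _ density_image
  di0 di_ge0 di_sigma_additive.

Let integral_di_indic (E : set (measurableTypeR R)) : measurable E ->
  \int[density_image]_x (\1_E x)%:E = \int[mu]_x (w x * \1_E (T x))%:E.
Proof.
move=> mE; rewrite integral_indic//= /density_image setIT.
rewrite [LHS]integral_mkcond/=; apply: eq_integral => x _.
rewrite patchE indicE.
have -> : (x \in T @^-1` E) = (T x \in E) by apply/idP/idP; rewrite !inE.
by case: (_ \in _); rewrite ?mulr1 ?mulr0.
Qed.

Import HBNNSimple.

Let integral_di_nnsfun (f : {nnsfun measurableTypeR R >-> R}) :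
  \int[density_image]_x (f x)%:E = \int[mu]_x (w x * f (T x))%:E.
Proof.
under [LHS]eq_integral do rewrite fimfunE -fsumEFin//.
rewrite [LHS]ge0_integral_fsum//; last 2 first.
  - by move=> r; exact/measurable_EFinP/measurableT_comp.
  - by move=> n x _; rewrite EFinM nnfun_muleindic_ge0.
under [RHS]eq_integral.
  move=> x xD; rewrite fimfunE EFinM -fsumEFin// ge0_mule_fsumr; last first.
    by move=> r; rewrite EFinM nnfun_muleindic_ge0.
  over.
rewrite [RHS]ge0_integral_fsum//; last 2 first.
  - move=> r; apply: emeasurable_funM; first exact/measurable_EFinP.
    apply/measurable_EFinP; apply: measurable_funM => //.
    by apply: (measurableT_comp _ mT'); exact: measurable_indic.
  - by move=> n x _; apply: mule_ge0; rewrite ?lee_fin//; rewrite -lee_fin EFinM nnfun_muleindic_ge0.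
apply: eq_fsbigr => r rf.
rewrite integralZl_indic_nnsfun//= integral_di_indic//.
have r0 : (0 <= r)%R.
  by move: rf; rewrite inE => -[x _ <-].
rewrite -ge0_integralZl_EFin//; first by apply: eq_integral => x _; rewrite -!EFinM mulrCA.
- by move=> x _; rewrite lee_fin mulr_ge0.
- apply/measurable_EFinP; apply: measurable_funM => //.
  by apply: (measurableT_comp _ mT'); exact: measurable_indic.
Qed.

Let integral_di (f : R -> \bar R) : measurable_fun [set: measurableTypeR R] f ->
  (forall x, 0 <= f x) ->
  \int[density_image]_x f x = \int[mu]_x ((w x)%:E * f (T x)).
Proof.
move=> mf f0; pose f_ := nnsfun_approx measurableT mf.
have cvf x : (f_ n x)%:E @[n --> \oo] --> f x.
  by apply: cvg_nnsfun_approx => // ? _; exact: f0.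
transitivity (limn (fun n => \int[density_image]_x (f_ n x)%:E)).
  rewrite -monotone_convergence//=.
  - by apply: eq_integral => x _; apply/esym/cvg_lim => //; exact: cvf.
  - by move=> n; exact/measurable_EFinP/measurable_funTS.
  - by move=> n x _; rewrite lee_fin.
  - by move=> x _ m n mn; rewrite lee_fin; exact/lefP/nd_nnsfun_approx.
transitivity (limn (fun n => \int[mu]_x (w x * f_ n (T x))%:E)).
  by apply: congr_lim; apply/funext => n /=; exact: integral_di_nnsfun.
rewrite -monotone_convergence//=.
- apply: eq_integral => x _; apply/cvg_lim => //.
  by under eq_fun do rewrite EFinM; apply: cvgeZl.
- move=> n; apply/measurable_EFinP; apply: measurable_funM => //.
  by apply: (measurableT_comp _ mT'); exact: measurable_funTS.
- by move=> n x _; rewrite lee_fin mulr_ge0.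
- move=> x _ m n mn; rewrite lee_fin ler_wpM2l//.
  by have /lefP := nd_nnsfun_approx measurableT mf mn; apply.
Qed.

(** It suffices to test a change of variables on bounded intervals, because
    these generate the Borel sets. *)
Lemma change_of_variables (f : R -> \bar R) :
  (forall a b : R, (a < b)%R ->
     \int[mu]_(x in T @^-1` `]a, b]) (w x)%:E = (b - a)%:E) ->
  measurable_fun [set: R] f -> (forall x, 0 <= f x) ->
  \int[mu]_x ((w x)%:E * f (T x)) = \int[mu]_x f x.
Proof.
move=> H mf f0; rewrite -integral_di//.
apply: (@eq_measure_integral _ _ _ setT mu density_image) => A mA _.
apply/esym; apply: (@lebesgue_measure_unique R density_image) => // _ [[a b]] _ <-.
rewrite lebesgue_measure_itv/= lte_fin; case: ltP => ab.
  by rewrite /density_image/= H.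
by rewrite set_itv_ge ?measure0// bnd_simp -leNgt.
Qed.

End ChangeOfVariables.

Lemma measurable_invr (R : realType) :
  measurable_fun [set: R] (fun x : R => x^-1).
Proof.
rewrite -(setUv [set (0:R)]); apply/measurable_funU => //.
  by apply: measurableC; exact: measurable_set1.
split; first exact: measurable_fun_set1.
apply: open_continuous_measurable_fun.
  by apply: closed_openC; exact: closed_eq.
by move=> x; rewrite inE/= => /eqP x0; exact: inv_continuous.
Qed.

Section Inv.
Variable R : realType.
Local Notation mu := (@lebesgue_measure R).

Lemma integral_shift (a : R) (f : R -> \bar R) : measurable_fun [set: R] f ->
  (forall x, 0 <= f x)%E -> (\int[mu]_x f (x + a)%R = \int[mu]_x f x)%E.
Proof.
move=> mf f0.
have := @change_of_variables R (cst 1) (fun x => x + a) _ _ _ f _ mf f0.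
rewrite (_ : (\int[mu]_x _ = _)%E = (\int[mu]_x f (x + a)%R = \int[mu]_x f x)%E); last first.
  by congr (_ = _); apply: eq_integral => x _; rewrite mul1e.
apply => //.
- exact: measurable_funD.
- move=> c d cd; rewrite (_ : _ @^-1` _ = `]c - a, d - a]%classic).
    rewrite [LHS](@integral_cst _ _ _ mu _ _ 1%E)// mul1e.
    rewrite [LHS](lebesgue_measure_itv `]c - a, d - a]%R)/= lte_fin ltrD2r cd.
    by rewrite -EFinD; congr EFin; ring.
  by apply/seteqP; split => x /=; rewrite !in_itv/= ltrBlDr lerBrDr.
Qed.

Variable q : R.
Hypothesis q0 : 0 < q.

Lemma integral_invsq (A : R) : 0 < A ->
  (\int[mu]_(x in `[A, +oo[) (q / x ^+ 2)%:E = (q / A)%:E)%E.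
Proof.
move=> A0.
pose G (x : R) : R := x^-1.
have GX (x : R) : 0 < x -> derivable G x 1 /\ 'D_1 G x = - (x ^- 2).
  move=> x0; have x0' := lt0r_neq0 x0; split.
    by apply: (@derivableV _ _ id).
  by rewrite (@deriveV _ _ id)// derive_id /GRing.scale/= mulr1.
have dF (x : R) : 0 < x -> is_derive x (1:R) (fun x : R => - (q * x^-1)) (q / x ^+ 2).
  move=> x0; have [d1 d2] := GX _ x0.
  have -> : (fun x : R => - (q * x^-1)) = - (q \*: G) by [].
  split; first by apply: derivableN; apply: derivableZ.
  rewrite deriveN; last exact: derivableZ.
  by rewrite deriveZ// d2 scalerN opprK.
rewrite (@ge0_continuous_FTC2y R (fun x => q / x ^+ 2) (fun x => - (q * x^-1)) A 0).
- by rewrite -EFinB sub0r opprK.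
- move=> x Ax; rewrite divr_ge0//; first exact: ltW.
  by rewrite exprn_ge0// ltW// (lt_le_trans A0).
- apply/continuous_within_itvcyP; split.
    move=> x /=; rewrite in_itv/= andbT => Ax.
    apply: cvgM; first exact: cvg_cst.
    apply: cvgV; first by rewrite sqrf_eq0 gt_eqF// (lt_trans A0).
    exact: exprn_continuous.
  apply: cvgM; first exact: cvg_cst.
  apply: cvgV; first by rewrite sqrf_eq0 gt_eqF.
  apply: cvg_at_right_filter; exact: exprn_continuous.
- rewrite -oppr0; apply: cvgN; rewrite -(mulr0 q); apply: cvgM; first exact: cvg_cst.
  apply/gtr0_cvgV0; last exact: cvg_id.
  exact: nbhs_pinfty_gt.
- by move=> x Ax; have [] := dF x (lt_trans A0 Ax).
- apply: cvgN; apply: cvgM; first exact: cvg_cst.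
  apply: cvgV; first by rewrite gt_eqF.
  exact: cvg_at_right_filter.
- move=> x; rewrite in_itv/= andbT => Ax; rewrite derive1E.
  by have [] := dF x (lt_trans A0 Ax).
Qed.

Let W x : R := if 0 < x then q / x ^+ 2 else 1.
Let T x : R := if 0 < x then q / x else x.

Let mpos : measurable_fun [set: R] (fun x : R => 0 < x).
Proof. exact: measurable_fun_ltr. Qed.

Let W0 x : 0 <= W x.
Proof.
rewrite /W; case: ifP => // x0; apply: divr_ge0; first exact: ltW.
by rewrite exprn_ge0// ltW.
Qed.

Let mW : measurable_fun [set: R] W.
Proof.
apply: measurable_fun_ifT => //; apply: measurable_funM => //.
apply: (measurableT_comp (@measurable_invr R)).
exact: measurable_funX.
Qed.

Let mT : measurable_fun [set: R] T.
Proof.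
apply: measurable_fun_ifT => //; apply: measurable_funM => //.
exact: measurable_invr.
Qed.

Let A (c d : R) : set R := [set x : R | 0 < x /\ c < q / x <= d].

Let AE c d : c < d -> A c d =
  if d <= 0 then set0 else if c <= 0 then `[q / d, +oo[%classic
  else `[q / d, q / c[%classic.
Proof.
move=> cd; apply/seteqP; case: (leP d 0) => d0.
  split=> x //= [x0 /andP[_ h]].
  by have := lt_le_trans (divr_gt0 q0 x0) (le_trans h d0); rewrite ltxx.
have hd x : 0 < x -> (q / x <= d) = (q / d <= x).
  by move=> x0; rewrite ler_pdivrMr// ler_pdivrMr// mulrC.
have qd : 0 < q / d by exact: divr_gt0.
case: (leP c 0) => c0; split=> x /=.
- by move=> [x0]; rewrite in_itv/= andbT hd// => /andP[].
- rewrite in_itv/= andbT => h; have x0 : 0 < x by exact: lt_le_trans h.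
  by split=> //; rewrite hd// h (le_lt_trans c0)// divr_gt0.
- by move=> [x0]; rewrite in_itv/= hd// => /andP[h ->]; rewrite ltr_pdivlMr// mulrC -ltr_pdivlMr.
- rewrite in_itv/= => /andP[h h2]; have x0 : 0 < x by exact: lt_le_trans h.
  by split=> //; rewrite hd// h ltr_pdivlMr// mulrC -ltr_pdivlMr// h2.
Qed.

Let intA c d : c < d ->
  (\int[mu]_(x in A c d) (W x)%:E = (Num.max d 0 - Num.max c 0)%:E)%E.
Proof.
move=> cd.
have -> : (\int[mu]_(x in A c d) (W x)%:E = \int[mu]_(x in A c d) (q / x ^+ 2)%:E)%E.
  by apply: eq_integral => x; rewrite inE /W => -[-> _].
rewrite AE//; case: (leP d 0) => d0.
  by rewrite integral_set0 maxEle (le_trans (ltW cd) d0) subrr.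
case: (leP c 0) => c0.
  by rewrite integral_invsq ?divr_gt0// invf_div mulrCA divff ?gt_eqF// mulr1 subr0.
have qd0 : 0 < q / d by exact: divr_gt0.
have qc0 : 0 < q / c by exact: divr_gt0.
have qdc : q / d <= q / c.
  by rewrite ler_wpM2l ?(ltW q0)// lef_pV2 ?posrE// ltW.
have H := integral_invsq qd0.
have Hc := integral_invsq qc0.
have mf : measurable_fun [set: R] (fun x => (W x)%:E) by apply/measurable_EFinP.
have E2 (D : set R) : (forall x, D x -> 0 < x) ->
   (\int[mu]_(x in D) (q / x ^+ 2)%:E = \int[mu]_(x in D) (W x)%:E)%E.
  by move=> D0; apply: eq_integral => x; rewrite inE /W => /D0 ->.
have Uc : `[q / d, +oo[%classic = `[q / d, q / c[%classic `|` `[q / c, +oo[%classic.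
  apply/seteqP; split => x /=; rewrite !in_itv/= ?andbT.
    by move=> ->; case: (ltP x (q / c)); [left|right].
  by case=> [/andP[]//|]; exact: le_trans.
move: H; rewrite E2; last first.
  by move=> x /=; rewrite in_itv/= andbT; exact: lt_le_trans.
rewrite Uc ge0_integral_setU//=; first last.
- apply/disj_setPS => x /= []; rewrite !in_itv/= andbT => /andP[_ h1] h2.
  by have := lt_le_trans h1 h2; rewrite ltxx.
- by move=> x _; rewrite lee_fin.
- exact: measurable_funTS.
rewrite -E2; last first.
  by move=> x /=; rewrite in_itv/= => /andP[h _]; exact: lt_le_trans h.
rewrite -E2; last first.
  by move=> x /=; rewrite in_itv/= andbT; exact: lt_le_trans.
rewrite Hc !invf_div !(mulrCA q) divff ?gt_eqF// !mulr1 => H.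
by rewrite EFinB -H addeK.
Qed.

(** The map x |-> q / x is an involution of the half-line with Jacobian
    q / x ^ 2; it is extended by the identity so that the criterion on bounded
    intervals applies. *)
Lemma integral_inversion (f : R -> \bar R) : measurable_fun [set: R] f ->
  (forall x, 0 <= f x)%E ->
  (\int[mu]_(x in @Rpos R) ((q / x ^+ 2)%:E * f (q / x)%R) =
   \int[mu]_(x in @Rpos R) f x)%E.
Proof.
move=> mf f0; pose D := @Rpos R.
have mg : measurable_fun [set: R] (f \_ D).
  apply/(measurable_restrictT f); first exact: measurable_itv.
  exact: measurable_funTS.
have g0 x : (0 <= (f \_ D) x)%E by rewrite patchE; case: ifP.
rewrite [RHS]integral_mkcond -(change_of_variables W0 mW mT _ mg g0); last first.
  move=> c d cd.
  rewrite (_ : T @^-1` _ = A c d `|` `]Num.min c 0, Num.min d 0]%classic); last first.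
    apply/seteqP; split => x /=; rewrite /A /T !in_itv/=.
      by case: (ltP 0 x) => x0 h; [left|right; rewrite gt_min le_min x0; case/andP: h => -> ->].
    case=> [[-> //]|/andP[]]; rewrite gt_min le_min => h /andP[h1 h2].
    by rewrite (ltNge 0 x) h2/= h1 andbT; case/orP: h => // h; have := lt_le_trans h h2; rewrite ltxx.
  rewrite ge0_integral_setU//=; first last.
  - apply/disj_setPS => x /= [[x0 _]]; rewrite in_itv/= le_min => /andP[_ /andP[_ h]].
    by have := lt_le_trans x0 h; rewrite ltxx.
  - by move=> x _; rewrite lee_fin.
  - by apply: measurable_funTS; apply/measurable_EFinP.
  - by rewrite AE//; case: ifP => // _; case: ifP => // _; exact: measurable_itv.
  rewrite intA//.
  set B : set R := `]Num.min c 0, Num.min d 0]%classic.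
  have -> : (\int[mu]_(x in B) (W x)%:E = \int[mu]_(x in B) (cst 1%E x))%E.
    apply: eq_integral => x; rewrite inE /B/= in_itv/= /W le_min => /andP[_ /andP[_]].
    by rewrite leNgt => /negbTE ->.
  rewrite integral_cst ?mul1e; last exact: measurable_itv.
  rewrite [X in (_ + X)%E](lebesgue_measure_itv `]Num.min c 0, Num.min d 0]%R)/= lte_fin.
  have dc := ltW cd.
  have -> : (if Num.min c 0 < Num.min d 0 then ((Num.min d 0)%:E - (Num.min c 0)%:E)%E else 0%E)
     = (Num.min d 0 - Num.min c 0)%:E.
    case: ltP => //; rewrite le_eqVlt => /orP[/eqP ->|]; first by rewrite subrr.
    by rewrite ltNge le_min !ge_min dc lexx !orbT.
  rewrite -EFinD; congr EFin; rewrite !maxEle !minEle.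
  by case: (leP c 0); case: (leP d 0); lra.
rewrite [LHS]integral_mkcond; apply: eq_integral => x _.
rewrite !patchE /D /Rpos /W /T !mem_setE !in_itv/= !andbT.
by case: (ltP 0 x) => x0; rewrite ?divr_gt0// ?(ltNge 0 x) ?x0/= ?mule0.
Qed.

End Inv.

(** * Absolutely convergent series *)

Section Csum.
Variable R : realType.
Local Notation C := R[i].
Implicit Types (u v : nat -> C) (a b : nat -> R).

Definition rsum a : R := limn (fun N => \sum_(1 <= n < N.+1) a n).

Definition rsummable a := exists B, forall N, \sum_(1 <= n < N.+1) `|a n| <= B.

Definition csummable u := exists B, forall N, \sum_(1 <= n < N.+1) nc (u n) <= B.

Lemma csum1E u : csum1 u = rsum (fun n => complex.Re (u n)) +i*
  rsum (fun n => complex.Im (u n)).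
Proof. by []. Qed.

Lemma rsum_cvg a : rsummable a ->
  (fun N => \sum_(1 <= n < N.+1) a n) @ \oo --> rsum a.
Proof.
move=> [B aB].
have E c : (fun N => \sum_(1 <= n < N.+1) c n) = series (fun n => c n.+1) :> (nat -> R).
  by apply/funext => N; rewrite big_add1.
rewrite /rsum E; apply: (@normed_cvg R R).
have -> : [normed series (fun n => a n.+1)] =
    (fun N => \sum_(1 <= n < N.+1) `|a n|).
  by apply/funext => N; rewrite big_add1.
apply: nondecreasing_is_cvgn.
  apply/nondecreasing_seqP => n /=; rewrite [leRHS]big_nat_recr//=.
  by rewrite lerDl.
by exists B => _ [N _ <-]; exact: aB.
Qed.

Lemma csummable_Re u : csummable u -> rsummable (fun n => complex.Re (u n)).
Proof.
move=> [B uB]; exists B => N; apply: le_trans (uB N).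
by apply: ler_sum => n _; exact: Re_le_nc.
Qed.

Lemma csummable_Im u : csummable u -> rsummable (fun n => complex.Im (u n)).
Proof.
move=> [B uB]; exists B => N; apply: le_trans (uB N).
by apply: ler_sum => n _; exact: Im_le_nc.
Qed.

Lemma csummable_le u b : rsummable b ->
  (forall n, (1 <= n)%N -> nc (u n) <= b n) -> csummable u.
Proof.
move=> [B bB] ub; exists B => N; apply: le_trans (bB N).
apply: ler_sum_nat => n /andP[n1 _].
by apply: le_trans (ub n n1) (ler_norm _).
Qed.

Lemma csummable_nc u : csummable u -> rsummable (fun n => nc (u n)).
Proof.
move=> [B uB]; exists B => N; apply: le_trans (uB N).
by apply: ler_sum => n _; rewrite ger0_norm// nc_ge0.
Qed.

Lemma rsummableD a b : rsummable a -> rsummable b -> rsummable (fun n => a n + b n).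
Proof.
move=> [A aA] [B bB]; exists (A + B) => N; apply: le_trans (lerD (aA N) (bB N)).
by rewrite -big_split; apply: ler_sum => n _; exact: ler_normD.
Qed.

Lemma rsummableZ (c : R) a : rsummable a -> rsummable (fun n => c * a n).
Proof.
move=> [A aA]; exists (`|c| * A) => N; apply: le_trans (ler_wpM2l _ (aA N)) => //.
by rewrite mulr_sumr; apply: ler_sum => n _; rewrite normrM.
Qed.

Lemma rsumD a b : rsummable a -> rsummable b ->
  rsum (fun n => a n + b n) = rsum a + rsum b.
Proof.
move=> sa sb; apply/cvg_lim => //.
under eq_fun do rewrite big_split.
by apply: cvgD; exact: rsum_cvg.
Qed.

Lemma rsumZ (c : R) a : rsummable a -> rsum (fun n => c * a n) = c * rsum a.
Proof.
move=> sa; apply/cvg_lim => //.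
under eq_fun do rewrite -mulr_sumr.
by apply: cvgM; [exact: cvg_cst|exact: rsum_cvg].
Qed.

Lemma rsumN a : rsummable a -> rsum (fun n => - a n) = - rsum a.
Proof.
move=> sa; rewrite -mulN1r -rsumZ//; congr rsum; apply/funext => n.
by rewrite mulN1r.
Qed.

Lemma rsum_le a b : rsummable a -> rsummable b ->
  (forall n, (1 <= n)%N -> a n <= b n) -> rsum a <= rsum b.
Proof.
move=> sa sb ab; apply: ler_lim; [by apply/cvg_ex; eexists; exact: rsum_cvg..|].
by apply: nearW => N; apply: ler_sum_nat => n /andP[n1 _]; exact: ab.
Qed.

Lemma rsum_bound a B : rsummable a -> (forall N, \sum_(1 <= n < N.+1) a n <= B) ->
  rsum a <= B.
Proof. by move=> sa h; apply: (limr_le (rsum_cvg sa)); exact: nearW. Qed.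

Lemma csum1_cvg u : csummable u ->
  (fun N => complex.Re (\sum_(1 <= n < N.+1) u n)) @ \oo --> complex.Re (csum1 u) /\
  (fun N => complex.Im (\sum_(1 <= n < N.+1) u n)) @ \oo --> complex.Im (csum1 u).
Proof.
move=> su; split.
  by under eq_fun do rewrite cRe_sum; exact/rsum_cvg/csummable_Re.
by under eq_fun do rewrite cIm_sum; exact/rsum_cvg/csummable_Im.
Qed.

Lemma nc_cvg (s : nat -> C) (l : C) :
  (fun N => complex.Re (s N)) @ \oo --> complex.Re l ->
  (fun N => complex.Im (s N)) @ \oo --> complex.Im l ->
  (fun N => nc (s N)) @ \oo --> nc l.
Proof.
move=> h1 h2; rewrite (_ : (fun N => _) = (fun N => Num.sqrt (complex.Re (s N) ^+ 2 + complex.Im (s N) ^+ 2))); last first.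
  by apply/funext => n; rewrite normc_def.
rewrite [X in _ --> X](_ : _ = Num.sqrt (complex.Re l ^+ 2 + complex.Im l ^+ 2)); last first.
  by rewrite normc_def.
apply: (@cvg_comp _ _ _ _ Num.sqrt); last exact: sqrt_continuous.
by apply: cvgD; apply: (@cvg_comp _ _ _ _ (fun x : R => x ^+ 2)); [|exact: exprn_continuous| |exact: exprn_continuous].
Qed.

Lemma csum1D u v : csummable u -> csummable v ->
  csum1 (fun n => u n + v n) = csum1 u + csum1 v.
Proof.
move=> su sv; rewrite !csum1E; apply: complex_ext => /=.
  rewrite -rsumD; [|exact: csummable_Re..].
  by congr rsum; apply/funext => n; rewrite cReD.
rewrite -rsumD; [|exact: csummable_Im..].
by congr rsum; apply/funext => n; rewrite cImD.
Qed.

Lemma csummableM (c : C) u : csummable u -> csummable (fun n => c * u n).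
Proof.
move=> /csummable_nc su; apply: csummable_le (rsummableZ (nc c) su) _ => n _.
by rewrite ncM.
Qed.

Lemma csum1M (c : C) u : csummable u -> csum1 (fun n => c * u n) = c * csum1 u.
Proof.
move=> su; rewrite !csum1E; apply: complex_ext.
  rewrite cReM/= -!rsumZ; [|exact: csummable_Im|exact: csummable_Re].
  rewrite -rsumN; last exact/rsummableZ/csummable_Im.
  rewrite -rsumD; first by congr rsum; apply/funext => n; rewrite cReM.
    exact/rsummableZ/csummable_Re.
  have [B h] := rsummableZ (complex.Im c) (csummable_Im su).
  by exists B => N; under eq_bigr do rewrite normrN; exact: h.
rewrite cImM/= -!rsumZ; [|exact: csummable_Re|exact: csummable_Im].
rewrite -rsumD; first by congr rsum; apply/funext => n; rewrite cImM.
  exact/rsummableZ/csummable_Im.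
exact/rsummableZ/csummable_Re.
Qed.

Lemma csum1_le u b : rsummable b -> (forall n, (1 <= n)%N -> nc (u n) <= b n) ->
  nc (csum1 u) <= rsum b.
Proof.
move=> sb ub; have [h1 h2] := csum1_cvg (csummable_le sb ub).
apply: ler_cvg_to (nc_cvg h1 h2) (rsum_cvg sb) _.
apply: nearW => N; apply: le_trans (nc_sum _ _ _) _.
by apply: ler_sum_nat => n /andP[n1 _]; exact: ub.
Qed.

Lemma csum1R b : csum1 (fun n => (b n)%:C) = (rsum b)%:C.
Proof.
rewrite csum1E; apply: complex_ext => //=; rewrite /rsum.
under eq_fun do rewrite big1//.
exact: lim_cst.
Qed.

Lemma csum1_0 : csum1 (fun=> 0 : C) = 0.
Proof.
have -> : (fun=> 0 : C) = (fun n : nat => (0 : R)%:C) by [].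
rewrite csum1R /rsum; under eq_fun do rewrite big1//.
by rewrite lim_cst.
Qed.

End Csum.

Section CsumMeasurable.
Variable R : realType.
Local Notation C := R[i].

(** The limit need not exist everywhere: the set of convergence is given by the
    Cauchy criterion, and off it the limit has a default value. *)
Lemma measurable_limn (f : nat -> R -> R) :
  (forall n, measurable_fun [set: R] (f n)) ->
  measurable_fun [set: R] (fun x => limn (fun n => f n x)).
Proof.
move=> mf; pose D := [set x : R | cvgn (fun n => f n x)].
have mD : measurable D.
  have -> : D = \bigcap_k \bigcup_N \bigcap_n
     [set x | `|f (N + n)%N x - f N x| < k.+1%:R^-1].
    apply/seteqP; split=> x /=.
      move=> /cvg_ex[l /cvgrPdist_lt fl] k _.
      have k0 : 0 < k.+1%:R^-1 / 2 :> R by rewrite divr_gt0// invr_gt0.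
      have [N _ h] := fl _ k0.
      exists N => // n _ /=.
      have h1 := h _ (leq_addr n N); have h2 := h _ (leqnn N).
      rewrite (splitr (k.+1%:R^-1)); apply: le_lt_trans (ltrD h1 h2).
      by rewrite -[X in _ <= X + _]distrC; exact: ler_distD.
    move=> h; apply/cauchy_cvgP/cauchy_exP => e e0.
    have [k ke] : exists k : nat, k.+1%:R^-1 < e.
      exists (Num.truncn e^-1); rewrite invf_plt ?posrE//.
      exact: truncnS_gt.
    have [N _ hN] := h k I; exists (f N x); exists N => // n /= Nn.
    rewrite /ball/= distrC; apply: lt_trans ke.
    by have := hN (n - N)%N I; rewrite subnKC.
  apply: bigcapT_measurable => k; apply: bigcupT_measurable => N.
  apply: bigcapT_measurable => n.
  rewrite -[X in measurable X]setTI.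
  apply: (measurable_fun_ltr _ (measurable_cst _)) => //.
  by apply: measurableT_comp => //; exact: measurable_funB.
rewrite -(setUv D); apply/measurable_funU => //; first exact: measurableC.
split.
  apply: (@measurable_fun_cvg _ _ _ D f) => //.
  by move=> n; exact: measurable_funTS.
apply: (@eq_measurable_fun _ _ _ _ _ (cst point)); last exact: measurable_cst.
by move=> x; rewrite inE/= => /dvgP ->.
Qed.

Lemma cmeas_csum1 (u : R -> nat -> C) : (forall n, cmeas (fun x => u x n)) ->
  cmeas (fun x => csum1 (u x)).
Proof.
by move=> mu; split => /=; apply: measurable_limn => N;
  apply: measurable_sum => n; case: (mu n).
Qed.

End CsumMeasurable.

(** * Sums over the translates of a function *)

Section Periodization.
Variable R : realType.
Local Notation mu := (@lebesgue_measure R).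
Local Notation C := R[i].

Definition Gt1 : set R := `]1, +oo[.

Lemma measurable_Iunit : measurable (@Iunit R).
Proof. exact: measurable_itv. Qed.
Lemma measurable_Rpos : measurable (@Rpos R).
Proof. exact: measurable_itv. Qed.
Lemma measurable_Gt1 : measurable Gt1.
Proof. exact: measurable_itv. Qed.
Hint Resolve measurable_Iunit measurable_Rpos measurable_Gt1 : core.

Lemma IunitE (x : R) : Iunit x <-> 0 < x < 1.
Proof. by rewrite /Iunit/= in_itv. Qed.
Lemma RposE (x : R) : Rpos x <-> 0 < x.
Proof. by rewrite /Rpos/= in_itv/= andbT. Qed.
Lemma Gt1E (x : R) : Gt1 x <-> 1 < x.
Proof. by rewrite /Gt1/= in_itv/= andbT. Qed.

Lemma zextT (D : set R) (f : R -> C) x : D x -> zext D f x = f x.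
Proof. by rewrite /zext => Dx; rewrite mem_set. Qed.
Lemma zextF (D : set R) (f : R -> C) x : ~ D x -> zext D f x = 0.
Proof. by rewrite /zext => Dx; rewrite memNset. Qed.

(** The translates of the unit interval tile the half-line. *)
Lemma unfold_ge0 (f : R -> \bar R) : measurable_fun [set: R] f ->
  (forall x, 0 <= f x)%E ->
  (\int[mu]_(x in @Iunit R) (\sum_(n <oo) f (x + n.+1%:R)%R) =
   \int[mu]_(x in Gt1) f x)%E.
Proof.
move=> mf f0.
have mshift (a : R) : measurable_fun [set: R] (fun x => f (x + a)).
  by apply: (measurableT_comp mf); exact: measurable_funD.
rewrite integral_nneseries//=; last first.
  by move=> n; apply: measurable_funTS; exact: mshift.
have E n : (\int[mu]_(x in @Iunit R) f (x + n.+1%:R)%R =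
    \int[mu]_(x in [set` `[n.+1%:R, n.+2%:R[%R]) f x)%E.
  rewrite -integral_itv_obnd_cbnd; last exact: measurable_funTS.
  set D : set R := [set` `]n.+1%:R, n.+2%:R[].
  rewrite integral_mkcond [RHS]integral_mkcond -(@integral_shift R n.+1%:R (f \_ D)).
  - apply: eq_integral => x _; rewrite !patchE /Iunit /D !mem_setE !in_itv/=.
    have -> : (0 < x < 1) = (n.+1%:R < x + n.+1%:R < n.+2%:R).
      by rewrite ltrDr -[in RHS](natr1 n.+1) addrC [in RHS]ltrD2l.
    by [].
  - apply/(measurable_restrictT f); first exact: measurable_itv.
    exact: measurable_funTS.
  - by move=> x; rewrite patchE; case: ifP.
under eq_eseriesr do rewrite E.
rewrite /Gt1 integral_itv_obnd_cbnd; last exact: measurable_funTS.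
rewrite -ge0_integral_bigcup//=; first last.
- apply/trivIsetP => i j _ _ ij; apply/seteqP; split => x//=.
  rewrite !in_itv/= => -[/andP[h1 h2] /andP[h3 h4]].
  case: (ltngtP i j) ij => // ij _.
    have ij' : i.+2%:R <= j.+1%:R :> R by rewrite ler_nat.
    by have := lt_le_trans h2 (le_trans ij' h3); rewrite ltxx.
  have ij' : j.+2%:R <= i.+1%:R :> R by rewrite ler_nat.
  by have := lt_le_trans h4 (le_trans ij' h1); rewrite ltxx.
- exact: measurable_funTS.
congr integral; apply/seteqP; split => x /=.
  by move=> [n _]; rewrite /= !in_itv/= andbT => /andP[h _]; rewrite (le_trans _ h)// ler1n.
rewrite in_itv/= andbT => x1; exists (Num.truncn x).-1 => //=.
have x0 : 0 <= x by exact: le_trans x1.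
have := truncn_itv x0; rewrite in_itv/=.
have t0 : (0 < Num.truncn x)%N by rewrite truncn_gt0.
by rewrite prednK.
Qed.

Lemma rsum_nneseries (a : nat -> R) : (forall n, 0 <= a n) -> rsummable a ->
  (rsum a)%:E = (\sum_(n <oo) (a n.+1)%:E)%E.
Proof.
move=> a0 sa; apply/esym/cvg_lim => //.
rewrite (_ : (fun n => _) = EFin \o (fun N => \sum_(1 <= n < N.+1) a n)).
  by apply: cvg_EFin; [exact: nearW|exact: rsum_cvg].
by apply/funext => N /=; rewrite big_add1/= sumEFin.
Qed.

Lemma rsummable_nneseries (a : nat -> R) : (forall n, 0 <= a n) ->
  (\sum_(n <oo) (a n.+1)%:E < +oo)%E -> rsummable a.
Proof.
move=> a0 aoo; exists (fine (\sum_(n <oo) (a n.+1)%:E)%E) => N.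
rewrite -lee_fin fineK; last first.
  by rewrite ge0_fin_numE//; apply: nneseries_ge0 => n _ _; rewrite lee_fin.
under eq_bigr do rewrite ger0_norm//.
rewrite big_add1/= -sumEFin; apply: nneseries_lim_ge => n _ _.
by rewrite lee_fin.
Qed.

Section Absolute.
Variable h : R -> C.
Hypothesis hi : cintegrable h.

Definition abs_periodization x : \bar R := (\sum_(n <oo) (nc (h (x + n.+1%:R)))%:E)%E.

Lemma abs_periodization_ge0 x : (0 <= abs_periodization x)%E.
Proof. by apply: nneseries_ge0 => n _ _; rewrite lee_fin nc_ge0. Qed.

Let mh : cmeas h := cintegrable_cmeas hi.

Let mshift (a : R) : measurable_fun [set: R] (fun x => (nc (h (x + a)))%:E).
Proof.
by apply: emeasurable_nc; apply: cmeas_comp mh; exact: measurable_funD.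
Qed.

Lemma measurable_abs_periodization (D : set R) : measurable_fun D abs_periodization.
Proof.
apply: measurable_funTS.
apply: ge0_emeasurable_sum => [n x _ _|n _]; last exact: mshift.
by rewrite lee_fin nc_ge0.
Qed.

Lemma integral_abs_periodization :
  (\int[mu]_(x in @Iunit R) abs_periodization x = \int[mu]_(x in Gt1) (nc (h x))%:E)%E.
Proof.
rewrite -unfold_ge0//; first exact: emeasurable_nc.
by move=> x; rewrite lee_fin nc_ge0.
Qed.

Lemma integral_sub_L1norm (D : set R) : measurable D ->
  (\int[mu]_(x in D) (nc (h x))%:E <= L1norm h)%E.
Proof.
move=> mD; apply: ge0_subset_integral => //; first exact: emeasurable_nc.
by move=> x _; rewrite lee_fin nc_ge0.
Qed.

Lemma integral_nc_lty (D : set R) : measurable D ->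
  (\int[mu]_(x in D) (nc (h x))%:E < +oo)%E.
Proof.
by move=> mD; apply: le_lt_trans (integral_sub_L1norm mD) _; rewrite L1normE// ltry.
Qed.

Lemma integrable_abs_periodization : mu.-integrable (@Iunit R) abs_periodization.
Proof.
apply/integrableP; split; first exact: measurable_abs_periodization.
under eq_integral do rewrite gee0_abs ?abs_periodization_ge0//.
by rewrite integral_abs_periodization integral_nc_lty.
Qed.

(** The sum of the norms has a finite integral, hence is finite almost everywhere. *)
Lemma ae_csummable :
  {ae mu, forall x, Iunit x -> csummable (fun n => h (x + n%:R))}.
Proof.
have /(_ measurable_Iunit) := integrable_ae _ integrable_abs_periodization.
apply: aeS => x H /H fin.
have [B hB] : rsummable (fun n => nc (h (x + n%:R))).
  apply: rsummable_nneseries; first by move=> n; exact: nc_ge0.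
  by rewrite -ge0_fin_numE//; exact: abs_periodization_ge0.
by exists B => N; apply: le_trans (hB N); apply: ler_sum => n _; exact: ler_norm.
Qed.

End Absolute.

Lemma csummable_unit (w : C) (u : nat -> C) : `|w| = 1 -> csummable u ->
  csummable (fun n => w ^+ n * u n).
Proof.
move=> w1 [B uB]; exists B => N; apply: le_trans (uB N).
by apply: ler_sum => n _; rewrite ncM ncX nc_unit// expr1n mul1r.
Qed.

Section Sop.
Variable w : C.
Hypothesis w1 : `|w| = 1.
Implicit Types h k : R -> C.

Lemma ae_csummable_twist h : cintegrable h ->
  {ae mu, forall x, Iunit x -> csummable (fun n => w ^+ n * h (x + n%:R))}.
Proof. by move=> /ae_csummable; apply: aeS => x H /H; exact: csummable_unit. Qed.

Lemma cmeas_Sop h : cmeas h -> cmeas (Sop w h).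
Proof.
move=> mh; apply: cmeas_zext => //; apply: cmeas_csum1 => n.
apply: cmeasM; first exact: cmeas_cst.
by apply: cmeas_comp mh; exact: measurable_funD.
Qed.

Lemma Sop_out h x : ~ Iunit x -> Sop w h x = 0.
Proof. exact: zextF. Qed.

Lemma SopE h x : Iunit x -> Sop w h x = csum1 (fun n => w ^+ n * h (x + n%:R)).
Proof. exact: zextT. Qed.

Lemma L1norm_on (D : set R) h : measurable D -> (forall x, ~ D x -> h x = 0) ->
  L1norm h = (\int[mu]_(x in D) (nc (h x))%:E)%E.
Proof.
move=> mD h0; rewrite [RHS]integral_mkcond; apply: eq_integral => x _.
rewrite patchE; case: ifPn => //; rewrite notin_setE => /h0 ->.
by rewrite nc0.
Qed.

Lemma L1norm_Sop h : cintegrable h ->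
  (L1norm (Sop w h) <= \int[mu]_(x in Gt1) (nc (h x))%:E)%E.
Proof.
move=> hi; have mh := cintegrable_cmeas hi.
rewrite (L1norm_on measurable_Iunit (@Sop_out h)) -integral_abs_periodization//.
apply: ae_ge0_le_integral => //.
- by move=> x _; rewrite lee_fin nc_ge0.
- by apply: measurable_funTS; apply: emeasurable_nc; exact: cmeas_Sop.
- by move=> x _; exact: abs_periodization_ge0.
- exact: measurable_abs_periodization.
move: (ae_csummable hi); apply: aeS => x H Ix; have /csummable_nc sh := H Ix.
rewrite /abs_periodization -(rsum_nneseries (a := fun n => nc (h (x + n%:R))))//; last first.
  by move=> n; exact: nc_ge0.
rewrite lee_fin SopE//; apply: csum1_le => // n _.
by rewrite ncM ncX nc_unit// expr1n mul1r.
Qed.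

Lemma cintegrable_Sop h : cintegrable h -> cintegrable (Sop w h).
Proof.
move=> hi; apply/cintegrableP; split; first exact/cmeas_Sop/cintegrable_cmeas.
apply: le_lt_trans (L1norm_Sop hi) _; exact: integral_nc_lty.
Qed.

Lemma l1_Sop h : cintegrable h -> l1 (Sop w h) <= l1 h.
Proof.
move=> hi; rewrite -lee_fin -!L1normE//; last exact: cintegrable_Sop.
apply: le_trans (L1norm_Sop hi) _; exact: integral_sub_L1norm.
Qed.

(** The identity may fail at points where one of the series diverges, because the
    value of the sum is arbitrary there. *)
Lemma SopD h k : cintegrable h -> cintegrable k ->
  eqae (Sop w (fun x => h x + k x)) (fun x => Sop w h x + Sop w k x).
Proof.
move=> /ae_csummable_twist hi /ae_csummable_twist ki.
move: hi ki; apply: aeS2 => x hi ki _.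
have [Ix|Ix] := pselect (Iunit x); last by rewrite !Sop_out// addr0.
rewrite !SopE// -csum1D; [|exact: hi|exact: ki].
by congr csum1; apply/funext => n; rewrite mulrDr.
Qed.

Lemma SopZ (c : C) h : cintegrable h ->
  eqae (Sop w (fun x => c * h x)) (fun x => c * Sop w h x).
Proof.
move=> /ae_csummable_twist; apply: aeS => x hi _.
have [Ix|Ix] := pselect (Iunit x); last by rewrite !Sop_out// mulr0.
rewrite !SopE// -csum1M; last exact: hi.
by congr csum1; apply/funext => n; rewrite mulrCA.
Qed.

Lemma SopN h : cintegrable h ->
  eqae (Sop w (fun x => - h x)) (fun x => - Sop w h x).
Proof.
move=> hi; have -> : (fun x => - h x) = (fun x => (-1) * h x).
  by apply/funext => x; rewrite mulN1r.
by apply: aeS (SopZ (-1) hi) => x H _; rewrite H// mulN1r.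
Qed.

Lemma SopB h k : cintegrable h -> cintegrable k ->
  eqae (Sop w (fun x => h x - k x)) (fun x => Sop w h x - Sop w k x).
Proof.
move=> hi ki; apply: eqae_trans (SopD hi (cintegrableN ki)) _.
by apply: aeS (SopN ki) => x H _; rewrite H.
Qed.

Lemma Sop_eqae h k : cintegrable h -> cintegrable k -> eqae h k ->
  eqae (Sop w h) (Sop w k).
Proof.
move=> hi ki hk.
have hki := cintegrableB hi ki.
have l0 : l1 (fun x => h x - k x) = 0.
  rewrite -(@l1_0 R); apply: l1_eqae; [exact: cintegrable_cmeas|exact: cmeas_cst|].
  by apply: aeS hk => x H _; rewrite H// subrr.
have S0 : l1 (Sop w (fun x => h x - k x)) = 0.
  by apply/eqP; rewrite eq_le l1_ge0 -{1}l0 l1_Sop.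
have := l1_eq0 (cintegrable_Sop hki) S0.
move: (SopB hi ki); apply: aeS2 => x H1 H2 _; apply/eqP.
by rewrite -subr_eq0 -H1// H2.
Qed.

End Sop.
End Periodization.
#[export] Hint Resolve measurable_Iunit measurable_Rpos measurable_Gt1 : core.

Section Mean.
Variable R : realType.
Local Notation mu := (@lebesgue_measure R).
Local Notation C := R[i].

Let unfold_integrable (a : R -> R) : mu.-integrable [set: R] (EFin \o a) ->
  (forall x, 0 <= a x) ->
  mu.-integrable (@Iunit R) (fun x => \sum_(n <oo) (a (x + n.+1%:R))%:E)%E /\
  (\int[mu]_(x in @Iunit R) (\sum_(n <oo) (a (x + n.+1%:R))%:E) =
  \int[mu]_(x in @Gt1 R) (a x)%:E)%E.
Proof.
move=> ai a0.
have ma : measurable_fun [set: R] (EFin \o a) by exact: measurable_int ai.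
have E := @unfold_ge0 R (EFin \o a) ma (fun x => a0 x); split=> //.
apply/integrableP; split.
  apply: measurable_funTS; apply: ge0_emeasurable_sum => [n x _ _|n _].
    by rewrite lee_fin.
  by apply: (measurableT_comp ma); exact: measurable_funD.
have Gi : mu.-integrable (@Gt1 R) (EFin \o a).
  by apply: integrableS ai => //; exact: measurable_Gt1.
have absE (D : set R) (g : R -> \bar R) : (forall x, 0 <= g x)%E ->
    (\int[mu]_(x in D) `|g x| = \int[mu]_(x in D) g x)%E.
  by move=> g0; apply: eq_integral => x _; rewrite gee0_abs.
rewrite absE => [|x]; last by apply: nneseries_ge0 => n _ _; rewrite lee_fin.
by rewrite E -absE//; case/integrableP: Gi.
Qed.

Lemma integral_periodization (f : R -> R) : mu.-integrable [set: R] (EFin \o f) ->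
  (\int[mu]_(x in @Iunit R) (rsum (fun n => f (x + n%:R)))%:E =
   \int[mu]_(x in @Gt1 R) (f x)%:E)%E.
Proof.
move=> fi; have mf : measurable_fun [set: R] f.
  by apply/measurable_EFinP; exact: measurable_int fi.
(* Adding |f| reduces the identity to nonnegative functions. *)
pose a x := `|f x| + f x; pose b x := `|f x|.
have a0 x : 0 <= a x by rewrite /a addrC -lerBlDr sub0r; exact: lerNnormlW.
have b0 x : 0 <= b x by exact: normr_ge0.
have bi : mu.-integrable [set: R] (EFin \o b).
  by move/integrable_abse: fi.
have ai : mu.-integrable [set: R] (EFin \o a).
  by rewrite (_ : EFin \o a = (EFin \o b) \+ (EFin \o f))%E//; exact: integrableD.
have [Ai AE] := unfold_integrable ai a0.
have [Bi BE] := unfold_integrable bi b0.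
have fci : cintegrable (fun x => (f x)%:C) by split => //=; exact: integrable0.
transitivity (\int[mu]_(x in @Iunit R)
   (\sum_(n <oo) (a (x + n.+1%:R)%R)%:E - \sum_(n <oo) (b (x + n.+1%:R)%R)%:E))%E; last first.
  rewrite integralB//; last exact: measurable_Iunit.
  rewrite AE BE -integralB; [|exact: measurable_Gt1| |].
  + by apply: eq_integral => x _; rewrite -EFinB /a addrAC subrr add0r.
  + by apply: integrableS ai => //; exact: measurable_Gt1.
  + by apply: integrableS bi => //; exact: measurable_Gt1.
apply: ae_eq_integral.
- exact: measurable_Iunit.
- apply: measurable_funTS; apply/measurable_EFinP; apply: measurable_limn => N.
  apply: measurable_sum => n; apply: (measurableT_comp mf); exact: measurable_funD.
- by apply: emeasurable_funB; [exact: measurable_int Ai|exact: measurable_int Bi].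
move: (ae_csummable fci); apply: aeS => x H Ix; have {H} := H Ix.
move=> /csummable_nc; under eq_fun do rewrite ncR.
move=> [B hB].
have fs : rsummable (fun n => f (x + n%:R)).
  by exists B => N; apply: le_trans (hB N); apply: ler_sum => n _; rewrite normr_id.
have bs : rsummable (fun n => b (x + n%:R)) by exists B.
have as_ : rsummable (fun n => a (x + n%:R)) by exact: rsummableD bs fs.
have EA := rsum_nneseries (fun n => a0 (x + n%:R)) as_.
have EB := rsum_nneseries (fun n => b0 (x + n%:R)) bs.
have ED := rsumD bs fs.
transitivity ((rsum (fun n => a (x + n%:R)))%:E - (rsum (fun n => b (x + n%:R)))%:E)%E; last by rewrite EA EB.
rewrite -EFinB; congr EFin; apply/eqP; rewrite eq_sym subr_eq addrC; apply/eqP.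
exact: ED.
Qed.

Lemma cintegral_ext (D : set R) (f g : R -> C) :
  (forall x, D x -> f x = g x) -> cintegral D f = cintegral D g.
Proof.
move=> fg; rewrite /cintegral /Rintegral; congr (fine _ +i* fine _);
  by apply: eq_integral => x; rewrite inE => /fg ->.
Qed.

Lemma cintegral_zext (D E : set R) (f : R -> C) : measurable D -> measurable E ->
  (forall x, D x -> E x) -> (forall x, E x -> ~ D x -> f x = 0) ->
  cintegral D f = cintegral E f.
Proof.
move=> mD mE DE f0; rewrite /cintegral /Rintegral; congr (fine _ +i* fine _);
  rewrite [LHS]integral_mkcond [RHS]integral_mkcond;
  apply: eq_integral => x _; rewrite !patchE.
all: have [Dx|Dx] := pselect (D x); first by rewrite !mem_set//; exact: DE.
all: rewrite (memNset Dx); case: ifPn => //; rewrite inE => /f0 /(_ Dx) -> //.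
Qed.

Lemma cintegral_Sop1 (h : R -> C) : cintegrable h ->
  cintegral (@Iunit R) (Sop 1 h) = cintegral (@Gt1 R) h.
Proof.
move=> [h1 h2]; rewrite /cintegral /Rintegral; congr (fine _ +i* fine _).
  rewrite -integral_periodization//; apply: eq_integral => x; rewrite inE => Ix.
  rewrite SopE//= /rsum; congr (limn _)%:E; apply/funext => N.
  by apply: eq_bigr => n _; rewrite expr1n mul1r.
rewrite -integral_periodization//; apply: eq_integral => x; rewrite inE => Ix.
rewrite SopE//= /rsum; congr (limn _)%:E; apply/funext => N.
by apply: eq_bigr => n _; rewrite expr1n mul1r.
Qed.

End Mean.

(** * The inversion *)

Section Jop.
Variable R : realType.
Local Notation mu := (@lebesgue_measure R).
Local Notation C := R[i].
Variable q : R.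
Hypothesis q0 : 0 < q.
Implicit Types h k : R -> C.

Lemma JopE h x : 0 < x -> Jop q h x = (q / x ^+ 2)%:C * h (q / x).
Proof. by move=> x0; rewrite /Jop zextT//; exact/RposE. Qed.

Lemma Jop_out h x : ~ Rpos x -> Jop q h x = 0.
Proof. exact: zextF. Qed.

Let measurable_q_div : measurable_fun [set: R] (fun x => q / x).
Proof. by apply: measurable_funM => //; exact: measurable_invr. Qed.

Let measurable_q_divsq : measurable_fun [set: R] (fun x => q / x ^+ 2).
Proof.
apply: measurable_funM => //; apply: (measurableT_comp (@measurable_invr R)).
exact: measurable_funX.
Qed.

Lemma cmeas_Jop h : cmeas h -> cmeas (Jop q h).
Proof.
move=> mh; apply: cmeas_zext => //.
by apply: cmeasM; [exact: cmeasR|exact: cmeas_comp].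
Qed.

Lemma L1norm_Jop h : cmeas h ->
  L1norm (Jop q h) = (\int[mu]_(x in @Rpos R) (nc (h x))%:E)%E.
Proof.
move=> mh; rewrite (L1norm_on (@measurable_Rpos R) (@Jop_out h)).
rewrite -(@integral_inversion R q q0 (fun x => (nc (h x))%:E)).
- apply: eq_integral => x; rewrite inE => /RposE x0.
  rewrite JopE// ncM ncR ger0_norm -?EFinM//.
  by apply: divr_ge0; rewrite ?exprn_ge0// ltW.
- exact: emeasurable_nc.
- by move=> x; rewrite lee_fin nc_ge0.
Qed.

Lemma cintegrable_Jop h : cintegrable h -> cintegrable (Jop q h).
Proof.
move=> hi; have mh := cintegrable_cmeas hi.
apply/cintegrableP; split; first exact: cmeas_Jop.
by rewrite L1norm_Jop//; apply: integral_nc_lty => //; exact: measurable_Rpos.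
Qed.

Lemma l1_Jop h : cintegrable h -> l1 (Jop q h) <= l1 h.
Proof.
move=> hi; rewrite -lee_fin -!L1normE//; last exact: cintegrable_Jop.
rewrite L1norm_Jop; last exact: cintegrable_cmeas.
by apply: integral_sub_L1norm => //; exact: measurable_Rpos.
Qed.

Lemma JopK h x : 0 < x -> Jop q (Jop q h) x = h x.
Proof.
move=> x0; have qx : 0 < q / x by exact: divr_gt0.
rewrite !JopE// mulrA -rmorphM.
have -> : q / (q / x) = x by rewrite invf_div mulrCA divff ?gt_eqF// mulr1.
have -> : q / x ^+ 2 * (q / (q / x) ^+ 2) = 1.
  by field; rewrite !gt_eqF.
by rewrite mul1r.
Qed.

Lemma JopD h k : Jop q (fun x => h x + k x) = (fun x => Jop q h x + Jop q k x).
Proof.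
apply/funext => x; have [Px|Px] := pselect (Rpos x); last by rewrite !Jop_out// addr0.
by have /RposE x0 := Px; rewrite !JopE// mulrDr.
Qed.

Lemma JopZ (c : C) h : Jop q (fun x => c * h x) = (fun x => c * Jop q h x).
Proof.
apply/funext => x; have [Px|Px] := pselect (Rpos x); last by rewrite !Jop_out// mulr0.
by have /RposE x0 := Px; rewrite !JopE// mulrCA.
Qed.

Lemma JopN h : Jop q (fun x => - h x) = (fun x => - Jop q h x).
Proof.
apply/funext => x; have [Px|Px] := pselect (Rpos x); last by rewrite !Jop_out// oppr0.
by have /RposE x0 := Px; rewrite !JopE// mulrN.
Qed.

Lemma Jop_eqae h k : cintegrable h -> cintegrable k -> eqae h k ->
  eqae (Jop q h) (Jop q k).
Proof.
move=> hi ki hk.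
have hki := cintegrableB hi ki.
have l0 : l1 (fun x => h x - k x) = 0.
  rewrite -(@l1_0 R); apply: l1_eqae; [exact: cintegrable_cmeas|exact: cmeas_cst|].
  by apply: aeS hk => x H _; rewrite H// subrr.
have S0 : l1 (Jop q (fun x => h x - k x)) = 0.
  by apply/eqP; rewrite eq_le l1_ge0 -{1}l0 l1_Jop.
have := l1_eq0 (cintegrable_Jop hki) S0.
rewrite JopD JopN; apply: aeS => x H1 _; apply/eqP.
by rewrite -subr_eq0 H1.
Qed.

Let integral_inversion_signed (f : R -> R) : measurable_fun [set: R] f ->
  (\int[mu]_(x in @Rpos R) (q / x ^+ 2 * f (q / x))%:E =
   \int[mu]_(x in @Rpos R) (f x)%:E)%E.
Proof.
move=> mf; rewrite integralE [RHS]integralE.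
have ef : measurable_fun [set: R] (EFin \o f) by apply/measurable_EFinP.
rewrite -(@integral_inversion R q q0 (fun x => (EFin \o f)^\+ x)%E); first last.
- by move=> x; exact: funepos_ge0.
- exact: measurable_funepos.
rewrite -(@integral_inversion R q q0 (fun x => (EFin \o f)^\- x)%E); first last.
- by move=> x; exact: funeneg_ge0.
- exact: measurable_funeneg.
have w0 x : Rpos x -> 0 <= q / x ^+ 2.
  by move=> /RposE x0; apply: divr_ge0; rewrite ?exprn_ge0// ltW.
congr (_ - _)%E; apply: eq_integral => x; rewrite inE => Px.
  by rewrite !funeposE /= -!EFin_max -EFinM maxr_pMr ?w0// mulr0.
by rewrite !funenegE /= -!EFin_max -EFinM maxr_pMr ?w0// mulr0 mulrN.
Qed.

Lemma cintegral_Jop h : cintegrable h ->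
  cintegral (@Rpos R) (Jop q h) = cintegral (@Rpos R) h.
Proof.
move=> hi; have [m1 m2] := cintegrable_cmeas hi.
rewrite /cintegral /Rintegral; congr (fine _ +i* fine _).
  rewrite -(@integral_inversion_signed (fun x => complex.Re (h x)))//; apply: eq_integral => x.
  by rewrite inE => /RposE x0; rewrite JopE// cReM /= mul0r subr0.
rewrite -(@integral_inversion_signed (fun x => complex.Im (h x)))//; apply: eq_integral => x.
by rewrite inE => /RposE x0; rewrite JopE// cImM /= mul0r addr0.
Qed.

(** Inversion turns the inverse branches q / (n + x) into translates. *)
Lemma LopE w h : Lop w q h = Sop w (Jop q h).
Proof.
rewrite /Lop /Sop; apply/funext => x; rewrite /zext; case: ifPn => //.
rewrite inE => /IunitE /andP[x0 _]; congr csum1; apply/funext => n.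
have xn : 0 < x + n%:R by rewrite ltr_wpDr.
by rewrite JopE// mulrA [n%:R + x]addrC.
Qed.

End Jop.

(** * Trigonometric polynomials *)

Section Cis.
Variable R : realType.
Local Notation C := R[i].

Lemma cis0 : cis (0 : R) = 1.
Proof. by rewrite /cis cos0 sin0. Qed.

Lemma cisD (x y : R) : cis (x + y) = cis x * cis y.
Proof.
by rewrite /cis cosD sinD; apply: complex_ext; rewrite ?cReM ?cImM/=; ring.
Qed.

Lemma nc_cis (x : R) : nc (cis x) = 1.
Proof. by rewrite normc_def /= cos2Dsin2 sqrtr1. Qed.

Lemma cisMn (n : nat) (x : R) : cis (x *+ n) = cis x ^+ n.
Proof. by elim: n => [|n IH]; rewrite ?mulr0n ?cis0// mulrS cisD IH exprS. Qed.

Lemma cis2pi : cis (2 * pi : R) = 1.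
Proof. by rewrite /cis mulr_natl cos2pi sin2pi. Qed.

Lemma cisN (x : R) : cis (- x) = (cis x)^-1.
Proof.
have u : cis x != 0.
  by apply/eqP => h; have := nc_cis x; rewrite h nc0 => /eqP; rewrite eq_sym oner_eq0.
by apply: (mulfI u); rewrite divff// -cisD subrr cis0.
Qed.

Lemma cis_2pi_nat (n : nat) : cis (2 * pi * n%:R : R) = 1.
Proof. by rewrite mulr_natr cisMn cis2pi expr1n. Qed.

Lemma cis_2pi_int (m : int) : cis (2 * pi * m%:~R : R) = 1.
Proof.
case: (intP m) => [|n|n]; first by rewrite mulr0 cis0.
  exact: cis_2pi_nat.
by rewrite mulrNz mulrN cisN cis_2pi_nat invr1.
Qed.

Lemma measurable_sin : measurable_fun [set: R] (@sin R).
Proof. by apply: continuous_measurable_fun; exact: continuous_sin. Qed.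
Lemma measurable_cos : measurable_fun [set: R] (@cos R).
Proof. by apply: continuous_measurable_fun; exact: continuous_cos. Qed.

Lemma cmeas_cis (t : R -> R) : measurable_fun [set: R] t ->
  cmeas (fun x => cis (t x)).
Proof.
move=> mt; split => /=.
  exact: (measurableT_comp measurable_cos mt).
exact: (measurableT_comp measurable_sin mt).
Qed.

Lemma cintegrable_cis (f : R -> C) (t : R -> R) : measurable_fun [set: R] t ->
  cintegrable f -> cintegrable (fun x => f x * cis (t x)).
Proof.
move=> mt fi; under eq_fun do rewrite mulrC.
by apply: (@cintegrable_mulb R 1) => //; [exact: cmeas_cis|move=> x; rewrite nc_cis].
Qed.

End Cis.

Section CintegralLinear.
Variable R : realType.
Local Notation mu := (@lebesgue_measure R).
Local Notation C := R[i].
Variables (D : set R) (mD : measurable D).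

Let iRe (f : R -> C) : cintegrable f -> mu.-integrable D (EFin \o (fun x => complex.Re (f x))).
Proof. by move=> [f1 _]; exact: integrableS f1. Qed.
Let iIm (f : R -> C) : cintegrable f -> mu.-integrable D (EFin \o (fun x => complex.Im (f x))).
Proof. by move=> [_ f1]; exact: integrableS f1. Qed.

Lemma cintegral0 : cintegral D (fun=> 0 : C) = 0.
Proof. by rewrite /cintegral /Rintegral /= integral0. Qed.

Lemma cintegralD (f g : R -> C) : cintegrable f -> cintegrable g ->
  cintegral D (fun x => f x + g x) = cintegral D f + cintegral D g.
Proof.
move=> fi gi; rewrite /cintegral; apply: complex_ext => /=.
  rewrite -RintegralD//; [|exact: iRe..].
  by apply: eq_Rintegral => x _; rewrite cReD.
rewrite -RintegralD//; [|exact: iIm..].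
by apply: eq_Rintegral => x _; rewrite cImD.
Qed.

Lemma cintegralZ (c : C) (f : R -> C) : cintegrable f ->
  cintegral D (fun x => c * f x) = c * cintegral D f.
Proof.
move=> fi; have i1 := iRe fi; have i2 := iIm fi.
have Z (a : R) (u : R -> R) : mu.-integrable D (EFin \o u) ->
    mu.-integrable D (EFin \o (fun x => a * u x)).
  by move=> ui; exact: (integrableZl _ a ui).
rewrite /cintegral; apply: complex_ext; rewrite ?cReM ?cImM /=.
  rewrite -!RintegralZl// -RintegralB//; [|exact: Z..].
  by apply: eq_Rintegral => x _; rewrite cReM.
rewrite -!RintegralZl// -RintegralD//; [|exact: Z..].
by apply: eq_Rintegral => x _; rewrite cImM.
Qed.

End CintegralLinear.

Section TrigPoly.
Variable R : realType.
Local Notation mu := (@lebesgue_measure R).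
Local Notation C := R[i].

Definition trig_poly (s : seq (C * int)) (x : R) : C :=
  \sum_(p <- s) p.1 * cis (2 * pi * p.2%:~R * x).

Definition is_trig (f : R -> C) := exists s, f = trig_poly s.

Lemma is_trig_cis (c : C) (m : int) : is_trig (fun x => c * cis (2 * pi * m%:~R * x)).
Proof. by exists [:: (c, m)]; apply/funext => x; rewrite /trig_poly big_seq1. Qed.

Lemma is_trig_cst (c : C) : is_trig (fun=> c).
Proof.
rewrite (_ : (fun=> c) = (fun x => c * cis (2 * pi * 0%:~R * x))).
  exact: is_trig_cis.
by apply/funext => x; rewrite mulr0z mulr0 mul0r cis0 mulr1.
Qed.

Lemma is_trigD f g : is_trig f -> is_trig g -> is_trig (fun x => f x + g x).
Proof.
move=> [s ->] [t ->]; exists (s ++ t); apply/funext => x.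
by rewrite /trig_poly big_cat.
Qed.

Lemma is_trigM f g : is_trig f -> is_trig g -> is_trig (fun x => f x * g x).
Proof.
move=> [s ->] [t ->].
exists [seq (p.1 * r.1, p.2 + r.2) | p <- s, r <- t]; apply/funext => x.
rewrite /trig_poly big_allpairs_dep mulr_suml; apply: eq_bigr => p _.
rewrite mulr_sumr; apply: eq_bigr => r _ /=.
have -> : 2 * pi * (p.2 + r.2)%:~R * x =
  2 * pi * p.2%:~R * x + 2 * pi * r.2%:~R * x :> R by rewrite intrD; ring.
by rewrite cisD; ring.
Qed.

Lemma is_trigX f n : is_trig f -> is_trig (fun x => f x ^+ n).
Proof.
move=> tf; elim: n => [|n IH]; first exact: is_trig_cst.
by under eq_fun do rewrite exprS; exact: is_trigM.
Qed.

Lemma is_trig_cos (a : R) : is_trig (fun x => (cos (2 * pi * x - a))%:C).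
Proof.
rewrite (_ : (fun x => _) = (fun x =>
  (cis (- a) / 2) * cis (2 * pi * 1%:~R * x) + (cis a / 2) * cis (2 * pi * (-1)%:~R * x))).
  by apply: is_trigD; exact: is_trig_cis.
apply/funext => x.
rewrite !(mulrAC _ (2^-1)) -!cisD.
have -> : - a + 2 * pi * 1%:~R * x = 2 * pi * x - a by rewrite mulr1; ring.
have -> : a + 2 * pi * (-1)%:~R * x = - (2 * pi * x - a) by rewrite mulrN1; ring.
have h : (2%:R : C)^-1 = (2%:R^-1 : R)%:C by rewrite fmorphV/= rmorph_nat.
apply: complex_ext; rewrite h ?cReM ?cImM/= cosN sinN; last by ring.
by field.
Qed.

Lemma bernoulli (x : R) n : -1 <= x -> 1 + n%:R * x <= (1 + x) ^+ n.
Proof.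
move=> x1; have x0 : 0 <= 1 + x by lra.
elim: n => [|n IH]; first by rewrite mul0r addr0 expr0.
rewrite exprS; apply: le_trans (ler_wpM2l x0 IH).
rewrite -subr_ge0 -(natr1 n).
have -> : (1 + x) * (1 + n%:R * x) - (1 + (n%:R + 1) * x) = n%:R * x ^+ 2 by ring.
by rewrite mulr_ge0// sqr_ge0.
Qed.

(** The polynomials (1 - y ^ n) ^ (2 ^ n) tend to 1 on [0, 1/2[ and to 0 on
    ]1/2, 1], by Bernoulli's inequality; composed with a trigonometric
    polynomial of degree 1 that crosses 1/2 exactly at 0 and b, they approximate
    the indicator function of ]0, b[ boundedly. *)
Definition step_poly n (y : R) := (1 - y ^+ n) ^+ (2 ^ n).

Let yn01 n (y : R) : 0 <= y <= 1 -> 0 <= y ^+ n <= 1.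
Proof. by move=> /andP[y0 y1]; rewrite exprn_ge0// exprn_ile1. Qed.

Lemma step_poly01 n (y : R) : 0 <= y <= 1 -> 0 <= step_poly n y <= 1.
Proof.
move=> /(yn01 n)/andP[h1 h2].
by rewrite /step_poly exprn_ge0 ?exprn_ile1 ?subr_ge0// gerBl.
Qed.

Lemma step_poly_lt (y : R) : 0 <= y < 2^-1 -> (fun n => step_poly n y) @ \oo --> (1 : R).
Proof.
move=> /andP[y0 y2].
have y01 : 0 <= y <= 1 by rewrite y0/= (le_trans (ltW y2))// invf_le1// ler1n.
apply: (@squeeze_cvgr _ _ _ _ (fun n => 1 - (2 * y) ^+ n) (cst 1)); last 2 first.
- rewrite -[X in _ --> X]subr0; apply: cvgB; first exact: cvg_cst.
  by apply: cvg_expr; rewrite ger0_norm ?mulr_ge0// mulrC -ltr_pdivlMr// mul1r.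
- exact: cvg_cst.
apply: nearW => n; rewrite (andP (step_poly01 n y01)).2 andbT /step_poly.
have := @bernoulli (- y ^+ n) (2 ^ n); rewrite lerN2.
move=> /(_ (andP (yn01 n y01)).2); apply: le_trans.
by rewrite exprMn mulrN natrX.
Qed.

Lemma step_poly_gt (y : R) : 2^-1 < y <= 1 -> (fun n => step_poly n y) @ \oo --> (0 : R).
Proof.
move=> /andP[y2 y1].
have y0 : 0 < y by apply: lt_trans y2; rewrite invr_gt0.
have y01 : 0 <= y <= 1 by rewrite (ltW y0).
apply: (@squeeze_cvgr _ _ _ _ (cst 0) (fun n => ((2 * y)^-1) ^+ n)); last 2 first.
- exact: cvg_cst.
- apply: cvg_expr; rewrite ger0_norm ?invr_ge0 ?mulr_ge0// ?(ltW y0)//.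
  by rewrite invf_lt1 ?mulr_gt0// mulrC -ltr_pdivrMr// mul1r.
apply: nearW => n; rewrite (andP (step_poly01 n y01)).1/= /step_poly.
have /andP[h1 h2] := yn01 n y01.
have yp : 0 < y ^+ n by exact: exprn_gt0.
have B := @bernoulli (y ^+ n) (2 ^ n) (le_trans (lerN10 _) h1).
have P1 : (1 - y ^+ n) ^+ (2 ^ n) * (1 + y ^+ n) ^+ (2 ^ n) <= 1.
  rewrite -exprMn exprn_ile1//; first by rewrite mulr_ge0 ?subr_ge0// addr_ge0.
  by move: h1; set z := y ^+ n; nra.
have P2 : (2 * y) ^+ n <= (1 + y ^+ n) ^+ (2 ^ n).
  by apply: le_trans B; rewrite exprMn natrX lerDr.
rewrite exprVn -[leRHS]mul1r ler_pdivlMr; last by rewrite exprn_gt0// mulr_gt0.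
apply: le_trans P1; rewrite ler_wpM2l//.
by rewrite exprn_ge0// subr_ge0.
Qed.

Lemma trig_indicator (b : R) : 0 < b <= 1 -> exists P : nat -> R -> R,
  [/\ forall n, is_trig (fun x => (P n x)%:C),
      forall n x, 0 <= P n x <= 1,
      forall x, 0 < x < b -> P ^~ x @ \oo --> (1 : R) &
      forall x, b < x < 1 -> P ^~ x @ \oo --> (0 : R)].
Proof.
move=> /andP[b0 b1].
pose y x : R := 2^-1 - (cos (2 * pi * x - pi * b) - cos (pi * b)) / 4.
have y01 x : 0 <= y x <= 1.
  have := cos_geN1 (2 * pi * x - pi * b); have := cos_le1 (2 * pi * x - pi * b).
  have := cos_geN1 (pi * b); have := cos_le1 (pi * b); rewrite /y.
  by move=> *; apply/andP; split; lra.
have yE x : (y x)%:C = (2^-1 + cos (pi * b) / 4)%:C +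
    (- 4^-1)%:C * (cos (2 * pi * x - pi * b))%:C.
  by rewrite -rmorphM -rmorphD; apply: (congr1 (real_complex R)); rewrite /y; field.
have pp := pi_gt0 R.
have pb0 : 0 <= pi * b by rewrite mulr_ge0// ltW.
have pb1 : pi * b <= pi by rewrite -[leRHS]mulr1 ler_wpM2l// ltW.
exists (fun n x => step_poly n (y x)); split.
- move=> n.
  rewrite (_ : (fun x => _) = (fun x => (1 + (-1) * ((2^-1 + cos (pi * b) / 4)%:C + (- 4^-1)%:C * (cos (2 * pi * x - pi * b))%:C) ^+ n) ^+ (2 ^ n))).
    apply: is_trigX; apply: is_trigD; first exact: is_trig_cst.
    apply: is_trigM; first exact: is_trig_cst.
    apply: is_trigX; apply: is_trigD; first exact: is_trig_cst.
    by apply: is_trigM; [exact: is_trig_cst|exact: is_trig_cos].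
  apply/funext => x; rewrite -yE /step_poly rmorphXn; congr (_ ^+ _).
  by rewrite rmorphB rmorph1 rmorphXn mulN1r.
- by move=> n x; exact: step_poly01.
- move=> x /andP[x0 xb]; apply: step_poly_lt; rewrite (andP (y01 x)).1/= /y.
  have h : `|2 * pi * x - pi * b| < pi * b.
    by rewrite ltr_norml; apply/andP; split; nra.
  suff : cos (pi * b) < cos (2 * pi * x - pi * b) by lra.
  rewrite -(cos_norm (2 * pi * x - pi * b)) ltr_cos// in_itv/= ?pb0//.
  by rewrite normr_ge0 (le_trans (ltW h)).
- move=> x /andP[bx x1]; apply: step_poly_gt; rewrite (andP (y01 x)).2 andbT /y.
  suff : cos (2 * pi * x - pi * b) < cos (pi * b) by lra.
  case: (leP (2 * pi * x - pi * b) pi) => hx.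
    by rewrite ltr_cos ?in_itv/= ?pb0// ?hx ?andbT; nra.
  rewrite -[2 * pi * x - pi * b]opprK cosN -(cosD2pi (- _)).
  by rewrite ltr_cos ?in_itv/= ?pb0//; [nra|apply/andP; split; nra].
Qed.

End TrigPoly.

(** * Uniqueness of Fourier coefficients *)

Section Fourier.
Variable R : realType.
Local Notation mu := (@lebesgue_measure R).
Local Notation C := R[i].

Lemma ae_neq (a : R) : {ae mu, forall x, x <> a}.
Proof.
exists [set a]; split; first exact: measurable_set1.
  exact: lebesgue_measure_set1.
by move=> x /= /contrapT.
Qed.

(** The primitive of f vanishes, and its derivative is f almost everywhere. *)
Lemma ae_eq0_of_itv (f : R -> R) : mu.-integrable [set: R] (EFin \o f) ->
  (forall x, ~ Iunit x -> f x = 0) ->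
  (forall b, 0 < b <= 1 -> (\int[mu]_(x in `]0%R, b[) (f x)%:E = 0)%E) ->
  {ae mu, forall x, f x = 0}.
Proof.
move=> fi f0 H.
have mf := measurable_int _ fi.
pose F y := \int[mu]_(t in [set` Interval (BLeft 0) (BRight y)]) f t.
have F0 : F = cst 0.
  apply/funext => y; rewrite /F /Rintegral.
  have [y0|y0] := leP y 0.
    have -> : [set` Interval (BLeft 0) (BRight y)] = [set` Interval (BLeft 0) (BRight y)] `&` [set (0:R)].
      apply/seteqP; split => x /=; rewrite ?in_itv/=; last by case.
      move=> h; split=> //; apply/eqP; rewrite eq_le; case/andP: h => -> h.
      by rewrite (le_trans h).
    rewrite (_ : (\int[mu]_(x in _) _ = 0)%E) => [//|].
    rewrite integral0_eq//= => x [_ ->]; rewrite f0// => /IunitE.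
    by rewrite ltxx.
  have b01 : 0 < Num.min y 1 <= 1 by rewrite lt_min y0 ltr01 ge_min lexx orbT.
  rewrite -[RHS]/(fine 0%E) -(H _ b01); congr fine.
  rewrite integral_mkcond [RHS]integral_mkcond; apply: ae_eq_integral => //.
  - apply/(measurable_restrictT _ _).1 => //.
    exact: measurable_funTS.
  - apply/(measurable_restrictT _ _).1 => //.
    exact: measurable_funTS.
  move: (ae_neq y); apply: aeS => x xy _; rewrite !patchE.
  have [Ix|Ix] := pselect (Iunit x); last by rewrite f0//; case: ifP; case: ifP.
  have /IunitE /andP[x0 x1] := Ix.
  rewrite !mem_setE !in_itv/= x0 (ltW x0)/= lt_min x1 andbT.
  by rewrite le_eqVlt; case: eqP.
have lf : locally_integrable [set: R] f by exact: (open_integrable_locally openT fi).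
have := lebesgue_differentiation lf; apply: aeS => x Lx.
have [/IunitE/andP[x0 x1]|/f0//] := pselect (Iunit x).
have fi2 : mu.-integrable [set` Interval (BLeft (0:R)) (BRight 2)] (EFin \o f).
  by apply: integrableS fi => //; exact: measurable_itv.
have x2 : x < 2 by lra.
case: (@FTC1_lebesgue_pt R f (BLeft 0) x 2 x2 fi2 _ Lx) => [|_].
  by rewrite /= lte_fin.
by rewrite -/F F0 derive1_cst => <-.
Qed.

(** Trigonometric polynomials approximate the indicator functions of the intervals
    ]0, b[ boundedly and almost everywhere. *)
Lemma fourier_real (f : R -> R) : mu.-integrable [set: R] (EFin \o f) ->
  (forall x, ~ Iunit x -> f x = 0) ->
  (forall p : R -> R, is_trig (fun x => (p x)%:C) ->
     \int[mu]_(x in @Iunit R) (f x * p x) = 0) ->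
  {ae mu, forall x, f x = 0}.
Proof.
move=> fi f0 H; apply: ae_eq0_of_itv => // b b01.
have [P [Pt P01 P1 P0]] := trig_indicator b01.
have mf : measurable_fun [set: R] f by apply/measurable_EFinP; exact: measurable_int fi.
have mP n : measurable_fun [set: R] (P n).
  have [s hs] := Pt n.
  have : cmeas (fun x => (P n x)%:C).
    rewrite hs; apply: cmeas_sum => p; apply: cmeasM; first exact: cmeas_cst.
    by apply: cmeas_cis; exact: measurable_funM.
  by case.
have iD : mu.-integrable (@Iunit R) (EFin \o f) by apply: integrableS fi => //; exact: measurable_Iunit.
have mI : measurable_fun [set: R] (fun x : R => (x < b)%R%:R : R).
  rewrite (_ : (fun x => _) = (fun x => if x < b then 1 else 0)).
    by apply: measurable_fun_ifT => //; exact: measurable_fun_ltr.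
  by apply/funext => x; case: (x < b).
have [_ _ h] : [/\ mu.-integrable (@Iunit R) (fun x => (f x * (x < b)%R%:R)%:E),
  [sequence (\int[mu]_(x in @Iunit R) `|(f x * P n x)%:E - (f x * (x < b)%R%:R)%:E|)%E]_n @ \oo --> 0%E &
  [sequence (\int[mu]_(x in @Iunit R) (f x * P n x)%:E)%E]_n @ \oo -->
  (\int[mu]_(x in @Iunit R) (f x * (x < b)%R%:R)%:E)%E].
  apply: (@dominated_convergence _ _ R mu _ _ _ _ (fun x => `|f x|%:E)).
  - exact: measurable_Iunit.
  - by move=> n; apply: measurable_funTS; apply/measurable_EFinP; exact: (measurable_funM mf (mP n)).
  - by apply: measurable_funTS; apply/measurable_EFinP; exact: (measurable_funM mf mI).
  - move: (ae_neq b); apply: aeS => x xb /IunitE /andP[x0 x1].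
    apply: cvg_EFin; first exact: nearW.
    apply: cvgM; first exact: cvg_cst.
    case: (ltgtP x b) xb => // xb _; first by apply: P1; rewrite x0.
    by apply: P0; rewrite xb.
  - exact: (integrable_abse iD).
  - apply: aeW => x n _; rewrite lee_fin normrM ler_piMr//.
    by rewrite ger0_norm; case/andP: (P01 n x).
have h0 n : (\int[mu]_(x in @Iunit R) (f x * P n x)%:E = 0)%E.
  rewrite -[RHS]/(0%:E) -(H _ (Pt n)) fineK//; apply: integrable_fin_num => //; first exact: measurable_Iunit.
  apply: (le_integrable _ _ _ iD) => //; first exact: measurable_Iunit.
    by apply: measurable_funTS; apply/measurable_EFinP; exact: (measurable_funM mf (mP n)).
  move=> x _; rewrite /= lee_fin normrM ler_piMr//.
  by rewrite ger0_norm; case/andP: (P01 n x).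
have : (\int[mu]_(x in @Iunit R) (f x * (x < b)%R%:R)%:E = 0)%E.
  apply: (cvg_unique _ h) => //.
  by rewrite (_ : [sequence _]_n = cst 0%E); [exact: cvg_cst|apply/funext => n /=; exact: h0].
move=> <-; rewrite integral_mkcond [RHS]integral_mkcond.
apply: eq_integral => x _; rewrite !patchE /Iunit !mem_setE !in_itv/=.
case/andP: b01 => _ b1; case: (ltP 0 x) => //= x0; case: (ltP x b) => xb/=.
  by rewrite (lt_le_trans xb b1) mulr1.
by case: ifP => // _; rewrite mulr0.
Qed.

Lemma fourier_unique (g : R -> C) : cintegrable g -> (forall x, ~ Iunit x -> g x = 0) ->
  (forall m : int, cintegral (@Iunit R) (fun x => g x * cis (2 * pi * m%:~R * x)) = 0) ->
  eqae g (fun=> 0).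
Proof.
move=> gi g0 H.
have mlin (a : R) : measurable_fun [set: R] (fun x => a * x) by exact: measurable_funM.
have icis (m : int) : cintegrable (fun x => g x * cis (2 * pi * m%:~R * x)).
  exact: (cintegrable_cis (mlin _) gi).
have itp s : cintegrable (fun x => g x * trig_poly s x).
  elim: s => [|p s IH].
    rewrite (_ : (fun x => _) = (fun=> 0)); first exact: cintegrable0.
    by apply/funext => x; rewrite /trig_poly big_nil mulr0.
  rewrite (_ : (fun x => _) = (fun x => p.1 * (g x * cis (2 * pi * p.2%:~R * x)) + g x * trig_poly s x)).
    by apply: cintegrableD => //; exact: cintegrableZ.
  by apply/funext => x; rewrite /trig_poly big_cons mulrDr mulrCA.
have Ht s : cintegral (@Iunit R) (fun x => g x * trig_poly s x) = 0.
  elim: s => [|p s IH].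
    rewrite (_ : (fun x => _) = (fun=> 0)); first exact: cintegral0.
    by apply/funext => x; rewrite /trig_poly big_nil mulr0.
  rewrite (_ : (fun x => _) = (fun x => p.1 * (g x * cis (2 * pi * p.2%:~R * x)) + g x * trig_poly s x)).
    rewrite cintegralD//; last exact: cintegrableZ.
    by rewrite cintegralZ// H IH mulr0 addr0.
  by apply/funext => x; rewrite /trig_poly big_cons mulrDr mulrCA.
case: (gi) => g1 g2.
have h1 : {ae mu, forall x, complex.Re (g x) = 0}.
  apply: fourier_real => // [x /g0 -> //|p [s ps]].
  transitivity (complex.Re (cintegral (@Iunit R) (fun x => g x * trig_poly s x))).
    by apply: eq_Rintegral => x _; rewrite -ps cReM/= mulr0 subr0.
  by rewrite Ht.
have h2 : {ae mu, forall x, complex.Im (g x) = 0}.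
  apply: fourier_real => // [x /g0 -> //|p [s ps]].
  transitivity (complex.Im (cintegral (@Iunit R) (fun x => g x * trig_poly s x))).
    by apply: eq_Rintegral => x _; rewrite -ps cImM/= mulr0 add0r.
  by rewrite Ht.
by move: h1 h2; apply: aeS2 => x h1 h2 _; exact: complex_ext.
Qed.

End Fourier.

(** * Orthogonality to characters *)

Section CintegralAe.
Variable R : realType.
Local Notation mu := (@lebesgue_measure R).
Local Notation C := R[i].
Implicit Types f g : R -> C.

Lemma cintegral_ae (D : set R) f g : measurable D -> cmeas f -> cmeas g ->
  {ae mu, forall x, D x -> f x = g x} -> cintegral D f = cintegral D g.
Proof.
move=> mD mf mg fg; rewrite /cintegral /Rintegral; congr (fine _ +i* fine _).
  apply: ae_eq_integral => //.
  - by apply: measurable_funTS; exact: emeasurable_Re.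
  - by apply: measurable_funTS; exact: emeasurable_Re.
  - by move: fg; apply: aeS => x h /h ->.
apply: ae_eq_integral => //.
- by apply: measurable_funTS; exact: emeasurable_Im.
- by apply: measurable_funTS; exact: emeasurable_Im.
- by move: fg; apply: aeS => x h /h ->.
Qed.

Lemma cintegral_split f : cintegrable f ->
  cintegral (@Rpos R) f = cintegral (@Iunit R) f + cintegral (@Gt1 R) f.
Proof.
move=> fi.
have i1 : cintegrable (zext (@Iunit R) f) by exact: cintegrable_zext.
have i2 : cintegrable (zext (@Gt1 R) f) by exact: cintegrable_zext.
transitivity (cintegral (@Rpos R) (fun x => zext (@Iunit R) f x + zext (@Gt1 R) f x)).
  apply: cintegral_ae => //; first exact: cintegrable_cmeas.
    by apply: cintegrable_cmeas; exact: cintegrableD.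
  move: (ae_neq (1 : R)); apply: aeS => x x1 /RposE x0.
  have [h|h|h] := ltgtP x 1; last by [].
    rewrite zextT; last by apply/IunitE; rewrite x0.
    by rewrite zextF ?addr0// => /Gt1E; rewrite ltNge (ltW h).
  rewrite zextF; last by move=> /IunitE/andP[_]; rewrite ltNge (ltW h).
  by rewrite zextT ?add0r//; exact/Gt1E.
rewrite cintegralD//; congr (_ + _).
  rewrite -(@cintegral_zext R (@Iunit R))//.
  - by apply: cintegral_ext => x Ix; rewrite zextT.
  - by move=> x /IunitE/andP[x0 _]; exact/RposE.
  - by move=> x _ nI; rewrite zextF.
rewrite -(@cintegral_zext R (@Gt1 R))//.
- by apply: cintegral_ext => x Ix; rewrite zextT.
- by move=> x /Gt1E x1; apply/RposE; exact: lt_trans x1.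
- by move=> x _ nI; rewrite zextF.
Qed.

Lemma cis_surj (z : C) : `|z| = 1 -> exists s : R, z = cis (2 * pi * s).
Proof.
move=> /nc_unit; rewrite normc_def /=; case: z => a b /= h1.
have h : a ^+ 2 + b ^+ 2 = 1.
  by rewrite -[LHS]sqr_sqrtr ?h1 ?expr1n// addr_ge0// sqr_ge0.
have a1 : -1 <= a <= 1.
  by have := sqr_ge0 b; have := sqr_ge0 a; move=> *; apply/andP; split; nra.
have pi0 : (2 * pi : R) != 0 by rewrite mulf_neq0// gt_eqF// pi_gt0.
have ca : cos (acos a) = a by rewrite acosK.
have sa : sin (acos a) = Num.sqrt (1 - a ^+ 2) by rewrite sin_acos.
have bE : 1 - a ^+ 2 = b ^+ 2 by rewrite -h addrAC subrr add0r.
case: (leP 0 b) => b0.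
  exists (acos a / (2 * pi)); rewrite mulrC divfK// /cis ca sa bE sqrtr_sqr ger0_norm//.
exists (- acos a / (2 * pi)); rewrite mulrC divfK// /cis cosN sinN ca sa bE sqrtr_sqr.
by rewrite ltr0_norm// opprK.
Qed.

(** Up to the factor exp (2 i pi s x), the integrals are the Fourier coefficients of
    the twisted periodization. *)
Lemma orthogonal_iff (F : R -> C) (s : R) (z : C) : cintegrable F ->
  z = cis (2 * pi * s) ->
  (forall m : int, cintegral (@Rpos R) (fun x => F x * cis (2 * pi * (m%:~R + s) * x)) = 0)
  <-> {ae mu, forall x, Iunit x -> F x + Sop z F x = 0}.
Proof.
move=> Fi zs.
have z1 : `|z| = 1 by rewrite nc_normE zs nc_cis.
have mlin (a : R) : measurable_fun [set: R] (fun x => a * x) by exact: measurable_funM.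
pose G := zext (@Iunit R) (fun x => F x + Sop z F x).
have Gi : cintegrable G.
  by apply: cintegrable_zext => //; apply: cintegrableD => //; exact: cintegrable_Sop.
pose g x := G x * cis (2 * pi * s * x).
have gi : cintegrable g by exact: (cintegrable_cis (mlin _) Gi).
have key m : cintegral (@Rpos R) (fun x => F x * cis (2 * pi * (m%:~R + s) * x)) =
    cintegral (@Iunit R) (fun x => g x * cis (2 * pi * m%:~R * x)).
  set P := fun x => F x * _.
  have Pi : cintegrable P by exact: (cintegrable_cis (mlin _) Fi).
  have SPi : cintegrable (Sop 1 P) by apply: cintegrable_Sop => //; exact: normr1.
  rewrite cintegral_split// -cintegral_Sop1// -cintegralD//.
  apply: cintegral_ae => //.
  - by apply: cintegrable_cmeas; exact: cintegrableD.
  - by apply: cintegrable_cmeas; exact: (cintegrable_cis (mlin _) gi).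
  move: (ae_csummable_twist z1 Fi); apply: aeS => x /[swap] Ix /(_ Ix) sx.
  have E : cis (2 * pi * s * x) * cis (2 * pi * m%:~R * x) = cis (2 * pi * (m%:~R + s) * x).
    by rewrite -cisD; congr cis; ring.
  rewrite /g /G zextT// -mulrA E mulrDl; congr (_ + _).
  rewrite !SopE// mulrC -csum1M//; congr csum1; apply/funext => n.
  rewrite expr1n mul1r /P.
  have -> : 2 * pi * (m%:~R + s) * (x + n%:R) =
     2 * pi * (m%:~R + s) * x + (2 * pi * (m * n%:Z)%:~R + (2 * pi * s) *+ n) :> R.
    by rewrite intrM -mulr_natr /=; ring.
  by rewrite !cisD cis_2pi_int cisMn -zs; ring.
have cn0 x : cis (2 * pi * s * x) != 0.
  by apply/eqP => h; have := nc_cis (2 * pi * s * x); rewrite h nc0 => /eqP; rewrite eq_sym oner_eq0.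
split=> [H|H m].
  have : eqae g (fun=> 0).
    apply: fourier_unique => //.
      by move=> x nI; rewrite /g /G zextF ?mul0r.
    by move=> m; rewrite -key H.
  apply: aeS => x gx Ix; have /eqP := gx I; rewrite /g mulf_eq0 (negbTE (cn0 x)) orbF.
  by rewrite /G zextT// => /eqP.
rewrite key; transitivity (cintegral (@Iunit R) (fun=> 0 : C)); last exact: cintegral0.
apply: cintegral_ae.
- exact: measurable_Iunit.
- by apply: cintegrable_cmeas; exact: (cintegrable_cis (mlin _) gi).
- exact: cmeas_cst.
by move: H; apply: aeS => x /[swap] Ix /(_ Ix) h; rewrite /g /G zextT// h !mul0r.
Qed.

(** Inversion exchanges the two families of characters. *)
Lemma cintegral_char_inversion (q : R) (F : R -> C) (a : R) : 0 < q -> cintegrable F ->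
  cintegral (@Rpos R) (fun x => F x * cis (a * (q / x))) =
  cintegral (@Rpos R) (fun y => Jop q F y * cis (a * y)).
Proof.
move=> q0 Fi.
have mt : measurable_fun [set: R] (fun x => a * (q / x)).
  apply: measurable_funM => //; apply: measurable_funM => //; exact: measurable_invr.
rewrite -(cintegral_Jop q0); last exact: (cintegrable_cis mt Fi).
apply: cintegral_ext => y /RposE y0; rewrite !JopE// mulrA.
by rewrite invf_div (mulrCA q) divff ?gt_eqF// mulr1.
Qed.

End CintegralAe.

(** * The transfer operator *)

Section Lop.
Variable R : realType.
Local Notation mu := (@lebesgue_measure R).
Local Notation C := R[i].
Variables (q : R) (w : C).
Hypotheses (q0 : 0 < q) (w1 : `|w| = 1).
Implicit Types h k : R -> C.

Lemma Lop_out h x : ~ Iunit x -> Lop w q h x = 0.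
Proof. exact: zextF. Qed.

Lemma cintegrable_Lop h : cintegrable h -> cintegrable (Lop w q h).
Proof. by move=> hi; rewrite LopE//; apply: cintegrable_Sop => //; exact: cintegrable_Jop. Qed.

Lemma l1_Lop h : cintegrable h -> l1 (Lop w q h) <= l1 h.
Proof.
move=> hi; rewrite LopE//; apply: le_trans (l1_Jop q0 hi).
by apply: l1_Sop => //; exact: cintegrable_Jop.
Qed.

(** Linearity holds only almost everywhere, as for sums over translates. *)
Lemma LopD h k : cintegrable h -> cintegrable k ->
  eqae (Lop w q (fun x => h x + k x)) (fun x => Lop w q h x + Lop w q k x).
Proof.
by move=> hi ki; rewrite !LopE// JopD; apply: SopD => //; exact: cintegrable_Jop.
Qed.

Lemma LopZ (c : C) h : cintegrable h ->
  eqae (Lop w q (fun x => c * h x)) (fun x => c * Lop w q h x).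
Proof.
by move=> hi; rewrite !LopE// JopZ; apply: SopZ => //; exact: cintegrable_Jop.
Qed.

Lemma LopN h : cintegrable h ->
  eqae (Lop w q (fun x => - h x)) (fun x => - Lop w q h x).
Proof.
by move=> hi; rewrite !LopE// JopN; apply: SopN => //; exact: cintegrable_Jop.
Qed.

Lemma Lop_eqae h k : cintegrable h -> cintegrable k -> eqae h k ->
  eqae (Lop w q h) (Lop w q k).
Proof.
move=> hi ki hk; rewrite !LopE//; apply: Sop_eqae => //; try exact: cintegrable_Jop.
exact: Jop_eqae.
Qed.

End Lop.

(** * The Green equation *)

Lemma csum1_eq (R : realType) (u v : nat -> R[i]) :
  (forall n, (1 <= n)%N -> u n = v n) -> csum1 u = csum1 v.
Proof.
move=> uv; rewrite /csum1; congr (limn _ +i* limn _); apply/funext => N;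
  by apply: eq_big_nat => n /andP[n1 _]; rewrite uv.
Qed.

Lemma aeI (R : realType) (P Q : R -> Prop) :
  {ae @lebesgue_measure R, forall x, P x} -> {ae @lebesgue_measure R, forall x, Q x} ->
  {ae @lebesgue_measure R, forall x, P x /\ Q x}.
Proof. by apply: aeS2. Qed.

Section Preann.
Variable R : realType.
Local Notation mu := (@lebesgue_measure R).
Local Notation C := R[i].
Variables (q : R) (zeta eta : C).
Hypotheses (q1 : 1 < q) (zeta1 : `|zeta| = 1) (eta1 : `|eta| = 1).
Implicit Types F h k v : R -> C.

Let q0 : 0 < q. Proof. exact: lt_trans q1. Qed.

Definition Mid : set R := `]1, q[.
Lemma MidE x : Mid x <-> 1 < x < q.
Proof. by rewrite /Mid/= in_itv. Qed.

Lemma measurable_Mid : measurable Mid. Proof. exact: measurable_itv. Qed.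

Lemma Sop_supp w k : (forall x, 1 < x -> k x = 0) -> Sop w k = (fun=> 0).
Proof.
move=> k0; apply/funext => x; have [Ix|/Sop_out->//] := pselect (Iunit x).
rewrite SopE// -[RHS](@csum1_0 R); apply: csum1_eq => n n1.
have /IunitE/andP[x0 _] := Ix; rewrite k0 ?mulr0//.
by rewrite -[ltLHS]add0r ltr_leD// ler1n.
Qed.

Lemma Bop_out h x : ~ q < x -> Bop q eta h x = 0.
Proof.
move=> qx; rewrite /Bop; have [/RposE x0|nx] := pselect (Rpos x); last first.
  by rewrite Jop_out// oppr0.
rewrite JopE// Sop_out ?mulr0 ?oppr0// => /IunitE/andP[_].
by rewrite ltr_pdivrMr// mul1r.
Qed.

Lemma cintegrable_Bop h : cintegrable h -> cintegrable (Bop q eta h).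
Proof.
move=> hi; apply: cintegrableN; apply: cintegrable_Jop => //.
by apply: cintegrable_Sop => //; exact: cintegrable_Jop.
Qed.

Lemma l1_Bop h : cintegrable h -> l1 (Bop q eta h) <= l1 h.
Proof.
move=> hi; rewrite l1N; apply: le_trans (l1_Jop q0 _) _.
  by apply: cintegrable_Sop => //; exact: cintegrable_Jop.
apply: le_trans (l1_Sop eta1 _) _; first exact: cintegrable_Jop.
exact: l1_Jop.
Qed.

Lemma cintegrable_Phi h v : cintegrable h -> cintegrable v -> cintegrable (Phi q eta h v).
Proof.
move=> hi vi; apply: cintegrableD; first exact: cintegrableD.
by apply: cintegrable_Bop; exact: cintegrableD.
Qed.

Lemma cintegrable_Aop v : cintegrable v -> cintegrable (Aop q zeta eta v).
Proof.
move=> vi; apply: cintegrableD.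
  by apply: cintegrableN; exact: cintegrable_Sop.
apply: cintegrable_Lop => //; apply: cintegrable_Sop => //.
exact: cintegrable_Jop.
Qed.

Lemma Jop_Bop h : Jop q (Bop q eta h) = (fun x => - Sop eta (Jop q h) x).
Proof.
rewrite /Bop JopN; apply/funext => x; congr (- _).
have [/RposE x0|nx] := pselect (Rpos x); first by rewrite JopK.
rewrite Jop_out// Sop_out// => /IunitE/andP[x0 _]; apply: nx; exact/RposE.
Qed.

(** The part of [Phi q eta h v] beyond q is an inversion, so that its twisted
    periodization is a transfer operator, and the condition for zeta becomes the
    Green equation. *)
Lemma Sop_Phi h v : L1on (@Iunit R) h -> L1on Mid v ->
  eqae (Sop zeta (Phi q eta h v))
       (fun x => - Qop q zeta eta h x - Aop q zeta eta v x).
Proof.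
move=> [hi h0] [vi v0]; have hvi := cintegrableD hi vi.
have Bi := cintegrable_Bop hvi.
have S0 : Sop zeta h = (fun=> 0).
  apply: Sop_supp => x x1; apply: h0 => /IunitE/andP[_].
  by rewrite ltNge (ltW x1).
have Jhi := cintegrable_Jop q0 hi; have Jvi := cintegrable_Jop q0 vi.
have SJi : cintegrable (Sop eta (Jop q (h \+ v))).
  by apply: cintegrable_Sop => //; exact: cintegrable_Jop.
have E1 := SopD zeta1 hvi Bi; have E2 := SopD zeta1 hi vi.
have E3 : eqae (Sop zeta (Bop q eta (h \+ v)))
    (fun x => - Lop zeta q (Sop eta (Jop q (h \+ v))) x).
  rewrite LopE//; apply: SopN => //; exact: cintegrable_Jop.
have E4 : eqae (Lop zeta q (Sop eta (Jop q (h \+ v))))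
   (fun x => Lop zeta q (Lop eta q h) x + Lop zeta q (Sop eta (Jop q v)) x).
  have Lhi : cintegrable (Lop eta q h) by exact: cintegrable_Lop.
  have SJvi : cintegrable (Sop eta (Jop q v)) by exact: cintegrable_Sop.
  apply: eqae_trans (LopD q0 zeta1 Lhi SJvi).
  apply: Lop_eqae => //; first exact: cintegrableD.
  by rewrite (JopD q h v) LopE//; exact: SopD.
move: (aeI E1 (aeI E2 (aeI E3 E4))).
apply: aeS => x [] /(_ I) e1 [] /(_ I) e2 [] /(_ I) e3 /(_ I) e4 _.
rewrite /Phi e1 e2 e3 e4 S0 /Qop /Aop; ring.
Qed.

(** The second family of characters is turned into the first by inversion. *)
Lemma preannP F : preann q zeta eta F <->
  [/\ L1on (@Rpos R) F, {ae mu, forall x, Iunit x -> F x + Sop zeta F x = 0} &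
   {ae mu, forall x, Iunit x -> Jop q F x + Sop eta (Jop q F) x = 0}].
Proof.
split=> [[[Fi F0] [s [t [zs et H1 H2]]]]|[[Fi F0] H1 H2]].
  split=> //; first exact/(orthogonal_iff Fi zs).
  apply/(orthogonal_iff (cintegrable_Jop q0 Fi) et) => m.
  by rewrite -cintegral_char_inversion.
split=> //; have [s zs] := cis_surj zeta1; have [t et] := cis_surj eta1.
exists s, t; split=> //; first exact/(orthogonal_iff Fi zs).
move=> m; rewrite cintegral_char_inversion//.
by move: m; apply/(orthogonal_iff (cintegrable_Jop q0 Fi) et).
Qed.

(** The condition for eta holds by the choice of the part beyond q, the condition
    for zeta is the Green equation. *)
Lemma preann_Phi h v : L1on (@Iunit R) h -> L1on Mid v ->
  eqae h (fun x => Qop q zeta eta h x + Aop q zeta eta v x) ->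
  preann q zeta eta (Phi q eta h v).
Proof.
move=> hI vM E; have [hi h0] := hI; have [vi v0] := vM.
have hvi := cintegrableD hi vi.
apply/preannP; split.
- split; first exact: cintegrable_Phi.
  move=> x nx; rewrite /Phi Bop_out ?addr0.
    rewrite h0 ?v0 ?addr0//.
      by move=> /MidE/andP[x1 _]; apply: nx; apply/RposE; exact: lt_trans x1.
    by move=> /IunitE/andP[x1 _]; apply: nx; exact/RposE.
  by move=> qx; apply: nx; apply/RposE; exact: lt_trans qx.
- move: (Sop_Phi hI vM) E; apply: aeS2 => x /(_ I) -> /(_ I) E /IunitE/andP[x0 x1].
  rewrite /Phi v0 ?Bop_out; last 2 first.
  + by move=> qx; have := lt_trans x1 (lt_trans q1 qx); rewrite ltxx.
  + by move=> /MidE/andP[h1 _]; have := lt_trans x1 h1; rewrite ltxx.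
  by rewrite E; ring.
- have JPE : Jop q (Phi q eta h v) = (fun x => Jop q (h \+ v) x + Jop q (Bop q eta (h \+ v)) x).
    by rewrite -JopD.
  have S0 : Sop eta (Jop q (Bop q eta (h \+ v))) = (fun=> 0).
    apply: Sop_supp => x x1; rewrite Jop_Bop Sop_out ?oppr0// => /IunitE/andP[_].
    by rewrite ltNge (ltW x1).
  have i1 := cintegrable_Jop q0 hvi; have i2 := cintegrable_Jop q0 (cintegrable_Bop hvi).
  rewrite JPE; move: (SopD eta1 i1 i2); apply: aeS => x /(_ I) -> /IunitE/andP[x0 x1].
  rewrite S0 Jop_Bop addr0 subrK JopE// /= h0 ?v0 ?addr0 ?mulr0//.
    by move=> /MidE/andP[_]; rewrite ltr_pdivrMr// ltNge ler_piMr// ltW.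
  move=> /IunitE/andP[_]; rewrite ltr_pdivrMr// mul1r ltNge.
  by rewrite (ltW (lt_trans x1 q1)).
Qed.

(** The inversion exchanges ]0, 1[ with the half-line beyond q and preserves
    ]1, q[; hence the condition for eta expresses the part of F beyond q by the
    restrictions of F to ]0, 1[ and ]1, q[. *)
Lemma preann_decomp F : preann q zeta eta F ->
  exists h v, [/\ L1on (@Iunit R) h, L1on Mid v, eqae F (Phi q eta h v) &
    eqae h (fun x => Qop q zeta eta h x + Aop q zeta eta v x)].
Proof.
move=> /preannP[[Fi F0] H1 H2].
pose h := zext (@Iunit R) F; pose v := zext Mid F; pose t := zext `]q, +oo[ F.
have hi : cintegrable h by exact: cintegrable_zext.
have vi : cintegrable v by apply: cintegrable_zext => //; exact: measurable_Mid.
have ti : cintegrable t by apply: cintegrable_zext => //; exact: measurable_itv.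
have hvi := cintegrableD hi vi.
have hI : L1on (@Iunit R) h by split=> // x; exact: zextF.
have vM : L1on Mid v by split=> // x; exact: zextF.
have tE x : q < x -> t x = F x by move=> qx; rewrite /t zextT//= in_itv/= qx.
have tN x : ~ q < x -> t x = 0.
  by move=> qx; rewrite /t zextF//= in_itv/= andbT.
have FE : eqae F (fun x => (h \+ v) x + t x).
  move: (ae_neq (1:R)) (ae_neq q); apply: aeS2 => x x1 xq _ /=.
  have [/RposE x0|nx] := pselect (Rpos x); last first.
    rewrite F0// /h /v !zextF ?tN ?addr0//.
    - by move=> qx; apply: nx; apply/RposE; exact: lt_trans qx.
    - by move=> /MidE/andP[h1 _]; apply: nx; apply/RposE; exact: lt_trans h1.
    - by move=> /IunitE/andP[h1 _]; apply: nx; exact/RposE.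
  have [xl|xg|//] := ltgtP x 1.
    rewrite /h zextT; last by apply/IunitE; rewrite x0.
    rewrite /v zextF ?tN ?addr0// => [qx|/MidE/andP[h1 _]].
      by have := lt_trans q1 (lt_trans qx xl); rewrite ltxx.
    by have := lt_trans h1 xl; rewrite ltxx.
  rewrite /h zextF ?add0r; last first.
    by move=> /IunitE/andP[_ h1]; have := lt_trans h1 xg; rewrite ltxx.
  have [xl|xgq|//] := ltgtP x q.
    rewrite /v zextT; last by apply/MidE; rewrite xg.
    by rewrite tN ?addr0// => h1; have := lt_trans h1 xl; rewrite ltxx.
  rewrite /v zextF ?tE ?add0r// => /MidE/andP[_ h1].
  by have := lt_trans h1 xgq; rewrite ltxx.
have Jhvi := cintegrable_Jop q0 hvi; have Jti := cintegrable_Jop q0 ti.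
have JFE : eqae (Jop q F) (fun x => Jop q (h \+ v) x + Jop q t x).
  by rewrite -JopD; apply: Jop_eqae => //; exact: cintegrableD.
have Jt : Jop q t = zext (@Iunit R) (Jop q F).
  apply/funext => x; have [/RposE x0|nx] := pselect (Rpos x); last first.
    rewrite Jop_out// zextF// => /IunitE/andP[x0 _]; apply: nx; exact/RposE.
  rewrite JopE//; have [Ix|nI] := pselect (Iunit x).
    rewrite zextT// JopE// tE//.
    by rewrite ltr_pdivlMr//; case/IunitE/andP : Ix => _ x1; rewrite gtr_pMr.
  rewrite zextF// tN ?mulr0// => h1; apply: nI; apply/IunitE; rewrite x0/=.
  by move: h1; rewrite ltr_pdivlMr// gtr_pMr.
have SJt : Sop eta (Jop q t) = (fun=> 0).
  apply: Sop_supp => x x1; rewrite Jt zextF// => /IunitE/andP[_].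
  by rewrite ltNge (ltW x1).
have JtE : eqae (Jop q t) (fun x => - Sop eta (Jop q (h \+ v)) x).
  have E1 : eqae (Sop eta (Jop q F)) (Sop eta (fun x => Jop q (h \+ v) x + Jop q t x)).
    by apply: Sop_eqae => //; [exact: cintegrable_Jop|exact: cintegrableD].
  move: (aeI H2 (aeI E1 (SopD eta1 Jhvi Jti))).
  apply: aeS => x [] H [] /(_ I) e1 /(_ I) e2 _.
  have [Ix|nI] := pselect (Iunit x); last by rewrite Sop_out// oppr0 Jt zextF.
  have := H Ix; rewrite e1 e2 SJt addr0 Jt zextT// => /eqP.
  by rewrite addr_eq0 => /eqP.
have tB : eqae t (Bop q eta (h \+ v)).
  have Si : cintegrable (fun x => - Sop eta (Jop q (h \+ v)) x).
    by apply: cintegrableN; exact: cintegrable_Sop.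
  move: (Jop_eqae q0 Jti Si JtE); apply: aeS => x /(_ I) E _.
  have [/RposE x0|nx] := pselect (Rpos x).
    by rewrite -(JopK q0 t x0) E JopN.
  rewrite tN ?Bop_out// => qx; apply: nx; apply/RposE; exact: lt_trans qx.
have FPhi : eqae F (Phi q eta h v).
  by move: FE tB; apply: aeS2 => x /(_ I) -> /(_ I) -> _.
exists h, v; split => //.
have SF : eqae (Sop zeta F) (Sop zeta (Phi q eta h v)).
  by apply: Sop_eqae => //; exact: cintegrable_Phi.
move: (aeI H1 (aeI SF (Sop_Phi hI vM))).
apply: aeS => x [] H [] /(_ I) e1 /(_ I) e2 _.
have [Ix|nI] := pselect (Iunit x); last first.
  rewrite /h zextF// /Qop /Aop Lop_out// Sop_out// Lop_out//.
  by rewrite oppr0 !addr0.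
have := H Ix; rewrite e1 e2 -{1}(zextT F Ix) -/h => /eqP.
by rewrite -opprD addr_eq0 opprK => /eqP.
Qed.

End Preann.

(** * Functions of bounded variation *)

Section Primitive.
Variable R : realType.
Local Notation mu := (@lebesgue_measure R).
Variable f : R -> R.
Hypotheses (fi : mu.-integrable [set: R] (EFin \o f)) (f0 : forall x, 0 <= f x).

Definition prim (t : R) : R := \int[mu]_(x in `]0%R, t]) f x.

Let fiD (D : set R) : measurable D -> mu.-integrable D (EFin \o f).
Proof. by move=> mD; apply: integrableS fi => //. Qed.

Lemma prim_ge (c s t : R) : 0 <= s -> s <= t ->
  (forall u, s < u <= t -> c <= f u) -> c * (t - s) <= prim t - prim s.
Proof.
move=> s0 st cf.
have mst : measurable [set` `]s, t]] by exact: measurable_itv.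
rewrite /prim Rintegral_itvB ?bnd_simp//; last first.
  by apply: fiD; exact: measurable_itv.
have -> : c * (t - s) = \int[mu]_(x in `]s, t]) c.
  rewrite Rintegral_cst// [X in fine X](lebesgue_measure_itv `]s, t]%R)/= lte_fin.
  move: st; rewrite le_eqVlt => /orP[/eqP ->|->//]; first by rewrite ltxx subrr mulr0.
apply: le_Rintegral => //.
- apply/integrableP; split; first exact/measurable_EFinP/measurable_cst.
  under eq_integral do rewrite abse_EFin.
  rewrite integral_cst//= [X in (_ * X)%E](lebesgue_measure_itv `]s, t]%R)/=.
  by case: ifP => _; rewrite ?mule0// -EFinB -EFinM ltry.
- exact: fiD.
Qed.

Lemma prim_upper (c s t : R) : 0 <= s -> s <= t ->
  (forall u, s < u <= t -> f u <= c) -> prim t - prim s <= c * (t - s).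
Proof.
move=> s0 st cf.
have mst : measurable [set` `]s, t]] by exact: measurable_itv.
rewrite /prim Rintegral_itvB ?bnd_simp//; last first.
  by apply: fiD; exact: measurable_itv.
have -> : c * (t - s) = \int[mu]_(x in `]s, t]) c.
  rewrite Rintegral_cst// [X in fine X](lebesgue_measure_itv `]s, t]%R)/= lte_fin.
  move: st; rewrite le_eqVlt => /orP[/eqP ->|->//]; first by rewrite ltxx subrr mulr0.
apply: le_Rintegral => //; first exact: fiD.
apply/integrableP; split; first exact/measurable_EFinP/measurable_cst.
under eq_integral do rewrite abse_EFin.
rewrite integral_cst//= [X in (_ * X)%E](lebesgue_measure_itv `]s, t]%R)/=.
by case: ifP => _; rewrite ?mule0// -EFinB -EFinM ltry.
Qed.

Lemma prim_le (s t : R) : s <= t -> prim s <= prim t.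
Proof.
move=> st; case: (leP 0 s) => s0.
  by rewrite -subr_ge0 -[leLHS](mul0r (t - s)) prim_ge.
rewrite [leLHS](_ : _ = 0); first by apply: Rintegral_ge0.
rewrite /prim set_itv_ge ?Rintegral_set0//.
by rewrite bnd_simp -leNgt ltW.
Qed.

Lemma prim_total (t : R) : prim t <= \int[mu]_x f x.
Proof.
rewrite /prim /Rintegral fine_le//.
- by apply: integrable_fin_num => //; apply: fiD; exact: measurable_itv.
- exact: integrable_fin_num.
- apply: ge0_subset_integral => //; first exact: measurable_int fi.
  by move=> x _; rewrite lee_fin.
Qed.

Lemma prim_ge0 (t : R) : 0 <= prim t.
Proof. exact: Rintegral_ge0. Qed.

End Primitive.

Section Variation.
Variable R : realType.
Local Notation mu := (@lebesgue_measure R).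
Local Notation C := R[i].
Implicit Types (h k : R -> C) (v : R -> R).

(** [v t] bounds the variation of [h] over [t, 1], including a possible jump to
    0 at the end point 1. *)
Definition dominates h v := [/\ forall t, 1 <= t -> v t = 0,
  forall s t, 0 <= s -> s <= t -> v t <= v s &
  forall s t, 0 < s -> s <= t -> nc (h s - h t) <= v s - v t].

(** The number M bounds the variation and thereby also the modulus
    ([bvle_bound]), because h vanishes at 1. *)
Definition bvle h M := L1on (@Iunit R) h /\ exists2 v, dominates h v & v 0 <= M.

Lemma dominates_ge0 h v t : dominates h v -> 0 <= t -> 0 <= v t.
Proof.
move=> [v1 vm _] t0; case: (leP t 1) => t1; last by rewrite v1// ltW.
by rewrite -(v1 1)//; exact: vm.
Qed.

Lemma dominates_bound h v t : L1on (@Iunit R) h -> dominates h v -> 0 < t ->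
  nc (h t) <= v t.
Proof.
move=> [_ h0] dv t0; have [v1 vm hv] := dv.
case: (ltP t 1) => t1; last first.
  rewrite h0 ?nc0 ?v1// => /IunitE/andP[_]; by rewrite ltNge t1.
have h1 : h 1 = 0 by apply: h0 => /IunitE/andP[_]; rewrite ltxx.
by have := hv t 1 t0 (ltW t1); rewrite (v1 1)// subr0 h1 subr0.
Qed.

Lemma bvle_bound h M t : bvle h M -> nc (h t) <= M.
Proof.
move=> [hI [v dv vM]]; have [_ vm _] := dv; have [_ h0] := hI.
case: (ltP 0 t) => t0.
  by apply: le_trans (dominates_bound hI dv t0) _; apply: le_trans vM; rewrite vm// ltW.
rewrite h0 ?nc0; last by move=> /IunitE/andP[]; rewrite ltNge t0.
exact: le_trans (dominates_ge0 dv (lexx 0)) vM.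
Qed.

Lemma bvle_ge0 h M : bvle h M -> 0 <= M.
Proof. by move=> hM; exact: le_trans (nc_ge0 _) (bvle_bound 0 hM). Qed.

Lemma bvle_mono h M M' : M <= M' -> bvle h M -> bvle h M'.
Proof. by move=> MM [hI [v dv vM]]; split=> //; exists v => //; exact: le_trans MM. Qed.

Lemma bvleD h k M N : bvle h M -> bvle k N -> bvle (fun x => h x + k x) (M + N).
Proof.
move=> [[hi h0] [v [v1 vm vv] vM]] [[ki k0] [w [w1 wm ww] wN]]; split.
  split; first exact: cintegrableD.
  by move=> x nx; rewrite h0// k0// addr0.
exists (fun t => v t + w t); last exact: lerD.
split.
- by move=> t t1; rewrite v1// w1// addr0.
- by move=> s t s0 st; rewrite lerD ?vm ?wm.
- move=> s t s0 st.
  have -> : h s + k s - (h t + k t) = (h s - h t) + (k s - k t) by ring.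
  have -> : v s + w s - (v t + w t) = (v s - v t) + (w s - w t) by ring.
  by apply: le_trans (ncD _ _) _; rewrite lerD ?vv ?ww.
Qed.

Lemma bvleZ (c : C) h M : bvle h M -> bvle (fun x => c * h x) (nc c * M).
Proof.
move=> [[hi h0] [v [v1 vm vv] vM]]; split.
  split; first exact: cintegrableZ.
  by move=> x nx; rewrite h0// mulr0.
exists (fun t => nc c * v t); last by rewrite ler_wpM2l// nc_ge0.
split.
- by move=> t t1; rewrite v1// mulr0.
- by move=> s t s0 st; rewrite ler_wpM2l ?nc_ge0// vm.
- by move=> s t s0 st; rewrite -!mulrBr ncM ler_wpM2l ?nc_ge0// vv.
Qed.

End Variation.

(** * The variation inequality *)

Section LasotaYorke.
Variable R : realType.
Local Notation mu := (@lebesgue_measure R).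
Local Notation C := R[i].
Variable q : R.
Hypothesis q1 : 1 < q.
Let q0 : 0 < q. Proof. exact: lt_trans q1. Qed.

Definition nq := Num.truncn q.
Lemma nq_le : nq%:R <= q.
Proof. by have /andP[] := truncn_itv (ltW q0). Qed.
Lemma lt_nqS : q < nq.+1%:R.
Proof. by have /andP[] := truncn_itv (ltW q0). Qed.
Lemma nq_gt0 : (0 < nq)%N.
Proof. by rewrite /nq truncn_gt0 ltW. Qed.

Let m : R := nq.+1%:R.
Let m2 : 2 <= m. Proof. by rewrite /m ler_nat ltnS nq_gt0. Qed.
Let qm : q < m. Proof. exact: lt_nqS. Qed.
Let m0 : 0 < m. Proof. by apply: lt_le_trans m2. Qed.

(** The full branches lie below the point [cut]. *)
Definition cut := q / nq.+1%:R.
(** The factor by which the variation decreases.  The weight at the point y of an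
    inverse branch is y ^ 2 / q; it is at most 1 / q, and at most cut ^ 2 / q on
    the full branches, where the factor 2 accounts for the jumps at the end
    points. *)
Definition rate := Num.max q^-1 (2 * (cut ^+ 2 / q)).

Let p0 : 0 < cut. Proof. exact: divr_gt0. Qed.
Let p1 : cut < 1. Proof. by rewrite /cut ltr_pdivrMr// mul1r. Qed.

Lemma rate_gt0 : 0 < rate.
Proof. by rewrite /rate lt_max invr_gt0 q0. Qed.

Lemma rate_lt1 : rate < 1.
Proof.
rewrite /rate gt_max invf_lt1// q1/=.
have -> : 2 * (cut ^+ 2 / q) = (2 * q) / m ^+ 2.
  by rewrite /cut -/m; field; rewrite !gt_eqF.
rewrite ltr_pdivrMr ?exprn_gt0// mul1r expr2.
by apply: le_lt_trans (ler_wpM2r _ m2) _; [exact: ltW|rewrite ltr_pM2l].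
Qed.

Let tau (y : R) := Num.min (q / y) 1.

Let tau_gt0 y : 0 < y -> 0 < tau y.
Proof. by move=> y0; rewrite /tau lt_min divr_gt0//= ltr01. Qed.

Let tau_le1 y : tau y <= 1.
Proof. by rewrite /tau ge_min lexx orbT. Qed.

Let tau_le y z : 0 < y -> y <= z -> tau z <= tau y.
Proof.
move=> y0 yz; have z0 : 0 < z by exact: lt_le_trans yz.
rewrite /tau le_min !ge_min lexx orbT andbT; apply/orP; left.
by rewrite ler_pM2l// lef_pV2.
Qed.

Section Majorant.
Variables (h : R -> C) (v : R -> R).
Hypotheses (hI : L1on (@Iunit R) h) (dv : dominates h v).

Let nhi : mu.-integrable [set: R] (EFin \o (fun x => nc (h x))).
Proof.
by have [hi _] := hI; exact: integrable_nc.
Qed.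

Let I := prim (fun x => nc (h x)).

Let I_le s t : s <= t -> I s <= I t.
Proof. by apply: prim_le => // x; exact: nc_ge0. Qed.

Let I_total t : I t <= l1 h.
Proof. by apply: prim_total => // x; exact: nc_ge0. Qed.

Let I_ge0 t : 0 <= I t.
Proof. by apply: prim_ge0 => x; exact: nc_ge0. Qed.

(** The value of [h] at an intermediate point is eliminated by averaging. *)
Lemma sqr_variation s t : 0 < s -> s <= t -> t <= 1 ->
  nc ((t ^+ 2)%:C * h t - (s ^+ 2)%:C * h s) <=
  t ^+ 2 * (v s - v t) + 2 * (I t - I s).
Proof.
move=> s0 st t1; have [v1 vm hv] := dv.
have t0 : 0 < t by exact: lt_le_trans st.
set X := nc _.
have st2 : s ^+ 2 <= t ^+ 2 by rewrite lerXn2r// nnegrE ltW.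
have key u : s < u <= t -> X - t ^+ 2 * (v s - v t) <= (t ^+ 2 - s ^+ 2) * nc (h u).
  move=> /andP[su ut]; rewrite lerBlDl.
  have u0 : 0 < u by exact: lt_trans su.
  have -> : X = nc ((t ^+ 2)%:C * (h t - h u) + (s ^+ 2)%:C * (h u - h s) + (t ^+ 2 - s ^+ 2)%:C * h u).
    by rewrite /X rmorphB; congr (nc _); ring.
  apply: le_trans (ncD _ _) _; apply: lerD; last by rewrite ncM ncR ger0_norm ?subr_ge0.
  apply: le_trans (ncD _ _) _.
  rewrite !ncM !ncR (ger0_norm (sqr_ge0 t)) (ger0_norm (sqr_ge0 s)) (ncB (h t) (h u)) (ncB (h u) (h s)).
  have h1 := hv u t u0 ut; have h2 := hv s u s0 (ltW su).
  have -> : v s - v t = (v u - v t) + (v s - v u) by ring.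
  rewrite mulrDr; apply: lerD; first by rewrite ler_wpM2l// sqr_ge0.
  apply: le_trans (ler_wpM2l (sqr_ge0 s) h2) _.
  by rewrite ler_wpM2r// (le_trans (nc_ge0 _) h2).
move: st; rewrite le_eqVlt => /orP[/eqP E|st].
  by rewrite /X E !subrr nc0 !mulr0 addr0.
have d0 : 0 < t ^+ 2 - s ^+ 2 by rewrite subr_gt0 ltrXn2r// ltW.
have H : (X - t ^+ 2 * (v s - v t)) / (t ^+ 2 - s ^+ 2) * (t - s) <= I t - I s.
  apply: prim_ge => //; [exact: ltW|exact: ltW|].
  by move=> u su; rewrite ler_pdivrMr// [leRHS]mulrC; exact: key.
have ts : 0 < t - s by rewrite subr_gt0.
have E : t ^+ 2 - s ^+ 2 = (t - s) * (t + s) by ring.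
have {}H : (X - t ^+ 2 * (v s - v t)) <= (t + s) * (I t - I s).
  have ts' : t + s != 0 by rewrite gt_eqF// addr_gt0.
  rewrite -(ler_pM2l (_ : 0 < (t + s)^-1)) ?invr_gt0 ?addr_gt0//.
  rewrite mulrA mulVf// mul1r; apply: le_trans H.
  by rewrite E le_eqVlt; apply/orP; left; apply/eqP; field; rewrite ts' gt_eqF.
have I2 : 0 <= I t - I s by rewrite subr_ge0 I_le// ltW.
nra.
Qed.

Let H := Jop q h.

Let h1 : h 1 = 0.
Proof. by have [_ h0] := hI; apply: h0 => /IunitE/andP[_]; rewrite ltxx. Qed.

Let HE y : 0 < y -> H y = (q^-1)%:C * ((tau y ^+ 2)%:C * h (tau y)).
Proof.
move=> y0; rewrite /H JopE// mulrA -rmorphM /tau minEle.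
case: leP => qy.
  by congr (_%:C * _); field; rewrite !gt_eqF.
have [_ h0] := hI; rewrite h1 h0 ?mulr0// => /IunitE/andP[_].
by rewrite ltNge ltW.
Qed.

Let c1 := cut ^+ 2 / q.
Let c10 : 0 <= c1. Proof. by rewrite /c1 divr_ge0 ?sqr_ge0// ltW. Qed.

(* Along the n-th branch the increments of W bound the oscillation of the term
   with index n; the primitive I pays for the variation of the weight. *)
Let W y := (if y <= m then v (tau y) / q
  else v cut / q + c1 * (v (tau y) - v cut)) - 2 / q * I (tau y).

Let tau_m : tau m = cut.
Proof. by rewrite /tau -/cut minEle (ltW p1). Qed.

Let WE y : m <= y ->
  W y = v cut / q + c1 * (v (tau y) - v cut) - 2 / q * I (tau y).
Proof.
rewrite /W le_eqVlt => /orP[/eqP <-|]; last by rewrite ltNge => /negbTE ->.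
by rewrite lexx tau_m subrr mulr0 addr0.
Qed.

Let vm s t : 0 <= s -> s <= t -> v t <= v s.
Proof. by have [_ + _] := dv; apply. Qed.

Let branch n y z : (1 <= n)%N -> n%:R <= y -> y <= z -> z <= n.+1%:R ->
  nc (H y - H z) <= W z - W y.
Proof.
move=> n1 ny yz zn.
have y1 : 1 <= y by apply: le_trans ny; rewrite ler1n.
have y0 : 0 < y by apply: lt_le_trans y1.
have z0 : 0 < z by exact: lt_le_trans yz.
have tz0 := tau_gt0 z0; have ty0 := tau_gt0 y0.
have tzy := tau_le y0 yz; have ty1 := tau_le1 y.
have S := sqr_variation tz0 tzy ty1.
have v0 : 0 <= v (tau z) - v (tau y) by rewrite subr_ge0 vm// ltW.
have i0 : 0 <= I (tau y) - I (tau z) by rewrite subr_ge0 I_le.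
have q0' : 0 < q^-1 by rewrite invr_gt0.
rewrite !HE// -mulrBr ncM ncR (gtr0_norm q0').
apply: le_trans (ler_wpM2l (ltW q0') S) _.
case: (leqP n nq) => nn.
  have zm : z <= m by apply: le_trans zn _; rewrite /m ler_nat ltnS.
  rewrite /W zm (le_trans yz zm).
  have t1 : tau y ^+ 2 <= 1 by rewrite expr_le1// ltW.
  have -> : v (tau z) / q - 2 / q * I (tau z) - (v (tau y) / q - 2 / q * I (tau y)) =
    q^-1 * (1 * (v (tau z) - v (tau y)) + 2 * (I (tau y) - I (tau z))) by ring.
  by rewrite ler_pM2l// lerD2r ler_wpM2r.
have my : m <= y by apply: le_trans ny; rewrite /m ler_nat.
rewrite !WE ?(le_trans my yz)//.
have tc : tau y <= cut by rewrite -tau_m tau_le.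
have t1 : tau y ^+ 2 <= cut ^+ 2 by rewrite lerXn2r// nnegrE ltW.
rewrite /c1.
have -> : v cut / q + cut ^+ 2 / q * (v (tau z) - v cut) - 2 / q * I (tau z) -
   (v cut / q + cut ^+ 2 / q * (v (tau y) - v cut) - 2 / q * I (tau y)) =
   q^-1 * (cut ^+ 2 * (v (tau z) - v (tau y)) + 2 * (I (tau y) - I (tau z))) by ring.
by rewrite ler_pM2l// lerD2r ler_wpM2r.
Qed.

Let W_le n y z : (1 <= n)%N -> n%:R <= y -> y <= z -> z <= n.+1%:R -> W y <= W z.
Proof. by move=> *; rewrite -subr_ge0; apply: le_trans (nc_ge0 _) (branch _ _ _ _); eassumption. Qed.

Let B := v cut / q + c1 * (v 0 - v cut).

Let c2 : 0 <= 2 / q. Proof. by rewrite divr_ge0// ltW. Qed.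

Let W_B y : 1 <= y -> W y <= B.
Proof.
move=> y1; have y0 : 0 < y by apply: lt_le_trans y1.
have t0 := tau_gt0 y0.
have I0 : 0 <= 2 / q * I (tau y) by rewrite mulr_ge0.
rewrite /W /B lerBlDr; apply: ler_wpDr => //.
case: (leP y m) => ym.
  have vc : v (tau y) <= v cut.
    by apply: (vm (ltW p0)); rewrite -tau_m; exact: tau_le.
  apply: (@le_trans _ _ (v cut / q)); first by rewrite ler_wpM2r// invr_ge0 ltW.
  by rewrite lerDl mulr_ge0// subr_ge0 vm// ltW.
by rewrite lerD2l ler_wpM2l// lerD2r vm// ltW.
Qed.

Let l0 := l1_ge0 h.

Let W_1 : - (2 / q * l1 h) <= W 1.
Proof.
have t1 : tau 1 = 1 by rewrite /tau divr1 minEle leNgt q1.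
have [v1 _ _] := dv; rewrite /W t1 v1// mul0r.
have -> : (1 <= m) by apply: le_trans m2; rewrite ler1n.
by rewrite sub0r lerN2 ler_wpM2l.
Qed.

Let W_m : v cut / q - 2 / q * l1 h <= W m.
Proof. by rewrite /W lexx tau_m lerD2l lerN2 ler_wpM2l. Qed.

Let Hi : cintegrable H.
Proof. by have [hi _] := hI; exact: cintegrable_Jop. Qed.

Let nHi : mu.-integrable [set: R] (EFin \o (fun x => nc (H x))).
Proof. exact: integrable_nc. Qed.

Let K := prim (fun x => nc (H x)).

Let K_total t : K t <= l1 h.
Proof.
have [hi _] := hI; apply: le_trans (l1_Jop q0 hi).
by apply: prim_total => // x; exact: nc_ge0.
Qed.

Let K_ge0 t : 0 <= K t.
Proof. by apply: prim_ge0 => x; exact: nc_ge0. Qed.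

(* The increments of D bound the values at the end points of the branches, by
   averaging over a branch. *)
Let D y := K y + W y.

Let H_end n : (nq <= n)%N -> nc (H n.+1%:R) <= D n.+2%:R - D n.+1%:R.
Proof.
move=> nn; have n1 : (1 <= n.+1)%N by [].
set c := nc _; set d := W n.+2%:R - W n.+1%:R.
have n12 : n.+1%:R <= n.+2%:R :> R by rewrite ler_nat.
have := @prim_ge R (fun x => nc (H x)) nHi (c - d) n.+1%:R n.+2%:R.
rewrite -/K => P.
have {}P : (c - d) * (n.+2%:R - n.+1%:R) <= K n.+2%:R - K n.+1%:R.
  apply: P => // u /andP[un1 un2]; rewrite lerBlDr.
  apply: le_trans (ncBD _ (H u)) _; rewrite addrC lerD2l.
  apply: le_trans (branch n1 _ (ltW un1) un2) _ => //.
  by rewrite /d lerD2r (@W_le n.+1)// ltW.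
have e1 : n.+2%:R - n.+1%:R = 1 :> R by rewrite -(natr1 n.+1) addrAC subrr add0r.
move: P; rewrite e1 mulr1 /D /d; lra.
Qed.

(* For n + 1 <= q the point q / (n + 1) lies outside ]0, 1[. *)
Let H_small n : (n < nq)%N -> nc (H n.+1%:R) = 0.
Proof.
move=> nn; have [_ h0] := hI.
rewrite /H JopE// h0 ?mulr0 ?nc0// => /IunitE/andP[_].
rewrite ltr_pdivrMr// mul1r ltNge => /negP; apply.
by apply: le_trans nq_le; rewrite ler_nat.
Qed.

Let e := c1 * (v 0 - v cut) + 2 / q * l1 h + l1 h.

Let end_sum N : \sum_(1 <= n < N.+1) nc (H n.+1%:R) <= e.
Proof.
have S : \sum_(1 <= n < N.+1) nc (H n.+1%:R) <= D (maxn N.+2 nq.+1)%:R - D m.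
  elim: N => [|N IH].
    rewrite big_geq// (_ : maxn 2 nq.+1 = nq.+1) ?subrr//.
    by apply/maxn_idPr; rewrite ltnS nq_gt0.
  rewrite big_nat_recr//; case: (leqP nq N.+1) => nN.
    have E1 : maxn N.+2 nq.+1 = N.+2 by apply/maxn_idPl; rewrite ltnS.
    have E2 : maxn N.+3 nq.+1 = N.+3 by apply/maxn_idPl; rewrite ltnS ltnW.
    have := lerD IH (H_end nN); rewrite E1 E2 => IH'; apply: le_trans IH' _.
    by rewrite [leLHS]addrC addrA subrK.
  rewrite (H_small nN) [leLHS]addr0.
  have E1 : maxn N.+2 nq.+1 = nq.+1 by apply/maxn_idPr; rewrite ltnS ltnW.
  have E2 : maxn N.+3 nq.+1 = nq.+1 by apply/maxn_idPr; rewrite ltnS.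
  by move: IH; rewrite E1 E2.
apply: le_trans S _.
have mx : 1 <= (maxn N.+2 nq.+1)%:R :> R by rewrite ler1n leq_max.
by move: (W_B mx) (K_total (maxn N.+2 nq.+1)%:R) (K_ge0 m) W_m; rewrite /D /B /e; lra.
Qed.

Let a x n := W n.+1%:R - W (n%:R + x).

Let a_ge0 x n : 0 <= x <= 1 -> (1 <= n)%N -> 0 <= a x n.
Proof.
move=> /andP[x0 x1] n1; rewrite subr_ge0 (@W_le n)// ?lerDl//.
by rewrite -(natr1 n) lerD2l.
Qed.

Let a_le x y n : 0 <= x -> x <= y -> y <= 1 -> (1 <= n)%N -> a y n <= a x n.
Proof.
move=> x0 xy y1 n1; rewrite lerD2l lerN2 (@W_le n)// ?lerDl ?lerD2l//.
by rewrite -(natr1 n) lerD2l.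
Qed.

Let a_sum x N : 0 <= x <= 1 -> \sum_(1 <= n < N.+1) a x n <= B + 2 / q * l1 h.
Proof.
move=> /andP[x0 x1]; apply: (@le_trans _ _ (\sum_(1 <= n < N.+1) a 0 n)).
  by apply: ler_sum_nat => n /andP[n1 _]; exact: a_le.
rewrite /a; under eq_bigr do rewrite addr0.
rewrite (telescope_sumr (fun n => W n%:R))//.
have N1 : 1 <= N.+1%:R :> R by rewrite ler1n.
by move: (W_B N1) W_1; lra.
Qed.

Let a_summable x : 0 <= x <= 1 -> rsummable (a x).
Proof.
move=> x01; exists (B + 2 / q * l1 h) => N; apply: le_trans (a_sum N x01).
by apply: ler_sum_nat => n /andP[n1 _]; rewrite ger0_norm// a_ge0.
Qed.

Let e_summable : rsummable (fun n => nc (H n.+1%:R)).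
Proof.
exists e => N; apply: le_trans (end_sum N).
by apply: ler_sum => n _; rewrite ger0_norm// nc_ge0.
Qed.

Let e_ge0 : 0 <= e.
Proof. by apply: le_trans (end_sum 0); rewrite big_geq. Qed.

(* Bounds the variation of all terms on [x, 1] plus the sum of their values
   at 1. *)
Let V x := if x < 1 then rsum (a x) + e else 0.

Let rsum_a_ge0 x : 0 <= x <= 1 -> 0 <= rsum (a x).
Proof.
move=> x01; have -> : 0 = rsum (fun=> 0 : R).
  by rewrite /rsum; under eq_fun do rewrite big1//; rewrite lim_cst.
apply: rsum_le => //; [|exact: a_summable|by move=> n; exact: a_ge0].
by exists 0 => N; rewrite big1// => i _; rewrite normr0.
Qed.

Lemma Lop_dominates (w : C) : `|w| = 1 -> dominates (Lop w q h) V.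
Proof.
move=> w1.
have cancel (x y z : R) : x + z - (y + z) = x + (-1) * y by ring.
have term x n : nc (w ^+ n * H (x + n%:R)) = nc (H (n%:R + x)).
  by rewrite ncM ncX nc_unit// expr1n mul1r addrC.
have bnd x n : 0 < x -> x < 1 -> (1 <= n)%N ->
    nc (H (n%:R + x)) <= a x n + nc (H n.+1%:R).
  move=> x0 x1 n1; apply: le_trans (ncBD _ (H n.+1%:R)) _; rewrite lerD2r.
  have x0' := ltW x0; have x1' := ltW x1.
  by apply: (branch n1) => //; rewrite ?lerDl// -(natr1 n) lerD2l.
have sm x : 0 < x -> x < 1 -> csummable (fun n => w ^+ n * H (x + n%:R)).
  move=> x0 x1; have x01 : 0 <= x <= 1 by rewrite !ltW.
  apply: csummable_le (rsummableD (a_summable x01) e_summable) _ => n n1.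
  by rewrite term bnd.
have LE x : 0 < x -> x < 1 -> Lop w q h x = csum1 (fun n => w ^+ n * H (x + n%:R)).
  by move=> x0 x1; rewrite LopE// SopE//; apply/IunitE; rewrite x0.
split.
- by move=> t t1; rewrite /V ltNge t1.
- move=> s t s0 st; rewrite /V; case: (ltP t 1) => t1; last first.
    case: ifP => // s1; rewrite addr_ge0// rsum_a_ge0//.
    by rewrite s0 ltW.
  rewrite (le_lt_trans st t1) lerD2r.
  have t01 : 0 <= t <= 1 by rewrite (le_trans s0 st) ltW.
  have s01 : 0 <= s <= 1 by rewrite s0 (le_trans st)// ltW.
  apply: rsum_le; [exact: a_summable..|].
  by move=> n n1; apply: a_le => //; exact: ltW.
- move=> s t s0 st; case: (ltP s 1) => s1; last first.
    have t1 := le_trans s1 st.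
    rewrite !Lop_out ?subr0 ?nc0; first by rewrite /V !ltNge s1 t1 subrr.
      by move=> /IunitE/andP[_]; rewrite ltNge t1.
    by move=> /IunitE/andP[_]; rewrite ltNge s1.
  have s01 : 0 <= s <= 1 by rewrite !ltW.
  case: (ltP t 1) => t1; last first.
    rewrite (@Lop_out _ _ _ _ t) ?subr0; last first.
      by move=> /IunitE/andP[_]; rewrite ltNge t1.
    rewrite /V s1 ltNge t1 /= subr0 LE//.
    apply: (@le_trans _ _ (rsum (fun n => a s n + nc (H n.+1%:R)))).
      apply: csum1_le; first exact: rsummableD (a_summable s01) e_summable.
      by move=> n n1; rewrite term bnd.
    rewrite rsumD//; last exact: a_summable.
    by rewrite lerD2l rsum_bound.
  have t0 : 0 < t by exact: lt_le_trans st.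
  have t01 : 0 <= t <= 1 by rewrite !ltW.
  rewrite /V s1 t1.
  rewrite cancel.
  have St := rsummableZ (-1) (a_summable t01).
  rewrite -(rsumZ (-1) (a_summable t01)) -rsumD//; last exact: a_summable.
  rewrite !LE// -[X in csum1 _ + X]mulN1r -csum1M; last exact: sm.
  rewrite -csum1D; [|exact: sm|by apply: csummableM; exact: sm].
  apply: csum1_le; first by apply: rsummableD => //; exact: a_summable.
  move=> n n1.
  have -> : w ^+ n * H (s + n%:R) + -1 * (w ^+ n * H (t + n%:R)) =
      w ^+ n * (H (n%:R + s) - H (n%:R + t)) by rewrite (addrC s) (addrC t); ring.
  rewrite ncM ncX nc_unit// expr1n mul1r.
  have -> : a s n + -1 * a t n = W (n%:R + t) - W (n%:R + s) by rewrite /a; ring.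
  apply: (branch n1); rewrite ?lerDl ?lerD2l//; first exact: ltW.
  by rewrite -(natr1 n) lerD2l ltW.
Qed.

Lemma Lop_majorant0 : V 0 <= rate * v 0 + 5 * l1 h.
Proof.
rewrite /V ltr01.
have x01 : 0 <= (0:R) <= 1 by rewrite lexx ler01.
have S := rsum_bound (a_summable x01) (fun N => a_sum N x01).
apply: (@le_trans _ _ (v cut / q + 2 * c1 * (v 0 - v cut) + (4 / q + 1) * l1 h)).
  by move: S; rewrite /B /e; lra.
have vc0 : 0 <= v cut by apply: (dominates_ge0 dv); exact: ltW.
have vc : 0 <= v 0 - v cut by rewrite subr_ge0 vm// ltW.
have r1 : q^-1 <= rate by rewrite /rate le_max lexx.
have r2 : 2 * c1 <= rate by rewrite /rate le_max /c1 lexx orbT.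
have q1' : q^-1 <= 1 by rewrite invf_le1// ltW.
have A1 : v cut / q <= rate * v cut by rewrite mulrC ler_wpM2r.
have A2 : 2 * c1 * (v 0 - v cut) <= rate * (v 0 - v cut) by rewrite ler_wpM2r.
have A3 : (4 / q + 1) * l1 h <= 5 * l1 h by rewrite ler_wpM2r//; lra.
by move: A1 A2 A3; lra.
Qed.

End Majorant.

(** The variation of the values of [h] is multiplied by the weights, and the
    variation of the weights is paid for by the L1 norm. *)
Lemma lasota_yorke (w : C) h M : `|w| = 1 -> bvle h M ->
  bvle (Lop w q h) (rate * M + 5 * l1 h).
Proof.
move=> w1 [hI [v dv vM]]; split.
  by split; [case: hI => hi _; exact: cintegrable_Lop|move=> x; exact: Lop_out].
eexists; first exact: (Lop_dominates hI dv w1).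
apply: le_trans (Lop_majorant0 hI dv) _; rewrite lerD2r ler_wpM2l//.
by rewrite ltW// rate_gt0.
Qed.

End LasotaYorke.

(** * Words and inverse branches *)

Section RsumMore.
Variable R : realType.
Local Notation C := R[i].

Lemma rsum_single (a : nat -> R) n : (1 <= n)%N -> (forall i, i != n -> a i = 0) ->
  rsum a = a n.
Proof.
move=> n1 a0; apply/cvg_lim => //.
apply: (@cvg_trans _ ((fun=> a n) @ \oo)); last exact: cvg_cst.
apply: near_eq_cvg; exists n => // N /= nN; rewrite /=.
rewrite (bigD1_seq n)/= ?mem_index_iota ?n1 ?ltnS ?iota_uniq//=.
by rewrite big1 ?addr0// => i; exact: a0.
Qed.

Lemma csum1_single (u : nat -> C) n : (1 <= n)%N -> (forall i, i != n -> u i = 0) ->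
  csum1 u = u n.
Proof.
move=> n1 u0; rewrite csum1E; apply: complex_ext => /=.
  by rewrite (rsum_single n1)// => i /u0 ->.
by rewrite (rsum_single n1)// => i /u0 ->.
Qed.

Lemma rsummable_single (a : nat -> R) n : (forall i, i != n -> a i = 0) -> rsummable a.
Proof.
move=> a0; exists `|a n| => N; case: (boolP (n \in index_iota 1 N.+1)) => nN.
  by rewrite (bigD1_seq n)/= ?iota_uniq//= big1 ?addr0// => i /a0 ->; rewrite normr0.
rewrite big1_seq// => i /andP[_ iN]; rewrite a0 ?normr0//.
by apply: contraNneq nN => <-.
Qed.

Lemma sum_invsq N : \sum_(1 <= n < N.+1) (n%:R ^+ 2)^-1 <= 2 :> R.
Proof.
case: N => [|N]; first by rewrite big_geq.
suff : \sum_(1 <= n < N.+2) (n%:R ^+ 2)^-1 <= 2 - (N.+1%:R)^-1 :> R.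
  by move/le_trans; apply; rewrite gerBl invr_ge0.
elim: N => [|N IH]; first by rewrite big_nat1 expr1n invr1; lra.
rewrite big_nat_recr//; apply: le_trans (lerD IH (lexx _)) _.
have n0 : 0 < N.+1%:R :> R by [].
rewrite -[N.+2%:R]natr1; move: (N.+1%:R : R) n0 => x x0.
have x1 : 0 < x + 1 by rewrite addr_gt0.
rewrite -subr_ge0.
have -> : 2 - (x + 1)^-1 - (2 - x^-1 + ((x + 1) ^+ 2)^-1) = (x * (x + 1) ^+ 2)^-1.
  by field; rewrite !gt_eqF.
by rewrite invr_ge0 mulr_ge0 ?exprn_ge0// ltW.
Qed.

Lemma rsummable_invsq (c : R) : rsummable (fun n => c * (n%:R ^+ 2)^-1).
Proof.
apply: rsummableZ; exists 2 => N; apply: le_trans (sum_invsq N).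
by apply: ler_sum => n _; rewrite ger0_norm// invr_ge0 sqr_ge0.
Qed.

End RsumMore.

Section Words.
Variable R : realType.
Local Notation mu := (@lebesgue_measure R).
Local Notation C := R[i].
Variable q : R.
Hypothesis q1 : 1 < q.
Let q0 : 0 < q. Proof. exact: lt_trans q1. Qed.
Implicit Types (w : seq nat) (ws : seq C) (h f : R -> C) (g : R -> R).

Definition bounded h := exists M, forall x, nc (h x) <= M.

(** Inverse branches along a word; the first letter is applied first. *)
Fixpoint branch_point w x : R :=
  if w is n :: w' then branch_point w' (q / (n%:R + x)) else x.

Fixpoint branch_weight w x : R :=
  if w is n :: w' then q / (n%:R + x) ^+ 2 * branch_weight w' (q / (n%:R + x)) else 1.

Fixpoint branch_ok w x : bool :=
  (0 < x < 1) && (if w is n :: w' then (0 < n)%N && branch_ok w' (q / (n%:R + x)) else true).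

Fixpoint branch_phase ws w : C :=
  match ws, w with
  | z :: ws', n :: w' => z ^+ n * branch_phase ws' w'
  | _, _ => 1
  end.

Definition Lops ws h : R -> C := foldr (fun z f => Lop z q f) h ws.

Definition Lreal g x : R := if x \in @Iunit R then
  rsum (fun n => q / (n%:R + x) ^+ 2 * g (q / (n%:R + x))) else 0.

Lemma Lop1_real g x : Lop 1 q (fun x => (g x)%:C) x = (Lreal g x)%:C.
Proof.
rewrite /Lop /Lreal /zext; case: ifP => // _; rewrite -csum1R; congr csum1.
by apply/funext => n; rewrite expr1n mul1r -rmorphM.
Qed.

Let weight_ge0 n x : 0 < x -> 0 <= q / (n%:R + x) ^+ 2.
Proof.
by move=> x0; rewrite divr_ge0 ?(ltW q0)// exprn_ge0// addr_ge0// ltW.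
Qed.

Let weight_le n x : (1 <= n)%N -> 0 < x -> q / (n%:R + x) ^+ 2 <= q * (n%:R ^+ 2)^-1.
Proof.
move=> n1 x0; rewrite ler_wpM2l ?(ltW q0)// lef_pV2 ?posrE ?exprn_gt0 ?ltr0n//.
  by rewrite lerXn2r ?nnegrE ?lerDl ?addr_ge0// ltW.
by rewrite addr_gt0// ltr0n.
Qed.

Lemma Lreal_summable g M x : (forall y, 0 <= g y <= M) -> 0 < x ->
  rsummable (fun n => q / (n%:R + x) ^+ 2 * g (q / (n%:R + x))).
Proof.
move=> gM x0; have [B hB] := rsummable_invsq (q * M); exists B => N.
apply: le_trans (hB N); apply: ler_sum_nat => n /andP[n1 _].
have /andP[g0 gm] := gM (q / (n%:R + x)).
have M0 : 0 <= M by exact: le_trans gm.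
rewrite !ger0_norm ?mulr_ge0 ?weight_ge0 ?invr_ge0 ?sqr_ge0 ?(ltW q0)//.
by rewrite [leRHS]mulrAC ler_pM ?weight_ge0// weight_le.
Qed.

Let rsum_ge0 (a : nat -> R) : rsummable a -> (forall n, (1 <= n)%N -> 0 <= a n) -> 0 <= rsum a.
Proof.
move=> sa a0; apply: (limr_ge (rsum_cvg sa)); apply: nearW => N.
by rewrite big_nat_cond; apply: sumr_ge0 => n /andP[/andP[n1 _] _]; exact: a0.
Qed.

Lemma Lreal_bounded g M x : (forall y, 0 <= g y <= M) -> 0 <= Lreal g x <= 2 * (q * M).
Proof.
move=> gM; have M0 : 0 <= M by have /andP[a b] := gM 0; exact: le_trans b.
rewrite /Lreal; case: ifPn; last by rewrite lexx !mulr_ge0// ltW.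
rewrite inE => /IunitE/andP[x0 _]; have s := Lreal_summable gM x0.
apply/andP; split.
  by apply: rsum_ge0 => // n n1; rewrite mulr_ge0 ?weight_ge0//; case/andP: (gM (q / (n%:R + x))).
apply: rsum_bound => // N; apply: (@le_trans _ _ (\sum_(1 <= n < N.+1) (q * M) * (n%:R ^+ 2)^-1)).
  apply: ler_sum_nat => n /andP[n1 _]; have /andP[g0 gm] := gM (q / (n%:R + x)).
  by rewrite [leRHS]mulrAC ler_pM ?weight_ge0// weight_le.
by rewrite -mulr_sumr [leRHS]mulrC ler_wpM2l ?sum_invsq// mulr_ge0// ltW.
Qed.

Lemma iter_Lreal_bounded g N : (exists M, forall y, 0 <= g y <= M) ->
  exists M, forall y, 0 <= iter N Lreal g y <= M.
Proof.
move=> gM; elim: N => [//|N [M IH]]; exists (2 * (q * M)) => y.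
exact: Lreal_bounded.
Qed.

(** When the modulus of f is at most g, splitting off terms t n from the series
    diminishes the bound for the rest by the moduli of these terms. *)
Lemma Lop_split (z : C) f g (t : nat -> C) x : `|z| = 1 ->
  (exists M, forall y, 0 <= g y <= M) -> Iunit x ->
  (forall n, (1 <= n)%N ->
     nc (f (q / (n%:R + x)) - t n) <= g (q / (n%:R + x)) - nc (t n)) ->
  nc (Lop z q f x - csum1 (fun n => z ^+ n * (q / (n%:R + x) ^+ 2)%:C * t n)) <=
  Lreal g x - rsum (fun n => q / (n%:R + x) ^+ 2 * nc (t n)).
Proof.
move=> z1 [M gM] Ix H; have /IunitE/andP[x0 _] := Ix.
have sg := Lreal_summable gM x0.
have wz n (u : C) : nc (z ^+ n * (q / (n%:R + x) ^+ 2)%:C * u) = q / (n%:R + x) ^+ 2 * nc u.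
  by rewrite !ncM ncX nc_unit// expr1n mul1r ncR (ger0_norm (weight_ge0 _ x0)).
have tg n : (1 <= n)%N -> nc (t n) <= g (q / (n%:R + x)).
  by move=> n1; rewrite -subr_ge0; apply: le_trans (H n n1); exact: nc_ge0.
have st : rsummable (fun n => q / (n%:R + x) ^+ 2 * nc (t n)).
  have [B hB] := sg; exists B => N; apply: le_trans (hB N).
  apply: ler_sum_nat => n /andP[n1 _]; have /andP[g0 _] := gM (q / (n%:R + x)).
  have a1 : 0 <= q / (n%:R + x) ^+ 2 * nc (t n) by rewrite mulr_ge0 ?weight_ge0// nc_ge0.
  have a2 : 0 <= q / (n%:R + x) ^+ 2 * g (q / (n%:R + x)) by rewrite mulr_ge0 ?weight_ge0.
  by rewrite (ger0_norm a1) (ger0_norm a2) ler_wpM2l ?weight_ge0// tg.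
have st' : csummable (fun n => z ^+ n * (q / (n%:R + x) ^+ 2)%:C * t n).
  by apply: (csummable_le st) => n _; rewrite wz.
have fg n : (1 <= n)%N -> nc (f (q / (n%:R + x))) <= g (q / (n%:R + x)).
  move=> n1; apply: le_trans (ncBD _ (t n)) _.
  by rewrite -lerBrDr; exact: H.
have sf : csummable (fun n => z ^+ n * (q / (n%:R + x) ^+ 2)%:C * f (q / (n%:R + x))).
  by apply: (csummable_le sg) => n n1; rewrite wz ler_wpM2l ?weight_ge0// fg.
rewrite /Lop zextT// /Lreal mem_set//.
rewrite -[X in nc (_ + X)]mulN1r -csum1M// -csum1D//; last exact: csummableM.
rewrite -rsumN// -rsumD//; last first.
  by have [B hB] := st; exists B => N; under eq_bigr do rewrite normrN; exact: hB.
apply: csum1_le => [|n n1].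
  apply: rsummableD => //.
  by have [B hB] := st; exists B => N; under eq_bigr do rewrite normrN; exact: hB.
rewrite mulN1r -mulrBr wz -mulrN -mulrDr ler_wpM2l ?weight_ge0//.
exact: H.
Qed.

Lemma Lop_le_Lreal (z : C) f g x : `|z| = 1 ->
  (exists M, forall y, 0 <= g y <= M) -> (forall y, nc (f y) <= g y) ->
  nc (Lop z q f x) <= Lreal g x.
Proof.
move=> z1 gM fg; have [Ix|nI] := pselect (Iunit x); last first.
  by rewrite Lop_out// nc0 /Lreal memNset.
have := @Lop_split z f g (fun=> 0) x z1 gM Ix.
have -> : csum1 (fun n => z ^+ n * (q / (n%:R + x) ^+ 2)%:C * 0) = 0 :> C.
  by rewrite -[RHS](@csum1_0 R); congr csum1; apply/funext => n; rewrite mulr0.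
have -> : rsum (fun n => q / (n%:R + x) ^+ 2 * nc (0 : C)) = 0.
  by rewrite nc0 (@rsum_single _ _ 1)// ?mulr0// => i _; rewrite mulr0.
by rewrite !subr0; apply => n _; rewrite nc0 !subr0.
Qed.

Lemma Lops_le_Lreal ws h x : (forall z, z \in ws -> `|z| = 1) -> bounded h ->
  nc (Lops ws h x) <= iter (size ws) Lreal (fun y => nc (h y)) x.
Proof.
move=> + hb; have hb' : exists M, forall y, 0 <= nc (h y) <= M.
  by have [M hM] := hb; exists M => y; rewrite nc_ge0 hM.
elim: ws x => [//|z ws IH] x zws /=.
apply: Lop_le_Lreal; first by apply: zws; rewrite mem_head.
  exact: iter_Lreal_bounded.
by move=> y; apply: IH => u uw; apply: zws; rewrite in_cons uw orbT.
Qed.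

Lemma branch_phase_unit ws w : (forall z, z \in ws -> `|z| = 1) ->
  nc (branch_phase ws w) = 1.
Proof.
elim: ws w => [|u ws IH] [|i w] zws'; rewrite [branch_phase _ _]/= ?nc1//.
rewrite ncM ncX nc_unit; last by apply: zws'; rewrite mem_head.
by rewrite expr1n mul1r IH// => r rw; apply: zws'; rewrite in_cons rw orbT.
Qed.

Lemma branch_weight_ge0 w x : branch_ok w x -> 0 <= branch_weight w x.
Proof.
elim: w x => [//|i w IH] r /= /andP[/andP[r0 _] /andP[i1 ok]].
by apply: mulr_ge0; [exact: weight_ge0|exact: IH].
Qed.

(** A single inverse branch may be isolated from an iterate, the remaining
    branches being controlled by the untwisted operator. *)
Lemma Lops_branch ws w h x : (forall z, z \in ws -> `|z| = 1) -> bounded h ->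
  size w = size ws -> branch_ok w x ->
  nc (Lops ws h x - branch_phase ws w * (branch_weight w x)%:C * h (branch_point w x)) <=
  iter (size ws) Lreal (fun y => nc (h y)) x - branch_weight w x * nc (h (branch_point w x)).
Proof.
move=> + hb; have hb' : exists M, forall y, 0 <= nc (h y) <= M.
  by have [M hM] := hb; exists M => y; rewrite nc_ge0 hM.
elim: ws w x => [|z ws IH] [|n w] x // zws sw.
  move=> _; change (nc (h x - 1 * 1 * h x) <= nc (h x) - 1 * nc (h x)).
  by rewrite !mul1r !subrr nc0.
move: sw => [sw] /andP[x01 /andP[n1 ok]].
have zws' u : u \in ws -> `|u| = 1 by move=> uw; apply: zws; rewrite in_cons uw orbT.
have z1 : `|z| = 1 by apply: zws; rewrite mem_head.
set y := q / (n%:R + x).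
change (nc (Lop z q (Lops ws h) x - z ^+ n * branch_phase ws w *
    (q / (n%:R + x) ^+ 2 * branch_weight w y)%:C * h (branch_point w y)) <=
  Lreal (iter (size ws) Lreal (fun y => nc (h y))) x -
    q / (n%:R + x) ^+ 2 * branch_weight w y * nc (h (branch_point w y))).
pose t i : C := if i == n then branch_phase ws w * (branch_weight w y)%:C * h (branch_point w y) else 0.
have ph := branch_phase_unit w zws'.
have wt : 0 <= branch_weight w y := branch_weight_ge0 ok.
have tn : nc (t n) = branch_weight w y * nc (h (branch_point w y)).
  by rewrite /t eqxx !ncM ph mul1r ncR ger0_norm.
have := @Lop_split z (Lops ws h) (iter (size ws) Lreal (fun y => nc (h y))) t x z1.
rewrite (csum1_single n1); last by move=> i ni; rewrite /t (negbTE ni) mulr0.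
rewrite (rsum_single n1); last by move=> i ni; rewrite /t (negbTE ni) nc0 mulr0.
rewrite tn -/y.
have -> : z ^+ n * branch_phase ws w * (q / (n%:R + x) ^+ 2 * branch_weight w y)%:C * h (branch_point w y) =
   z ^+ n * (q / (n%:R + x) ^+ 2)%:C * t n.
  by rewrite /t eqxx rmorphM; ring.
rewrite -(mulrA _ (branch_weight w y)); apply.
- exact: iter_Lreal_bounded.
- exact/IunitE.
move=> i i1; rewrite /t; case: eqP => [->|_]; last by rewrite nc0 !subr0; exact: Lops_le_Lreal.
by rewrite -/y; have := IH w y zws' sw ok; rewrite -tn /t eqxx.
Qed.

End Words.

(** * Cylinders *)

Section Cylinders.
Variable R : realType.
Variable q : R.
Hypothesis q1 : 1 < q.
Let q0 : 0 < q. Proof. exact: lt_trans q1. Qed.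
Local Notation nq := (nq q).

Definition cylinder w (a b : R) := forall x, 0 < x < 1 ->
  branch_ok q w x && (a < branch_point q w x < b).

Lemma branch_point_rcons w n x :
  branch_point q (rcons w n) x = q / (n%:R + branch_point q w x).
Proof. by elim: w x => //= i w IH x; rewrite IH. Qed.

Lemma branch_ok_rcons w n x : (0 < n)%N -> branch_ok q w x ->
  0 < q / (n%:R + branch_point q w x) < 1 -> branch_ok q (rcons w n) x.
Proof.
move=> n0; elim: w x => [|i w IH] x /=.
  by rewrite andbT => -> ->; rewrite n0.
by move=> /andP[-> /andP[-> ok]] h /=; exact: IH.
Qed.

Lemma full_branch n x : (nq < n)%N -> 0 < x -> 0 < q / (n%:R + x) < 1.
Proof.
move=> nn x0; have n0 : 0 < n%:R :> R by rewrite ltr0n (leq_trans _ nn).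
have nx : 0 < n%:R + x by rewrite addr_gt0.
rewrite divr_gt0//= ltr_pdivrMr// mul1r.
apply: lt_trans (lt_nqS q1) _; apply: (@le_lt_trans _ _ n%:R); first by rewrite ler_nat.
by rewrite ltrDl.
Qed.

Let exists_nat_gt (c : R) : exists n, (nq < n)%N /\ c < n%:R.
Proof.
exists (maxn nq.+1 (Num.truncn c).+1); split; first by rewrite leq_max leqnn.
apply: lt_le_trans (truncnS_gt c) _; by rewrite ler_nat leq_max leqnn orbT.
Qed.

(** If an interval contains one of the points q / n between full branches, its
    image contains a neighbourhood of 0, hence infinitely many full branches. *)
Lemma cylinder_cut n (a b : R) : (nq < n)%N -> 0 <= a -> a < q / n%:R < b ->
  exists w, cylinder w a b.
Proof.
move=> nn a0 /andP[an nb].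
have n0 : 0 < n%:R :> R by rewrite ltr0n (leq_trans _ nn).
have d0 : 0 < q - a * n%:R by rewrite subr_gt0 -ltr_pdivlMr.
have [m [mn mc]] := exists_nat_gt (a * q / (q - a * n%:R)).
have m0 : 0 < m%:R :> R by rewrite ltr0n (leq_trans _ mn).
exists [:: m; n] => x /andP[x0 x1].
have ok1 := full_branch mn x0; have /andP[y0 y1] := ok1.
have ok2 := full_branch nn y0.
rewrite /= x0 x1 ok1 ok2 (leq_trans _ mn)//= (leq_trans _ nn)//=.
have ny : 0 < n%:R + q / (m%:R + x) by rewrite addr_gt0.
apply/andP; split; last first.
  by apply: lt_trans nb; rewrite ltr_pM2l// ltf_pV2 ?posrE// ltrDl.
rewrite ltr_pdivlMr// mulrDr -ltrBrDl mulrA ltr_pdivrMr; last by rewrite addr_gt0.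
move: mc; rewrite ltr_pdivrMr// => mc; apply: lt_le_trans mc _.
by rewrite mulrC ler_pM2l// lerDl ltW.
Qed.

(** Otherwise the image is an interval longer by a factor q. *)
Lemma cylinder_expand (a b : R) : 0 <= a -> a < b -> b <= 1 ->
  (forall n, (nq < n)%N -> ~~ (a < q / n%:R < b)) ->
  exists n, [/\ (0 < n)%N, 0 <= q / b - n%:R, q / a - n%:R <= 1,
    q * (b - a) <= (q / a - n%:R) - (q / b - n%:R) & 0 < a].
Proof.
move=> a0 ab b1 nocut.
have a0' : 0 < a.
  rewrite lt_neqAle a0 andbT eq_sym; apply/eqP => aE.
  have b0 : 0 < b by rewrite -aE.
  have [n [nn hn]] := exists_nat_gt (q / b).
  have n0 : 0 < n%:R :> R by rewrite ltr0n (leq_trans _ nn).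
  have /negP := nocut n nn; apply; rewrite aE divr_gt0//=.
  by rewrite ltr_pdivrMr// mulrC -ltr_pdivrMr.
have b0 : 0 < b by exact: lt_trans ab.
have exn : exists n, q / a <= n.+1%:R.
  by have [n [_ hn]] := exists_nat_gt (q / a); exists n; rewrite (le_trans (ltW hn))// ler_nat.
have := @ex_minnP (fun n => q / a <= n.+1%:R) exn; case=> n na nmin.
have n_lt : n%:R < q / a.
  case: n na nmin => [|n] na nmin; first exact: divr_gt0.
  by rewrite ltNge; apply/negP => /nmin; rewrite ltnn.
have qa : q < q / a by rewrite ltr_pdivlMr// gtr_pMr// (lt_le_trans ab).
have nqn : (nq <= n)%N.
  rewrite -ltnS -(ltr_nat R); apply: lt_le_trans na.
  exact: le_lt_trans (nq_le q1) qa.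
have n0 : (0 < n)%N by apply: leq_trans nqn; exact: nq_gt0.
have n0' : 0 < n%:R :> R by rewrite ltr0n.
have bn : b <= q / n%:R.
  move: nqn; rewrite leq_eqVlt => /orP[/eqP E|nn].
    apply: le_trans b1 _; rewrite ler_pdivlMr// mul1r -E; exact: nq_le.
  have := nocut n nn; rewrite ltr_pdivlMr// mulrC -ltr_pdivlMr// n_lt /=.
  by rewrite -leNgt.
exists n; split=> //.
- by rewrite subr_ge0 ler_pdivlMr// mulrC -ler_pdivlMr.
- by rewrite lerBlDr addrC natr1.
have -> : q / a - n%:R - (q / b - n%:R) = q * (b - a) / (a * b).
  by field; rewrite !gt_eqF.
rewrite ler_pdivlMr ?mulr_gt0// ler_piMr// ?mulr_ge0 ?subr_ge0 ?(ltW ab) ?(ltW q0)//.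
by rewrite mulr_ile1 ?(ltW b0)// ltW// (lt_le_trans ab).
Qed.

(** Each step without a cut at a point q / n makes the interval longer by the
    factor q, which cannot go on for ever within ]0, 1[. *)
Lemma exists_cylinder (a b : R) : 0 <= a -> a < b -> b <= 1 -> exists w, cylinder w a b.
Proof.
move=> a0 ab b1.
have [j hj] : exists j, 1 < q ^+ j * (b - a).
  have ba : 0 < b - a by rewrite subr_gt0.
  have [j hj] : exists j : nat, (b - a)^-1 < q ^+ j.
    exists (Num.truncn ((b - a)^-1 / (q - 1))).+1.
    have B := @bernoulli R (q - 1) (Num.truncn ((b - a)^-1 / (q - 1))).+1.
    have q1' : 0 < q - 1 by rewrite subr_gt0.
    have t := truncnS_gt ((b - a)^-1 / (q - 1)).
    rewrite ltr_pdivrMr// in t.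
    apply: lt_le_trans t _; rewrite (_ : 1 + (q - 1) = q) in B; last by ring.
    apply: le_trans _ (B _); last by lra.
    by rewrite lerDr.
  by exists j; rewrite -ltr_pdivrMr// div1r.
elim: j a b a0 ab b1 hj => [|j IH] a b a0 ab b1 hj.
  by move: hj; rewrite expr0 mul1r; lra.
have [[n [nn h]]|nocut] := pselect (exists n, (nq < n)%N /\ a < q / n%:R < b).
  exact: cylinder_cut nn a0 h.
have [n [n0 b' a' len a0']] := @cylinder_expand a b a0 ab b1
  (fun n nn => introN idP (fun h => nocut (ex_intro _ n (conj nn h)))).
have qba : 0 < q * (b - a) by rewrite mulr_gt0// subr_gt0.
have [||w cw] := IH (q / b - n%:R) (q / a - n%:R) b' _ a' _.
- by rewrite -subr_gt0 (lt_le_trans qba).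
- apply: lt_le_trans hj _; rewrite exprSr -mulrA ler_wpM2l// exprn_ge0//; exact: ltW.
exists (rcons w n) => x x01; have /andP[ok /andP[h1 h2]] := cw x x01.
have b0 : 0 < b by exact: lt_trans ab.
have y0 : 0 < n%:R + branch_point q w x.
  by rewrite addr_gt0 ?ltr0n// (le_lt_trans b').
rewrite branch_point_rcons.
have h3 : a < q / (n%:R + branch_point q w x).
  by rewrite ltr_pdivlMr// mulrC -ltr_pdivlMr// addrC -ltrBrDr.
have h4 : q / (n%:R + branch_point q w x) < b.
  by rewrite ltr_pdivrMr// mulrC -ltr_pdivrMr// addrC -ltrBlDr.
rewrite h3 h4 /= andbT; apply: branch_ok_rcons => //.
by rewrite (lt_trans a0')//= (lt_le_trans h4).
Qed.

(** Letters above [nq] may be put in front of the word, as their branches are full. *)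
Lemma cylinder_long w (a b : R) N : (size w <= N)%N -> cylinder w a b ->
  exists2 w', size w' = N & cylinder w' a b.
Proof.
move=> wN cw; rewrite -(subnK wN); elim: (N - size w)%N => [|i [w' sw' cw']].
  by exists w.
exists (nq.+1 :: w'); first by rewrite /= sw' addSn.
move=> x x01; have /andP[x0 _] := x01; have y01 := full_branch (ltnSn nq) x0.
by rewrite [branch_ok _ _ _]/= x01; have := cw' _ y01.
Qed.

(** The product of the infima of the weights of the letters over ]0, 1[, which
    bounds the weight of the word from below at all points. *)
Definition min_weight (w : seq nat) : R := \prod_(n <- w) (q / n.+1%:R ^+ 2).

Lemma min_weight_gt0 w : 0 < min_weight w.
Proof.
elim: w => [|n w IH]; first by rewrite /min_weight big_nil.
by rewrite /min_weight big_cons mulr_gt0// divr_gt0// exprn_gt0.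
Qed.

Lemma weight_min n x : (0 < n)%N -> 0 < x < 1 -> q / n.+1%:R ^+ 2 <= q / (n%:R + x) ^+ 2.
Proof.
move=> n0 /andP[x0 x1]; have nx : 0 < n%:R + x by rewrite addr_gt0// ltr0n.
rewrite ler_pM2l// lef_pV2 ?posrE ?exprn_gt0// lerXn2r ?nnegrE ?(ltW nx)//.
by rewrite -natr1 lerD2l ltW.
Qed.

Lemma min_weight_le w x : branch_ok q w x -> min_weight w <= branch_weight q w x.
Proof.
elim: w x => [|n w IH] x; first by rewrite /min_weight big_nil.
rewrite /= /min_weight big_cons => /andP[x01 /andP[n0 ok]].
apply: ler_pM; rewrite ?weight_min ?IH//.
  by rewrite divr_ge0 ?(ltW q0)// exprn_ge0.
exact: ltW (min_weight_gt0 w).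
Qed.

End Cylinders.

(** * Flat intervals *)

Section Flat.
Variable R : realType.
Local Notation mu := (@lebesgue_measure R).
Local Notation C := R[i].

Lemma prim_l1 (h : R -> C) : L1on (@Iunit R) h -> prim (fun x => nc (h x)) 1 = l1 h.
Proof.
move=> [hi h0]; rewrite /prim /l1 /L1norm /Rintegral; congr fine.
rewrite integral_mkcond; apply: eq_integral => x _; rewrite patchE.
case: ifPn => // /negP nx; rewrite h0 ?nc0//.
move=> /IunitE/andP[x0 x1]; apply: nx; rewrite inE.
by change (x \in `]0, 1]); rewrite in_itv/= x0 ltW.
Qed.

Lemma prim_0 (f : R -> R) : prim f 0 = 0.
Proof. by rewrite /prim set_itv_ge ?Rintegral_set0// bnd_simp ltxx. Qed.

(** If h oscillated by more than d |h|_1 on every interval on which it exceeds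
    |h|_1 / 2, then, the oscillations having sum at most M |h|_1 and h being at
    most M |h|_1, these few intervals could not carry half of the norm. *)
Lemma flat_interval (M d : R) : 0 < M -> 0 < d -> exists2 K : nat, (0 < K)%N &
  forall h, bvle h (M * l1 h) -> 0 < l1 h ->
  exists j z, [/\ (j < K)%N, l1 h / 2 <= nc (h z) &
    forall x, j%:R / K%:R < x < j.+1%:R / K%:R -> nc (h x - h z) <= d * l1 h].
Proof.
move=> M0 d0.
pose K := (Num.truncn (2 * M ^+ 2 / d)).+1; exists K => // h hM l0.
have K0 : 0 < K%:R :> R by rewrite ltr0n.
have KM : 2 * M ^+ 2 / d < K%:R by exact: truncnS_gt.
apply: contrapT => no.
have [hI [v dv vM]] := hM; have [v1 vm hv] := dv; have [hi h0] := hI.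
pose P := prim (fun x => nc (h x)).
pose o j := v (j%:R / K%:R) - v (j.+1%:R / K%:R).
have step j : (j < K)%N -> P (j.+1%:R / K%:R) - P (j%:R / K%:R) <=
    (l1 h / 2 + M / d * o j) * K%:R^-1.
  move=> jK.
  have j0 : 0 <= j%:R / K%:R :> R by rewrite divr_ge0// ltW.
  have jj : j%:R / K%:R <= j.+1%:R / K%:R :> R by rewrite ler_pM2r ?invr_gt0// ler_nat.
  have E : K%:R^-1 = j.+1%:R / K%:R - j%:R / K%:R :> R.
    by rewrite -mulrBl -natr1 addrAC subrr add0r mul1r.
  rewrite [leRHS](_ : _ = (l1 h / 2 + M / d * o j) * (j.+1%:R / K%:R - j%:R / K%:R)); last by rewrite -E.
  have o0 : 0 <= o j by rewrite subr_ge0 vm.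
  apply: (prim_upper (integrable_nc hi) j0 jj).
  move=> z /andP[z1 z2].
  have [hz|hz] := ltP (nc (h z)) (l1 h / 2).
    by apply: le_trans (ltW hz) _; rewrite lerDl mulr_ge0// divr_ge0// ltW.
  have [x [/andP[x1 x2] hx]] : exists x, j%:R / K%:R < x < j.+1%:R / K%:R /\ d * l1 h < nc (h x - h z).
    apply: contrapT => nx; apply: no; exists j, z; split=> // x xj.
    by rewrite leNgt; apply/negP => hx; apply: nx; exists x.
  have osc : nc (h x - h z) <= o j.
    have x0 : 0 < x by exact: le_lt_trans x1.
    have z0 : 0 < z by exact: le_lt_trans z1.
    have [xz|zx] := leP x z.
      by apply: le_trans (hv _ _ x0 xz) _; rewrite lerB// vm// ltW.
    rewrite ncB; apply: le_trans (hv _ _ z0 (ltW zx)) _.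
    by rewrite lerB// vm// ltW.
  have := bvle_bound z hM => hz2; apply: le_trans hz2 _.
  have h3 := lt_le_trans hx osc.
  apply: (@le_trans _ _ (M / d * o j)); last by rewrite lerDr divr_ge0// ltW.
  by rewrite -mulrA ler_pM2l// ler_pdivlMl// ltW.
have S : l1 h <= \sum_(0 <= j < K) (l1 h / 2 + M / d * o j) * K%:R^-1.
  have T : P 1 - P 0 = \sum_(0 <= j < K) (P (j.+1%:R / K%:R) - P (j%:R / K%:R)).
    rewrite (telescope_sumr (fun j => P (j%:R / K%:R)))//.
    by rewrite divff ?gt_eqF// mul0r.
  rewrite -[leLHS](prim_l1 hI) -[leLHS]subr0 -[X in _ - X](prim_0 (fun x => nc (h x))) -/P T.
  by apply: ler_sum_nat => j /andP[_ jK]; exact: step.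
have So : \sum_(0 <= j < K) o j = v 0.
  rewrite /o -(opprK (\sum_(0 <= j < K) _)) -sumrN.
  under eq_bigr do rewrite opprB.
  rewrite (telescope_sumr (fun j => v (j%:R / K%:R)))//.
  by rewrite divff ?gt_eqF// mul0r v1// sub0r opprK.
move: S; rewrite -mulr_suml big_split/= -(mulr_sumr _ _ _ (M / d)) So sumr_const_nat subn0 -(mulr_natr (l1 h / 2)).
rewrite mulrDl (mulfK (lt0r_neq0 K0)).
move=> S.
have : M / d * v 0 / K%:R < l1 h / 2.
  rewrite ltr_pdivrMr//; apply: (@le_lt_trans _ _ (M / d * (M * l1 h))).
    by rewrite ler_wpM2l// divr_ge0// ltW.
  have -> : M / d * (M * l1 h) = (2 * M ^+ 2 / d) * (l1 h / 2) by field; rewrite gt_eqF.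
  by rewrite mulrC ltr_pM2l// divr_gt0.
by move: S; lra.
Qed.

End Flat.

(** * Loss of norm by cancellation *)

Section GainTools.
Variable R : realType.
Local Notation mu := (@lebesgue_measure R).
Local Notation C := R[i].

Lemma rsum_two (a : nat -> R) n : (1 <= n)%N ->
  (forall i, i != n -> i != n.+1 -> a i = 0) -> rsum a = a n + a n.+1.
Proof.
move=> n1 a0.
pose b i := if i == n then a n else 0; pose c i := if i == n.+1 then a n.+1 else 0.
have bs i : i != n -> b i = 0 by rewrite /b => /negbTE ->.
have cs i : i != n.+1 -> c i = 0 by rewrite /c => /negbTE ->.
have -> : a = (fun i => b i + c i).
  apply/funext => i; rewrite /b /c; have [->|ni] := eqVneq i n.
    by rewrite ltn_eqF// addr0.
  by have [->|mi] := eqVneq i n.+1; rewrite add0r// a0.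
rewrite rsumD; [|exact: (rsummable_single bs)|exact: (rsummable_single cs)].
rewrite (rsum_single n1 bs) (rsum_single _ cs)//.
by rewrite /b /c !eqxx ltn_eqF// gtn_eqF// addr0 add0r.
Qed.

Lemma csum1_two (u : nat -> C) n : (1 <= n)%N ->
  (forall i, i != n -> i != n.+1 -> u i = 0) -> csum1 u = u n + u n.+1.
Proof.
move=> n1 u0; rewrite csum1E; apply: complex_ext => /=.
  by rewrite (rsum_two n1) ?cReD// => i i1 i2; rewrite u0.
by rewrite (rsum_two n1) ?cImD// => i i1 i2; rewrite u0.
Qed.

Lemma nc_sqr (z : C) : nc z ^+ 2 = complex.Re z ^+ 2 + complex.Im z ^+ 2.
Proof. by case: z => a b /=; rewrite sqr_sqrtr// addr_ge0// sqr_ge0. Qed.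

Lemma nc_one_add (w : C) : `|w| = 1 -> w <> 1 -> nc (1 + w) < 2.
Proof.
move=> w1 wn; have E := nc_sqr w; have F := nc_sqr (1 + w).
have n0 : 0 <= nc (1 + w) by exact: nc_ge0.
rewrite (nc_unit w1) expr1n in E; rewrite cReD cImD in F.
move: (nc (1 + w)) n0 F => z z0 F.
have {}F : z ^+ 2 = (1 + complex.Re w) ^+ 2 + complex.Im w ^+ 2 by rewrite F; congr (_ + _ ^+ 2); exact: add0r.
have a1 : complex.Re w < 1.
  rewrite lt_neqAle; apply/andP; split; last by nra.
  apply/negP => /eqP aE; apply: wn; apply: complex_ext => //.
  by apply/eqP; rewrite -sqrf_eq0; apply/eqP; change (complex.Im w ^+ 2 = 0); rewrite aE in E; lra.
rewrite -(@ltr_pXn2r _ 2)// ?nnegrE// F; nra.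
Qed.

(** Both coefficients contain the amount g, and for these parts the sum
    g (c + w c) of modulus g |c| |1 + w| replaces 2 g |c|. *)
Lemma phase_gain (w c h1 h2 : C) (A1 A2 g d : R) : `|w| = 1 -> 0 <= g ->
  g <= A1 -> g <= A2 -> nc (h1 - c) <= d -> nc (h2 - c) <= d ->
  g * (nc c * (2 - nc (1 + w)) - 4 * d) <=
  A1 * nc h1 + A2 * nc h2 - nc (A1%:C * h1 + w * A2%:C * h2).
Proof.
move=> w1 g0 gA1 gA2 d1 d2.
have B1 : 0 <= A1 - g by rewrite subr_ge0.
have B2 : 0 <= A2 - g by rewrite subr_ge0.
have E : A1%:C * h1 + w * A2%:C * h2 =
  (A1 - g)%:C * h1 + w * (A2 - g)%:C * h2 + g%:C * ((1 + w) * c + ((h1 - c) + w * (h2 - c))).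
  by rewrite !rmorphB; ring.
have nw := nc_unit w1.
have H1 : nc (A1%:C * h1 + w * A2%:C * h2) <=
   (A1 - g) * nc h1 + (A2 - g) * nc h2 + g * (nc (1 + w) * nc c + 2 * d).
  rewrite E; apply: le_trans (ncD _ _) _; apply: lerD.
    apply: le_trans (ncD _ _) _; rewrite !ncM !ncR nw mul1r.
    by rewrite (ger0_norm B1) (ger0_norm B2).
  rewrite ncM ncR (ger0_norm g0) ler_wpM2l//.
  apply: le_trans (ncD _ _) _; rewrite ncM lerD2l.
  apply: le_trans (ncD _ _) _; rewrite ncM nw mul1r; lra.
have c1 : nc c <= d + nc h1 by apply: le_trans (ncBD c h1) _; rewrite ncB lerD2r.
have c2 : nc c <= d + nc h2 by apply: le_trans (ncBD c h2) _; rewrite ncB lerD2r.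
have H2 : g * (nc h1 + nc h2 - (nc (1 + w) * nc c + 2 * d)) <=
   A1 * nc h1 + A2 * nc h2 - nc (A1%:C * h1 + w * A2%:C * h2).
  by rewrite lerBrDr -lerBrDl; apply: le_trans H1 _; rewrite le_eqVlt; apply/orP; left; apply/eqP; ring.
apply: le_trans H2; rewrite ler_wpM2l//.
by move: c1 c2; move: (nc c) (nc h1) (nc h2) (nc (1 + w)) => X Y Z W; lra.
Qed.

Lemma l1_gain (f g : R -> C) (G : R) : cintegrable f -> cintegrable g ->
  0 <= G -> (forall x, ~ Iunit x -> f x = 0) ->
  (forall x, Iunit x -> nc (f x) <= nc (g x) - G) -> l1 f <= l1 g - G.
Proof.
move=> fi gi G0 f0 fg; rewrite lerBrDr -lee_fin EFinD -!L1normE//.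
have mf := cintegrable_cmeas fi; have mg := cintegrable_cmeas gi.
have -> : G%:E = (\int[mu]_x (G * \1_(@Iunit R) x)%:E)%E.
  under eq_integral do rewrite EFinM.
  rewrite ge0_integralZl//=; last first.
    by apply/measurable_EFinP; apply: measurable_indic; exact: measurable_Iunit.
  rewrite integral_indic//; last exact: measurable_Iunit.
  rewrite setIT [X in (_ * X)%E](lebesgue_measure_itv `]0%R, 1%R[)/= lte_fin ltr01.
  by rewrite sube0 mule1.
rewrite /L1norm -ge0_integralD//=; first last.
- apply/measurable_EFinP; apply: measurable_funM => //; by apply: measurable_indic; exact: measurable_Iunit.
- by move=> x _; rewrite lee_fin mulr_ge0.
- exact: emeasurable_nc.
- by move=> x _; rewrite lee_fin; exact: nc_ge0.
apply: ge0_le_integral => //=.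
- by move=> x _; rewrite -EFinD lee_fin addr_ge0 ?mulr_ge0//; exact: nc_ge0.
- apply: emeasurable_funD; first exact: emeasurable_nc.
  apply/measurable_EFinP; apply: measurable_funM => //; by apply: measurable_indic; exact: measurable_Iunit.
- exact: emeasurable_nc.
move=> x _; rewrite -EFinD lee_fin indicE; case: (pselect (Iunit x)) => Ix.
  by rewrite mem_set// mulr1 -lerBrDr; exact: fg.
rewrite memNset// mulr0 addr0; change (nc (f x) <= nc (g x)).
by rewrite f0// nc0; exact: nc_ge0.
Qed.

End GainTools.

Section Gain.
Variable R : realType.
Local Notation mu := (@lebesgue_measure R).
Local Notation C := R[i].
Variable q : R.
Hypothesis q1 : 1 < q.
Let q0 : 0 < q. Proof. exact: lt_trans q1. Qed.
Implicit Types (w : seq nat) (ws : seq C) (h f : R -> C) (g : R -> R).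

Lemma Lops_l1 ws h : (forall z, z \in ws -> `|z| = 1) -> cintegrable h ->
  cintegrable (Lops q ws h) /\ l1 (Lops q ws h) <= l1 h.
Proof.
elim: ws => [|z ws IH] zws hi; first by split.
have z1 : `|z| = 1 by apply: zws; rewrite mem_head.
have [|ci le] := IH _ hi; first by move=> u uw; apply: zws; rewrite in_cons uw orbT.
split; first exact: cintegrable_Lop.
exact: le_trans (l1_Lop q0 z1 ci) le.
Qed.

Lemma Lops_eqaeB ws h f : (forall z, z \in ws -> `|z| = 1) ->
  cintegrable h -> cintegrable f ->
  eqae (Lops q ws (fun x => h x - f x)) (fun x => Lops q ws h x - Lops q ws f x).
Proof.
elim: ws => [|z ws IH] zws hi fi; first exact: eqae_refl.
have z1 : `|z| = 1 by apply: zws; rewrite mem_head.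
have zws' u : u \in ws -> `|u| = 1 by move=> uw; apply: zws; rewrite in_cons uw orbT.
have [ch _] := Lops_l1 zws' hi; have [cf _] := Lops_l1 zws' fi.
have [cb _] := Lops_l1 zws' (cintegrableB hi fi).
apply: eqae_trans (Lop_eqae q0 z1 cb (cintegrableB ch cf) (IH zws' hi fi)) _.
apply: eqae_trans (LopD q0 z1 ch (cintegrableN cf)) _.
by apply: aeS (LopN q0 z1 cf) => x E _; rewrite /= E.
Qed.

Lemma Lops_real N g : Lops q (nseq N 1) (fun x => (g x)%:C) = fun x => (iter N (Lreal q) g x)%:C.
Proof. by elim: N => [//|N IH] /=; rewrite IH; apply/funext => x; rewrite Lop1_real. Qed.

Lemma nseq1_unit N (z : C) : z \in nseq N 1 -> `|z| = 1.
Proof. by move=> /nseqP[-> _]; rewrite normr1. Qed.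

Lemma cintegrable_ncC h : cintegrable h -> cintegrable (fun x => (nc (h x))%:C).
Proof.
move=> hi; split; first exact: (integrable_nc hi).
exact: integrable0.
Qed.

Lemma l1_ncC h : l1 (fun x => (nc (h x))%:C) = l1 h.
Proof.
rewrite /l1 /L1norm; congr fine; apply: eq_integral => x _.
by rewrite ncR ger0_norm// nc_ge0.
Qed.

Lemma iter_Lreal_l1 N h : cintegrable h ->
  cintegrable (fun x => (iter N (Lreal q) (fun y => nc (h y)) x)%:C) /\
  l1 (fun x => (iter N (Lreal q) (fun y => nc (h y)) x)%:C) <= l1 h.
Proof.
move=> hi; rewrite -Lops_real -[in X in _ <= X](l1_ncC h).
by apply: Lops_l1; [exact: nseq1_unit|exact: cintegrable_ncC].
Qed.

Lemma bvle_bounded h M : bvle h M -> bounded h.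
Proof. by move=> hM; exists M => x; exact: bvle_bound. Qed.

(** Shorter words are prolonged to the common length N by full branches, and a
    minimum over finitely many weights is positive. *)
Lemma cylinders_all K : (0 < K)%N -> exists N0, forall N, (N0 <= N)%N ->
  exists2 g : R, 0 < g & forall j, (j < K)%N -> exists w,
    [/\ size w = N, cylinder q w (j%:R / K%:R) (j.+1%:R / K%:R) & g <= min_weight q w].
Proof.
move=> K0; have K0' : 0 < K%:R :> R by rewrite ltr0n.
have ex j : (j < K)%N -> exists w, cylinder q w (j%:R / K%:R) (j.+1%:R / K%:R).
  move=> jK; apply: (exists_cylinder q1).
  - by rewrite divr_ge0.
  - by rewrite ltr_pM2r ?invr_gt0// ltr_nat.
  - by rewrite ler_pdivrMr// mul1r ler_nat.
have [N0 hN0] : exists N0, forall j, (j < K)%N -> exists2 w, (size w <= N0)%N &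
    cylinder q w (j%:R / K%:R) (j.+1%:R / K%:R).
  have : forall i, (i <= K)%N -> exists N0, forall j, (j < i)%N -> exists2 w, (size w <= N0)%N &
    cylinder q w (j%:R / K%:R) (j.+1%:R / K%:R).
    elim=> [|i IH] iK; first by exists 0%N.
    have [n hn] := IH (ltnW iK); have [w cw] := ex i iK.
    exists (maxn n (size w)) => j; rewrite ltnS leq_eqVlt => /orP[/eqP ->|ji].
      by exists w => //; rewrite leq_max leqnn orbT.
    by have [w' sw' cw'] := hn j ji; exists w' => //; rewrite leq_max sw'.
  by move=> /(_ K (leqnn K)).
exists N0 => N NN.
suff : forall i, (i <= K)%N -> exists2 g : R, 0 < g & forall j, (j < i)%N -> exists w,
    [/\ size w = N, cylinder q w (j%:R / K%:R) (j.+1%:R / K%:R) & g <= min_weight q w].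
  by move=> /(_ K (leqnn K)).
elim=> [|i IH] iK; first by exists 1.
have [g g0 hg] := IH (ltnW iK); have [w sw cw] := hN0 i iK.
have [w' sw' cw'] := cylinder_long q1 (leq_trans sw NN) cw.
exists (Num.min g (min_weight q w')); first by rewrite lt_min g0 min_weight_gt0.
move=> j; rewrite ltnS leq_eqVlt => /orP[/eqP ->|ji].
  by exists w'; split => //; rewrite ge_min lexx orbT.
by have [u [su cu gu]] := hg j ji; exists u; split => //; rewrite ge_min gu.
Qed.

End Gain.

Section Twisted.
Variable R : realType.
Local Notation mu := (@lebesgue_measure R).
Local Notation C := R[i].
Variable q : R.
Hypothesis q1 : 1 < q.
Let q0 : 0 < q. Proof. exact: lt_trans q1. Qed.
Implicit Types (w : seq nat) (ws : seq C) (h f : R -> C) (g : R -> R).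

(** Along two neighbouring letters the values of [h] near a point of flatness
    return with almost the same modulus, but with phases whose ratio is [z]. *)
Lemma twisted_gain (z : C) (M : R) : `|z| = 1 -> z <> 1 -> 0 < M ->
  exists N0, forall N, (N0 <= N)%N -> exists2 e : R, 0 < e &
  forall ws h, size ws = N -> (forall u, u \in ws -> `|u| = 1) ->
    bvle h (M * l1 h) -> l1 (Lop z q (Lops q ws h)) <= (1 - e) * l1 h.
Proof.
move=> z1 zn M0.
pose D := 2 - nc (1 + z); have D0 : 0 < D by rewrite subr_gt0 nc_one_add.
(* The loss below is c1 * c * (|h y| D - 4 d |h|_1) with |h y| >= |h|_1 / 2. *)
pose d := D / 16; have d0 : 0 < d by rewrite divr_gt0.
have [K K0 flat] := flat_interval M0 d0.
have [N0 hN0] := cylinders_all q1 K0.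
exists N0 => N NN; have [c c0 words] := hN0 N NN.
(* The first two letters with full branches. *)
pose m := (nq q).+1.
pose c1 := q / m.+2%:R ^+ 2; have c10 : 0 < c1 by rewrite divr_gt0// exprn_gt0.
have cc0 : 0 < c1 * c by exact: mulr_gt0.
pose e := c1 * c * (D / 4); have e0 : 0 < e by rewrite mulr_gt0// divr_gt0.
exists e => // ws h sw zws hM.
have [hI _] := hM; have [hi _] := hI; have hb := bvle_bounded hM.
have [ci li] := Lops_l1 q1 zws hi.
have [l0|l0] := leP (l1 h) 0.
  have E : l1 h = 0 by apply/eqP; rewrite eq_le l0 l1_ge0.
  rewrite E mulr0; apply: le_trans (l1_Lop q0 z1 ci) _; by rewrite -E.
have [j [y [jK hy osc]]] := flat h hM l0.
have [w [swN cw cm]] := words j jK.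
have [gi gl] := iter_Lreal_l1 q1 N.+1 hi.
pose G := e * l1 h.
suff key x : Iunit x -> nc (Lop z q (Lops q ws h) x) <=
    nc ((iter N.+1 (Lreal q) (fun y => nc (h y)) x)%:C : C) - G.
  apply: le_trans (l1_gain (cintegrable_Lop q0 z1 ci) gi _ _ key) _.
  - by rewrite mulr_ge0 ?l1_ge0// ltW.
  - by move=> x; exact: Lop_out.
  by rewrite mulrBl mul1r lerD2r.
move=> Ix; have /IunitE/andP[x0 x1] := Ix.
have gM : exists B, forall t, 0 <= iter N (Lreal q) (fun y => nc (h y)) t <= B.
  apply: iter_Lreal_bounded => //.
  by have [B hB] := hb; exists B => t; rewrite nc_ge0 hB.
have [B hB] := gM.
have /andP[P0 _] := Lreal_bounded q1 x hB.
rewrite ncR; rewrite (ger0_norm P0).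
pose yn n := q / (n%:R + x).
pose t n : C := if (n == m) || (n == m.+1) then
  branch_phase ws w * (branch_weight q w (yn n))%:C * h (branch_point q w (yn n)) else 0.
have phu := branch_phase_unit w zws.
have good n : (n == m) || (n == m.+1) ->
    [/\ (0 < n)%N, branch_ok q w (yn n), nc (h (branch_point q w (yn n)) - h y) <= d * l1 h,
        c1 * c <= q / (n%:R + x) ^+ 2 * branch_weight q w (yn n) &
        nc (t n) = branch_weight q w (yn n) * nc (h (branch_point q w (yn n)))].
  move=> nm.
  have nn : (nq q < n)%N by move: nm => /orP[] /eqP ->.
  have nm' : (n <= m.+1)%N by move: nm => /orP[] /eqP ->.
  have n0 : (0 < n)%N by exact: leq_ltn_trans nn.
  have /andP[ok bp] := cw _ (full_branch q1 nn x0).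
  have bw := min_weight_le q1 ok.
  split => //; first exact: osc.
  - apply: ler_pM; [exact: ltW|exact: ltW| |exact: le_trans cm bw].
    apply: (le_trans _ (weight_min q1 n0 _)); last by rewrite x0.
    by rewrite ler_pM2l// lef_pV2 ?posrE ?exprn_gt0// lerXn2r ?nnegrE// ler_nat ltnS.
  - rewrite /t nm !ncM phu mul1r ncR ger0_norm//.
    exact: branch_weight_ge0 ok.
have gm1 : (m == m) || (m == m.+1) by rewrite eqxx.
have gm2 : (m.+1 == m) || (m.+1 == m.+1) by rewrite eqxx orbT.
have [_ ok1 o1 w1 t1] := good m gm1.
have [_ ok2 o2 w2 t2] := good m.+1 gm2.
have toff n : n != m -> n != m.+1 -> t n = 0.
  by rewrite /t => /negbTE -> /negbTE ->.
have := @Lop_split R q q1 z (Lops q ws h) (iter N (Lreal q) (fun y => nc (h y))) t x z1 gM Ix.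
rewrite (@rsum_two _ _ m)//; last by move=> i i1 i2; rewrite toff// nc0 mulr0.
rewrite (@csum1_two _ _ m)//; last by move=> i i1 i2; rewrite toff// mulr0.
rewrite t1 t2 => split.
set A1 := q / (m%:R + x) ^+ 2 * branch_weight q w (yn m) in w1.
set A2 := q / (m.+1%:R + x) ^+ 2 * branch_weight q w (yn m.+1) in w2.
set h1 := h (branch_point q w (yn m)) in o1 t1 split.
set h2 := h (branch_point q w (yn m.+1)) in o2 t2 split.
have pg := phase_gain z1 (ltW cc0) w1 w2 o1 o2.
have E : nc (z ^+ m * (q / (m%:R + x) ^+ 2)%:C * t m + z ^+ m.+1 * (q / (m.+1%:R + x) ^+ 2)%:C * t m.+1)
    = nc (A1%:C * h1 + z * A2%:C * h2).
  have -> : z ^+ m * (q / (m%:R + x) ^+ 2)%:C * t m + z ^+ m.+1 * (q / (m.+1%:R + x) ^+ 2)%:C * t m.+1 =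
     (z ^+ m * branch_phase ws w) * (A1%:C * h1 + z * A2%:C * h2).
    rewrite /t gm1 gm2 (exprS z m) -/h1 -/h2.
    have -> : A1%:C = (q / (m%:R + x) ^+ 2)%:C * (branch_weight q w (yn m))%:C by exact: rmorphM.
    have -> : A2%:C = (q / (m.+1%:R + x) ^+ 2)%:C * (branch_weight q w (yn m.+1))%:C by exact: rmorphM.
    by ring.
  by rewrite !ncM ncX nc_unit// expr1n phu !mul1r.
have {}split : nc (Lop z q (Lops q ws h) x) <= nc (A1%:C * h1 + z * A2%:C * h2) +
    (Lreal q (iter N (Lreal q) (fun y => nc (h y))) x - (A1 * nc h1 + A2 * nc h2)).
  rewrite -E; apply: le_trans (ncBD _ (z ^+ m * (q / (m%:R + x) ^+ 2)%:C * t m + z ^+ m.+1 * (q / (m.+1%:R + x) ^+ 2)%:C * t m.+1)) _.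
  rewrite addrC lerD2l; apply: le_trans (split _) _.
    move=> n n1; have [nm|] := boolP ((n == m) || (n == m.+1)); last first.
      rewrite negb_or => /andP[nm1 nm2]; rewrite toff// nc0 !subr0 -sw.
      exact: Lops_le_Lreal.
    have [_ okn _ _ tn] := good n nm; rewrite tn /t nm -sw.
    by apply: Lops_branch => //; rewrite swN sw.
  by rewrite /A1 /A2 !mulrA.
apply: le_trans split _; change (iter N.+1 (Lreal q) (fun y => nc (h y)) x) with
  (Lreal q (iter N (Lreal q) (fun y => nc (h y))) x).
have G1 : G <= c1 * c * (nc (h y) * D - 4 * (d * l1 h)).
  have -> : G = c1 * c * (l1 h / 2 * D - 4 * (d * l1 h)) by rewrite /G /e /d; field.
  by rewrite ler_pM2l// lerB// ler_pM2r.
have {}pg := le_trans G1 pg.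
have lin (a1 a2 a3 a4 : R) : a4 <= a2 - a1 -> a1 + (a3 - a2) <= a3 - a4.
  clear; lra.
exact: lin.
Qed.

End Twisted.

Section Untwisted.
Variable R : realType.
Local Notation mu := (@lebesgue_measure R).
Local Notation C := R[i].
Variable q : R.
Hypothesis q1 : 1 < q.
Let q0 : 0 < q. Proof. exact: lt_trans q1. Qed.
Implicit Types (w : seq nat) (ws : seq C) (h f : R -> C) (g : R -> R).

(** A single inverse branch into an interval on which g is not small already gives
    the lower bound at all points. *)
Lemma iter_Lreal_lower (M : R) : 0 < M ->
  exists N0, forall N, (N0 <= N)%N -> exists2 e : R, 0 < e &
  forall g, (forall x, 0 <= g x) -> let h := fun x => (g x)%:C in
    bvle h (M * l1 h) -> forall x, Iunit x -> e * l1 h <= iter N (Lreal q) g x.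
Proof.
move=> M0; have d0 : 0 < 4^-1 :> R by rewrite invr_gt0.
have [K K0 flat] := flat_interval M0 d0.
have [N0 hN0] := cylinders_all q1 K0.
exists N0 => N NN; have [c c0 words] := hN0 N NN.
exists (c / 4); first exact: divr_gt0.
move=> g g0 h hM x Ix; have hb := bvle_bounded hM.
have gh : (fun y => nc (h y)) = g.
  by apply/funext => y; rewrite /h ncR ger0_norm.
have gM : exists B, forall t, 0 <= g t <= B.
  by have [B hB] := hb; exists B => t; rewrite g0 -gh hB.
have [l0|l0] := leP (l1 h) 0.
  have -> : l1 h = 0 by apply/eqP; rewrite eq_le l0 l1_ge0.
  rewrite mulr0; have [B hB] := iter_Lreal_bounded q1 N gM; by have /andP[] := hB x.
have [j [y [jK hy osc]]] := flat h hM l0.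
have [w [swN cw cm]] := words j jK.
have /andP[ok bp] := cw x (proj1 (IunitE x) Ix).
have sw : size w = size (nseq N (1 : C)) by rewrite size_nseq.
have B := @Lops_branch R q q1 (nseq N 1) w h x (@nseq1_unit R N) hb sw ok.
have {}B := le_trans (nc_ge0 _) B.
rewrite size_nseq gh subr_ge0 in B; apply: le_trans B.
have bw := le_trans cm (min_weight_le q1 ok).
have o := osc _ bp; have hy2 := le_trans hy (ncBD (h y) (h (branch_point q w x))).
rewrite ncB in hy2.
rewrite -mulrA; apply: ler_pM => //; first exact: ltW.
  by rewrite mulr_ge0// ltW.
lra.
Qed.

Lemma dist_max0 (a b : R) : `|Num.max a 0 - Num.max b 0| <= `|a - b|.
Proof.
have h1 := ler_norm (a - b); have h2 := ler_norm (b - a); rewrite distrC in h2.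
rewrite ler_norml; apply/andP; split; case: (leP a 0); case: (leP b 0); lra.
Qed.

Lemma bvle_pos g (M : R) : bvle (fun x => (g x)%:C) M ->
  bvle (fun x => (Num.max (g x) 0)%:C) M.
Proof.
move=> [[gi g0] [v [v1 vm vv] vM]].
have [mg _] := cintegrable_cmeas gi.
split; last first.
  exists v => //; split => // s t s0 st; apply: le_trans (vv s t s0 st).
  by rewrite -!rmorphB !ncR dist_max0.
split; last first.
  by move=> x /g0 [->]; rewrite maxxx.
apply: cintegrable_le gi _; last first.
  move=> x; rewrite !ncR; have := dist_max0 (g x) 0; by rewrite maxxx !subr0.
by apply: cmeasR; apply: measurable_maxr.
Qed.

Lemma l1_real g : cintegrable (fun x => (g x)%:C) ->
  l1 (fun x => (g x)%:C) = \int[mu]_x `|g x|.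
Proof. by move=> _; rewrite /l1 /L1norm /Rintegral; congr fine; apply: eq_integral => x _; rewrite ncR. Qed.

(** Both the positive and the negative part spread over the whole interval, and
    the overlap cancels. *)
Lemma untwisted_gain (M : R) : 0 < M ->
  exists N0, forall N, (N0 <= N)%N -> exists2 e : R, 0 < e &
  forall g, let h := fun x => (g x)%:C in \int[mu]_x g x = 0 ->
    bvle h (M * l1 h) -> l1 (Lops q (nseq N 1) h) <= (1 - e) * l1 h.
Proof.
move=> M0; have [|N0 hN0] := @iter_Lreal_lower (2 * M); first exact: mulr_gt0.
exists N0 => N NN; have [e e0 low] := hN0 N NN; exists e => // g h g0 hM.
pose p x := Num.max (g x) 0; pose n x := Num.max (- g x) 0.
pose hp x := (p x)%:C : C; pose hn x := (n x)%:C : C.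
have pB : bvle hp (M * l1 h) by exact: bvle_pos.
have nB : bvle hn (M * l1 h).
  apply: (@bvle_pos (fun x => - g x)); have := bvleZ (-1) hM.
  rewrite ncN nc1 mul1r; congr bvle; apply/funext => x.
  by rewrite /h mulN1r rmorphN.
have p0 x : 0 <= p x by rewrite /p le_max lexx orbT.
have n0 x : 0 <= n x by rewrite /n le_max lexx orbT.
have gE x : g x = p x - n x.
  by rewrite /p /n; case: (leP (g x) 0); case: (leP (- g x) 0); lra.
have aE x : `|g x| = p x + n x.
  by rewrite /p /n; case: (leP (g x) 0) => gx; case: (leP (- g x) 0) => gn;
   [rewrite ler0_norm//|rewrite ler0_norm//|rewrite gtr0_norm//|rewrite gtr0_norm//]; lra.
have [[pi _] _] := pB; have [[ni _] _] := nB; have [[hi _] _] := hM.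
have [pi1 _] := pi; have [ni1 _] := ni.
have lp : l1 hp = \int[mu]_x p x.
  by rewrite l1_real//; apply: eq_Rintegral => x _; rewrite ger0_norm.
have ln : l1 hn = \int[mu]_x n x.
  by rewrite l1_real//; apply: eq_Rintegral => x _; rewrite ger0_norm.
have E1 : l1 hp - l1 hn = 0.
  by rewrite lp ln -RintegralB// -g0; apply: eq_Rintegral => x _; rewrite gE.
have E2 : l1 h = l1 hp + l1 hn.
  rewrite l1_real// lp ln -RintegralD//; apply: eq_Rintegral => x _; exact: aE.
have el : l1 hn = l1 hp by apply/esym/eqP; rewrite -subr_eq0 E1.
have lpE : M * l1 h = 2 * M * l1 hp by rewrite E2 el; ring.
have lnE : M * l1 h = 2 * M * l1 hn by rewrite lpE el.
have P x : Iunit x -> e * l1 hp <= iter N (Lreal q) p x.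
  by apply: (low p p0); rewrite lpE in pB.
have Q x : Iunit x -> e * l1 hn <= iter N (Lreal q) n x.
  by apply: (low n n0); rewrite lnE in nB.
have u1 := @nseq1_unit R N.
have [cp lcp] := Lops_l1 q1 u1 pi; have [cn lcn] := Lops_l1 q1 u1 ni.
have [ch _] := Lops_l1 q1 u1 hi.
have hE : h = (fun x => hp x - hn x).
  by apply/funext => x; rewrite /h gE rmorphB.
have := Lops_eqaeB q1 u1 pi ni; rewrite -hE => ae.
rewrite (l1_eqae (cintegrable_cmeas ch) (cintegrable_cmeas (cintegrableB cp cn)) ae).
pose G := e * l1 h.
have G0 : 0 <= G by rewrite mulr_ge0 ?l1_ge0// ltW.
rewrite mulrBl mul1r -/G.
apply: le_trans (l1_gain (cintegrableB cp cn) (cintegrableD cp cn) G0 _ _) _; last first.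
- rewrite lerD2r E2; apply: le_trans (l1D cp cn) _; exact: lerD.
- move=> x Ix; have := P x Ix; have := Q x Ix.
  rewrite !Lops_real -rmorphB -rmorphD !ncR /G E2.
  move: (iter N (Lreal q) p x) (iter N (Lreal q) n x) => a b h1 h2.
  rewrite el in h1 *.
  have elp : 0 <= e * l1 hp by rewrite mulr_ge0 ?l1_ge0// ltW.
  have e2 : e * (l1 hp + l1 hp) = 2 * (e * l1 hp) by ring.
  rewrite e2; move: (e * l1 hp) elp h1 h2 => c; clear => c0 h1 h2.
  rewrite ler_norml ger0_norm; last by lra.
  by apply/andP; split; lra.
- move=> x nx; rewrite !Lops_real; case: N {NN hN0 low u1 cp lcp cn lcn ch ae P Q} => [|N].
    by have [[_ p00] _] := pB; have [[_ n00] _] := nB; change (hp x - hn x = 0); rewrite p00// n00// subr0.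
  by rewrite /= /Lreal memNset// subr0.
Qed.

End Untwisted.

(** * Contraction *)

Section Arithmetic.
Variable R : realType.
Implicit Types a c e s r : R.

Lemma contract_small a' a c e s r : a' <= (1 - e) * a -> s * a <= e / 2 * a ->
  s * c <= (1 - r) * c -> a' + (r * c + e / 2 * a) <= (1 - s) * (a + c).
Proof. by move=> *; lra. Qed.

Lemma contract_large a' a c e s r : a' <= a ->
  s * a + e / 2 * a + s * c <= (1 - r) * c -> a' + (r * c + e / 2 * a) <= (1 - s) * (a + c).
Proof. by move=> *; lra. Qed.

End Arithmetic.

Section Contraction.
Variable R : realType.
Local Notation C := R[i].

Lemma bvle_l1 (h : R -> C) M : bvle h M -> l1 h <= M.
Proof.
move=> hM; have [[hi h0] _] := hM.
rewrite -prim_l1; last by split.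
rewrite -[leLHS]subr0 -[X in _ - X](prim_0 (fun x => nc (h x))) -[leRHS]mulr1 -[X in _ <= M * X]subr0.
apply: (prim_upper (integrable_nc hi)) => // u _; exact: bvle_bound hM.
Qed.

Variables (T : (R -> C) -> R -> C) (P : (R -> C) -> Prop) (r B e : R).
Hypotheses (r0 : 0 < r) (r1 : r < 1) (B0 : 0 < B) (e0 : 0 < e).
Hypothesis PT : forall h, P h -> P (T h).
Hypothesis LY : forall h b, P h -> bvle h b -> bvle (T h) (r * b + B * l1 h).
Hypothesis nonexp : forall h b, P h -> bvle h b -> l1 (T h) <= l1 h.
Hypothesis gain : forall h, P h -> bvle h (2 * B / (1 - r) * l1 h) ->
  l1 (T h) <= (1 - e) * l1 h.

Let k := e / (2 * B).
Let s := e * (1 - r) / (2 * (1 - r + e)).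
Let r1' : 0 < 1 - r. Proof. by rewrite subr_gt0. Qed.
Let re0 : 0 < 1 - r + e. Proof. exact: addr_gt0. Qed.
Let k0 : 0 < k. Proof. by rewrite divr_gt0// mulr_gt0. Qed.
Let s0 : 0 < s. Proof. by rewrite divr_gt0// mulr_gt0. Qed.
Let se : s <= e / 2.
Proof.
rewrite /s ler_pdivrMr ?mulr_gt0//.
have -> : e / 2 * (2 * (1 - r + e)) = e * (1 - r) + e * e by field.
by rewrite lerDl mulr_ge0// ltW.
Qed.
Let sr : s <= (1 - r) / 2.
Proof.
rewrite /s ler_pdivrMr ?mulr_gt0//.
have -> : (1 - r) / 2 * (2 * (1 - r + e)) = e * (1 - r) + (1 - r) * (1 - r) by field.
by rewrite lerDl mulr_ge0// ltW.
Qed.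
Let sr1 : s <= 1 - r.
Proof. by apply: le_trans sr _; rewrite ler_pdivrMr// mulr_natr mulr2n lerDl ltW. Qed.
Let kB : k * B = e / 2. Proof. by rewrite /k; field; rewrite gt_eqF. Qed.

(** In the norm a + k b, with a the L1 norm and b the variation, the operator
    contracts: if a dominates because of the gain, if b does because of the
    variation inequality. *)
Let step h b : P h -> bvle h b -> exists2 b', bvle (T h) b' &
  l1 (T h) + k * b' <= (1 - s) * (l1 h + k * b).
Proof.
move=> Ph hb; exists (r * b + B * l1 h); first exact: LY.
have a0 := l1_ge0 h; have b0 := bvle_ge0 hb.
have kb : 0 <= k * b by rewrite mulr_ge0// ltW.
have E : k * (r * b + B * l1 h) = r * (k * b) + e / 2 * l1 h by rewrite -kB; ring.
rewrite E; have [hab|hab] := leP b (2 * B / (1 - r) * l1 h).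
  have G := gain Ph (bvle_mono hab hb).
  have S1 : s * l1 h <= e / 2 * l1 h by rewrite ler_wpM2r.
  have S2 : s * (k * b) <= (1 - r) * (k * b) by rewrite ler_wpM2r.
  exact: (contract_small G S1 S2).
have N := nonexp Ph hb.
have U : e * l1 h <= (1 - r) * (k * b).
  have -> : (1 - r) * (k * b) = e * ((1 - r) * b / (2 * B)) by rewrite /k; field; rewrite gt_eqF.
  rewrite ler_pM2l// ler_pdivlMr ?mulr_gt0//.
  by move: (ltW hab); rewrite mulrAC ler_pdivrMr// mulrC (mulrC b).
have V : s * l1 h + (e / 2) * l1 h + s * (k * b) <= (1 - r) * (k * b).
  have sl : 2 * s * (1 - r + e) = e * (1 - r) by rewrite /s; field; rewrite gt_eqF.
  have W : s * (e * l1 h) <= s * ((1 - r) * (k * b)) by rewrite ler_pM2l.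
  have X : s * l1 h <= e / 2 * l1 h by rewrite ler_wpM2r.
  rewrite -(ler_pM2l e0).
  have -> : e * (s * l1 h + e / 2 * l1 h + s * (k * b)) =
    s * (e * l1 h) + e / 2 * (e * l1 h) + s * e * (k * b) by ring.
  apply: (@le_trans _ _ (s * ((1 - r) * (k * b)) + e / 2 * ((1 - r) * (k * b)) + s * e * (k * b))).
    by rewrite lerD2r lerD// ler_wpM2l// divr_ge0// ltW.
  have -> : s * ((1 - r) * (k * b)) + e / 2 * ((1 - r) * (k * b)) + s * e * (k * b) =
    (2 * s * (1 - r + e)) / 2 * (k * b) + e / 2 * ((1 - r) * (k * b)) by field.
  by rewrite sl le_eqVlt; apply/orP; left; apply/eqP; field.
exact: (contract_large N V).
Qed.

Lemma bv_contraction : exists K t : R, [/\ 0 <= K, 0 < t < 1 &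
  forall h b n, P h -> bvle h b -> bvle (iter n T h) (K * t ^+ n * b)].
Proof.
exists ((1 + k) / k), (1 - s); split.
- by rewrite divr_ge0 ?addr_ge0// ltW.
- by rewrite subr_gt0 (le_lt_trans sr1) ?gtrBl//= gtrBl.
have s1 : 0 <= 1 - s by rewrite subr_ge0 (le_trans sr1)// gerBl ltW.
move=> h b n Ph hb.
have [b' hb' H] : exists2 b', bvle (iter n T h) b' &
    l1 (iter n T h) + k * b' <= (1 - s) ^+ n * (l1 h + k * b).
  suff [_ //] : P (iter n T h) /\ exists2 b', bvle (iter n T h) b' &
    l1 (iter n T h) + k * b' <= (1 - s) ^+ n * (l1 h + k * b).
  elim: n => [|n [Pn [b' hb' IH]]]; first by split => //; exists b => //; rewrite mul1r.
  split; first exact: PT.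
  have [b2 hb2 S] := step Pn hb'; exists b2 => //; apply: le_trans S _.
  by rewrite exprS -mulrA ler_wpM2l// s1.
apply: bvle_mono hb'.
rewrite -(ler_pM2l k0); apply: (@le_trans _ _ (l1 (iter n T h) + k * b')).
  by rewrite lerDr l1_ge0.
apply: le_trans H _.
have -> : k * ((1 + k) / k * (1 - s) ^+ n * b) = (1 - s) ^+ n * (b + k * b).
  by field; rewrite gt_eqF.
by rewrite ler_wpM2l ?lerD2r ?(bvle_l1 hb)// exprn_ge0// s1.
Qed.

End Contraction.

(** * Decay on functions of bounded variation *)

Section Decay.
Variable R : realType.
Local Notation mu := (@lebesgue_measure R).
Local Notation C := R[i].
Variable q : R.
Hypothesis q1 : 1 < q.
Let q0 : 0 < q. Proof. exact: lt_trans q1. Qed.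
Implicit Types (ws : seq C) (h f : R -> C) (g : R -> R).
Local Notation rate := (rate q).

(** The sum of the geometric series of the errors in [lasota_yorke]. *)
Definition ly_const := 5 / (1 - rate).

Let r0 : 0 < rate. Proof. exact: rate_gt0. Qed.
Let r1 : rate < 1. Proof. exact: rate_lt1. Qed.
Let B0 : 0 < ly_const.
Proof. by rewrite divr_gt0// subr_gt0. Qed.
Let gr : 0 < 2 * ly_const / (1 - rate).
Proof. by apply: divr_gt0; [exact: mulr_gt0|rewrite subr_gt0]. Qed.

(** The constant does not grow with the number of factors. *)
Lemma Lops_bvle ws h M : (forall z, z \in ws -> `|z| = 1) -> bvle h M ->
  bvle (Lops q ws h) (rate ^+ size ws * M + ly_const * l1 h).
Proof.
move=> + hM; have [[hi _] _] := hM.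
elim: ws => [|z ws IH] zws.
  apply: bvle_mono hM; rewrite expr0 mul1r lerDl mulr_ge0 ?l1_ge0//; exact: ltW.
have z1 : `|z| = 1 by apply: zws; rewrite mem_head.
have zws' u : u \in ws -> `|u| = 1 by move=> uw; apply: zws; rewrite in_cons uw orbT.
have [_ ll] := Lops_l1 q1 zws' hi.
apply: bvle_mono (lasota_yorke q1 z1 (IH zws')).
have -> : rate ^+ size (z :: ws) * M + ly_const * l1 h =
  rate * (rate ^+ size ws * M + ly_const * l1 h) + 5 * l1 h.
  rewrite [size _]/= exprS /ly_const; field; rewrite subr_eq0 eq_sym lt_eqF//.
by rewrite lerD2l ler_pM2l.
Qed.

Lemma Lops_bvle_pos ws h M : (0 < size ws)%N -> (forall z, z \in ws -> `|z| = 1) ->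
  bvle h M -> bvle (Lops q ws h) (rate * M + ly_const * l1 h).
Proof.
move=> sw zws hM; apply: bvle_mono (Lops_bvle zws hM).
rewrite lerD2r ler_wpM2r ?(bvle_ge0 hM)//.
by case: (size ws) sw => // n _; rewrite exprS ler_piMr ?exprn_ile1 ?(ltW r0)// ltW.
Qed.

Lemma geometric_small (t K d : R) : 0 < t < 1 -> 0 <= K -> 0 < d ->
  exists n, K * t ^+ n <= d.
Proof.
move=> /andP[t0 t1] K0 d0.
have ht : `|t| < 1 by rewrite ger0_norm// ltW.
have /cvgrPdist_le H : (fun n => K * t ^+ n) @ \oo --> (0 : R).
  rewrite -[X in _ --> X](mulr0 K); apply: cvgM; first exact: cvg_cst.
  exact: cvg_expr.
have [n _ hn] := H d d0; exists n; have := hn n (leqnn n).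
by rewrite sub0r normrN ger0_norm// mulr_ge0// exprn_ge0// ltW.
Qed.

Section Twisted.
Variables (z e : C).
Hypotheses (z1 : `|z| = 1) (e1 : `|e| = 1).
Local Notation Q := (Qop q z e).

Definition qword k : seq C := iter k (fun ws => [:: z, e & ws]) [::].

Lemma size_qword k : size (qword k) = k.*2.
Proof. by elim: k => //= k ->. Qed.

Lemma qword_unit k u : u \in qword k -> `|u| = 1.
Proof.
by elim: k => //= k IH; rewrite !in_cons => /orP[/eqP ->//|/orP[/eqP ->//|]].
Qed.

Lemma iter_Qop k h : iter k Q h = Lops q (qword k) h.
Proof. by elim: k => // k IH; rewrite iterS IH. Qed.

Lemma iter_Qop_l1 k h : cintegrable h ->
  cintegrable (iter k Q h) /\ l1 (iter k Q h) <= l1 h.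
Proof. by move=> hi; rewrite iter_Qop; apply: Lops_l1 => // u; exact: qword_unit. Qed.

Let Q_gain : (z, e) <> (1, 1) -> exists k, exists2 d : R, 0 < d &
  forall h, bvle h (2 * ly_const / (1 - rate) * l1 h) ->
    l1 (iter k.+1 Q h) <= (1 - d) * l1 h.
Proof.
move=> ze; have [e1'|en] := pselect (e = 1).
  have zn : z <> 1 by move=> z1'; apply: ze; rewrite z1' e1'.
  have [N0 gain] := twisted_gain q1 z1 zn gr.
  have [|d d0 hd] := gain N0.*2.+1; first by rewrite -addnn -addSn leq_addl.
  exists N0, d => // h hb; rewrite iterS iter_Qop.
  apply: (hd (e :: qword N0)) => //; first by rewrite /= size_qword.
  by move=> u; rewrite in_cons => /orP[/eqP ->//|]; exact: qword_unit.
have [N0 gain] := twisted_gain q1 e1 en gr.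
have [|d d0 hd] := gain N0.*2; first by rewrite -addnn leq_addl.
exists N0, d => // h hb; rewrite iterS iter_Qop.
have [[hi _] _] := hb.
have [ci _] := Lops_l1 q1 (@qword_unit N0) hi.
apply: (le_trans (l1_Lop q0 z1 (cintegrable_Lop q0 e1 ci))).
apply: hd => //; [exact: size_qword|exact: qword_unit].
Qed.

(** At least one of the two factors of Q is twisted; the word of the other factors
    is chosen such that this one comes last. *)
Lemma Q_small_bv h b d : (z, e) <> (1, 1) -> bvle h b -> 0 < d ->
  exists n, l1 (iter n Q h) <= d.
Proof.
move=> ze hb d0; have [k [c c0 gain]] := Q_gain ze.
have [||||K [t [K0 t01 H]]] := @bv_contraction R (iter k.+1 Q) (fun=> True) rate ly_const c r0 r1 B0 c0.
- by [].
- move=> f M _ fM; rewrite iter_Qop; by apply: Lops_bvle_pos => //; exact: qword_unit.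
- by move=> f M _ [[fi _] _]; have [] := iter_Qop_l1 k.+1 fi.
- by move=> f _; exact: gain.
have [|n hn] := geometric_small t01 (_ : 0 <= K * b) d0.
  by rewrite mulr_ge0// (bvle_ge0 hb).
exists (n * k.+1)%N; rewrite iterM; apply: le_trans hn.
by have := bvle_l1 (H h b n I hb); rewrite mulrAC.
Qed.

End Twisted.

Section Untwisted.

Lemma cintegral_Lop1 h : L1on (@Iunit R) h ->
  cintegral (@Iunit R) (Lop 1 q h) = cintegral (@Iunit R) h.
Proof.
move=> [hi h0]; rewrite LopE// cintegral_Sop1; last exact: cintegrable_Jop.
have -> : cintegral (@Gt1 R) (Jop q h) = cintegral (@Rpos R) (Jop q h).
  apply: cintegral_zext; [exact: measurable_Gt1|exact: measurable_Rpos| |].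
    by move=> x /Gt1E x1; apply/RposE; exact: lt_trans x1.
  move=> x /RposE x0 nx; rewrite JopE// h0 ?mulr0// => /IunitE/andP[_].
  rewrite ltr_pdivrMr// mul1r => qx; apply: nx; apply/Gt1E; exact: lt_trans qx.
rewrite cintegral_Jop//; apply/esym.
apply: cintegral_zext; [exact: measurable_Iunit|exact: measurable_Rpos| |].
  by move=> x /IunitE/andP[x0 _]; exact/RposE.
by move=> x _; exact: h0.
Qed.

Definition real_zero h := [/\ L1on (@Iunit R) h, forall x, complex.Im (h x) = 0 &
  cintegral (@Iunit R) h = 0].

Lemma real_zeroE h : real_zero h -> h = (fun x => (complex.Re (h x))%:C).
Proof. by move=> [_ im _]; apply/funext => x; apply: complex_ext => //=; exact: im. Qed.

Lemma real_zero_Lops N h : real_zero h -> real_zero (Lops q (nseq N 1) h).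
Proof.
elim: N => // N IH h0; have [[fi f0] im ct] := IH h0; split.
- by split; [apply: cintegrable_Lop => //; exact: normr1|move=> x; exact: Lop_out].
- move=> x; rewrite [Lops _ _ _]/= (real_zeroE (IH h0)).
  by change (complex.Im (Lop 1 q (fun x => (complex.Re (Lops q (nseq N 1) h x))%:C) x) = 0); rewrite Lop1_real.
- by rewrite -ct; exact: cintegral_Lop1.
Qed.

Lemma Lop1_decay : exists m K t, [/\ 0 <= K, 0 < t < 1 & forall h b n,
  real_zero h -> bvle h b ->
  bvle (iter n (Lops q (nseq m.+1 1)) h) (K * t ^+ n * b)].
Proof.
have [N0 gain] := untwisted_gain q1 gr.
have [|d d0 hd] := gain N0.+1; first exact: leqnSn.
exists N0; have [||||K [t H]] := @bv_contraction R (Lops q (nseq N0.+1 1)) real_zero rate ly_const d r0 r1 B0 d0.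
- by move=> h; exact: real_zero_Lops.
- by move=> f M _ fM; apply: Lops_bvle_pos => //; exact: nseq1_unit.
- by move=> f M _ [[fi _] _]; have [] := Lops_l1 q1 (@nseq1_unit R N0.+1) fi.
- move=> f fz; rewrite (real_zeroE fz) => fb; apply: hd => //.
  have [[fi f0] _ ct] := fz.
  have := congr1 (@complex.Re R) ct; rewrite /cintegral /= => <-.
  rewrite /Rintegral [in RHS]integral_mkcond; congr fine; apply: eq_integral => x _.
  rewrite patchE; case: ifPn => // /negP nx; rewrite f0// => Ix.
  by apply: nx; rewrite inE.
by exists K, t.
Qed.

End Untwisted.

End Decay.

(** * Iterates of the constant function *)

Section Density.
Variable R : realType.
Local Notation mu := (@lebesgue_measure R).
Local Notation C := R[i].
Variable q : R.
Hypothesis q1 : 1 < q.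
Let q0 : 0 < q. Proof. exact: lt_trans q1. Qed.
Implicit Types (ws : seq C) (h f : R -> C) (g : R -> R).

(** For bounded functions the series converge at every point, so that linearity
    is exact. *)
Lemma LopB_bounded (z : C) h f x : `|z| = 1 -> bounded h -> bounded f ->
  Lop z q (fun y => h y - f y) x = Lop z q h x - Lop z q f x.
Proof.
move=> z1 hb fb; have [Ix|nI] := pselect (Iunit x); last by rewrite !Lop_out// subr0.
have /IunitE/andP[x0 _] := Ix.
have sum k : bounded k -> csummable (fun n => z ^+ n * (q / (n%:R + x) ^+ 2)%:C * k (q / (n%:R + x))).
  move=> [M kM].
  have kM' y : 0 <= nc (k y) <= M by rewrite nc_ge0 kM.
  apply: (csummable_le (Lreal_summable q1 kM' x0)) => n _.
  rewrite !ncM ncX nc_unit// expr1n mul1r ncR ger0_norm//.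
  by rewrite divr_ge0 ?(ltW q0)// exprn_ge0// addr_ge0// ltW.
rewrite /Lop !zextT// -[X in _ + X]mulN1r -csum1M; last exact: sum.
rewrite -csum1D; [|exact: sum|by apply: csummableM; exact: sum].
by congr csum1; apply/funext => n; rewrite mulrBr mulN1r.
Qed.

Lemma Lop_bounded (z : C) h : `|z| = 1 -> bounded h -> bounded (Lop z q h).
Proof.
move=> z1 [M hM]; exists (2 * (q * M)) => x.
have hM' y : 0 <= nc (h y) <= M by rewrite nc_ge0 hM.
apply: (le_trans (Lop_le_Lreal q1 x z1 (ex_intro _ M hM') (fun y => lexx _))).
by have /andP[] := Lreal_bounded q1 x hM'.
Qed.

Lemma Lops_bounded ws h : (forall u, u \in ws -> `|u| = 1) -> bounded h -> bounded (Lops q ws h).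
Proof.
elim: ws => [//|z ws IH] zws hb; apply: Lop_bounded; first by apply: zws; rewrite mem_head.
by apply: IH => // u uw; apply: zws; rewrite in_cons uw orbT.
Qed.

Lemma LopsB_bounded ws h f : (forall u, u \in ws -> `|u| = 1) -> bounded h -> bounded f ->
  Lops q ws (fun y => h y - f y) = (fun x => Lops q ws h x - Lops q ws f x).
Proof.
move=> + hb fb; elim: ws => [//|z ws IH] zws.
have z1 : `|z| = 1 by apply: zws; rewrite mem_head.
have zws' u : u \in ws -> `|u| = 1 by move=> uw; apply: zws; rewrite in_cons uw orbT.
apply/funext => x; change (Lop z q (Lops q ws (fun y => h y - f y)) x =
  Lop z q (Lops q ws h) x - Lop z q (Lops q ws f) x).
by rewrite IH// LopB_bounded//; exact: Lops_bounded.
Qed.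

Definition one_unit : R -> C := fun x => (\1_(@Iunit R) x)%:C.
Definition iter_one k : R -> R := iter k (Lreal q) (\1_(@Iunit R)).

Lemma iter_oneE k : (fun x => (iter_one k x)%:C) = Lops q (nseq k 1) one_unit.
Proof. by rewrite -Lops_real. Qed.

Lemma one_in x : Iunit x -> one_unit x = 1.
Proof. by move=> nx; rewrite /one_unit indicE mem_set. Qed.

Definition initial c : R -> C := fun x => (\1_`]0, c[ x)%:C.

Lemma initial_in c x : 0 < x < c -> initial c x = 1.
Proof. by move=> xc; rewrite /initial indicE mem_set//= in_itv. Qed.

Lemma initial_out c x : ~~ (0 < x < c) -> initial c x = 0.
Proof. by move=> xc; rewrite /initial indicE memNset//= in_itv; apply/negP. Qed.

Lemma cintegrable_initial c : cintegrable (initial c).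
Proof.
apply/cintegrableP; split.
  by apply: cmeasR; apply: measurable_indic; exact: measurable_itv.
apply: (@le_lt_trans _ _ (\int[mu]_x (\1_`]0%R, c[ x)%:E)%E).
  rewrite /L1norm le_eqVlt; apply/orP; left; apply/eqP; apply: eq_integral => x _.
  by rewrite ncR ger0_norm.
rewrite integral_indic// setIT [X in (X < _)%E](lebesgue_measure_itv `]0%R, c[)/=.
by case: ifP => _; rewrite ?sube0 ltry.
Qed.

Lemma bvle_initial c : c <= 1 -> bvle (initial c) 1.
Proof.
move=> c1; split.
  split=> [|x nx]; first exact: cintegrable_initial.
  apply: initial_out; apply/negP => /andP[x0 xc]; apply: nx; apply/IunitE.
  by rewrite x0 (lt_le_trans xc).
exists (fun t => if t < c then 1 else 0); last by case: ifP.
split=> [t t1|s t s0 st|s t s0 st]; first by rewrite ltNge (le_trans c1).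
  case: (ltP t c) => t1; first by rewrite (le_lt_trans st t1).
  by case: ifP.
case: (ltP t c) => tc.
  rewrite (le_lt_trans st tc) !initial_in ?subrr ?nc0//.
    by rewrite (lt_le_trans s0 st).
  by rewrite s0 (le_lt_trans st tc).
rewrite (@initial_out c t); last by rewrite negb_and -!leNgt tc orbT.
rewrite !subr0; case: (ltP s c) => sc; first by rewrite initial_in ?nc1// s0.
by rewrite initial_out ?nc0// negb_and -!leNgt sc orbT.
Qed.

Lemma cintegrable_one : cintegrable one_unit.
Proof. exact: (cintegrable_initial 1). Qed.

Lemma bvle_one : bvle one_unit 1.
Proof. exact: (bvle_initial (lexx 1)). Qed.

Lemma cintegral_one : cintegral (@Iunit R) one_unit = 1.
Proof.
rewrite /cintegral; apply: complex_ext => /=; last exact: (congr1 fine (integral0 _ _)).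
rewrite (@eq_Rintegral _ _ _ _ _ (cst 1)); last first.
  by move=> x; rewrite inE => Ix; rewrite indicE mem_set.
rewrite Rintegral_cst//; last exact: measurable_Iunit.
by rewrite [X in fine X](lebesgue_measure_itv `]0%R, 1%R[)/= lte_fin ltr01 sube0 mulr1.
Qed.

Definition iter_one_bound := 1 + ly_const q.

Let ly0 : 0 < ly_const q.
Proof. by rewrite divr_gt0// subr_gt0 rate_lt1. Qed.

Lemma bvle_iter_one k : bvle (fun x => (iter_one k x)%:C) iter_one_bound.
Proof.
rewrite iter_oneE; apply: bvle_mono (Lops_bvle q1 (@nseq1_unit R k) bvle_one).
rewrite mulr1; apply: lerD.
  by rewrite exprn_ile1 ?(ltW (rate_gt0 q1))// ltW// rate_lt1.
by rewrite ler_piMr ?(ltW ly0)// (bvle_l1 bvle_one).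
Qed.

Lemma iter_one_ge0 k x : 0 <= iter_one k x.
Proof.
have [|M] := @iter_Lreal_bounded R q q1 (\1_(@Iunit R)) k; last by move=> /(_ x)/andP[].
by exists 1 => y; rewrite indicE; case: (y \in _); rewrite lexx ?ler01.
Qed.

Lemma iter_one_out k x : ~ Iunit x -> iter_one k x = 0.
Proof.
move=> nx; have [[_ h0] _] := bvle_iter_one k.
by have := congr1 (@complex.Re R) (h0 x nx).
Qed.

Lemma cintegral_iter_one k : cintegral (@Iunit R) (fun x => (iter_one k x)%:C) = 1.
Proof.
elim: k => [|k IH]; first exact: cintegral_one.
rewrite -IH -[RHS](@cintegral_Lop1 R q q1); last by case: (bvle_iter_one k).
by congr cintegral; apply/funext => x; rewrite Lop1_real.
Qed.

Lemma integral_iter_one k : \int[mu]_(x in @Iunit R) iter_one k x = 1.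
Proof. by have := congr1 (@complex.Re R) (cintegral_iter_one k). Qed.

Lemma l1_iter_one k : l1 (fun x => (iter_one k x)%:C) = 1.
Proof.
have [[hi h0] _] := bvle_iter_one k.
rewrite l1_real// -(integral_iter_one k) /Rintegral [in RHS]integral_mkcond; congr fine.
apply: eq_integral => x _; rewrite patchE (ger0_norm (iter_one_ge0 k x)).
by case: ifPn => // /negP nx; rewrite iter_one_out// => Ix; apply: nx; rewrite inE.
Qed.

(** Two iterates differ by an iterate of a function of mean zero, which is small
    in variation and hence uniformly small. *)
Lemma iter_one_cauchy (d : R) : 0 < d -> exists N, forall k x, (N <= k)%N ->
  `|iter_one k x - iter_one N x| <= d.
Proof.
move=> d0; have [m [K [t [K0 t01 H]]]] := Lop1_decay q1.
have [|n hn] := geometric_small t01 (_ : 0 <= K * (iter_one_bound + iter_one_bound)) d0.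
  by rewrite mulr_ge0// addr_ge0// addr_ge0// ltW.
exists (n * m.+1)%N => k x nk; rewrite -(subnK nk); set j := (k - _)%N.
pose D y : C := (iter_one j y)%:C + -1 * one_unit y.
have bo : bvle one_unit iter_one_bound by exact: (bvle_iter_one 0).
have Db : bvle D (iter_one_bound + iter_one_bound).
  apply: bvleD; first exact: bvle_iter_one.
  by have := bvleZ (-1) bo; rewrite ncN nc1 mul1r.
have Dz : real_zero D.
  split; first by case: Db.
    by move=> y; rewrite /D mulN1r cImD cImN /= subr0.
  have [[h1 _] _] := bvle_iter_one j.
  have mI := @measurable_Iunit R; have i1 := cintegrable_one.
  rewrite (cintegralD mI h1 (cintegrableZ (-1) i1)) (cintegralZ mI _ i1).
  by rewrite cintegral_iter_one cintegral_one mulN1r subrr.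
have := bvle_bound x (H D _ n Dz Db).
have E : iter n (Lops q (nseq m.+1 1)) D = fun x => (iter_one (j + n * m.+1) x - iter_one (n * m.+1) x)%:C.
  have I f : iter n (Lops q (nseq m.+1 1)) f = Lops q (nseq (n * m.+1) 1) f.
    elim: n {hn nk j D Db Dz} => // n IH; rewrite iterS IH mulSn nseqD /Lops foldr_cat//.
  rewrite I (_ : D = fun y => (iter_one j y)%:C - one_unit y); last first.
    by apply/funext => y; rewrite /D mulN1r.
  rewrite LopsB_bounded; [|exact: nseq1_unit|exact: bvle_bounded (bvle_iter_one j)|exact: bvle_bounded bvle_one].
  rewrite iter_oneE /Lops -foldr_cat -nseqD -/(Lops q _ _) -/(Lops q _ _) -!iter_oneE addnC.
  by apply/funext => y; rewrite rmorphB.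
by rewrite E ncR => /le_trans; apply; rewrite mulrAC.
Qed.

End Density.

(** * The invariant density *)

Section InvDensity.
Variable R : realType.
Local Notation mu := (@lebesgue_measure R).
Local Notation C := R[i].
Variable q : R.
Hypothesis q1 : 1 < q.
Let q0 : 0 < q. Proof. exact: lt_trans q1. Qed.

Definition inv_density x : R := limn (fun k => iter_one q k x).

Lemma iter_one_cvg x : cvgn (fun k => iter_one q k x).
Proof.
apply: cauchy_cvg; apply: cauchy_exP => e e0.
have [|N hN] := iter_one_cauchy q1 (_ : 0 < e / 2); first exact: divr_gt0.
exists (iter_one q N x), N => // k /= Nk; change (`|iter_one q N x - iter_one q k x| < e).
by rewrite distrC (le_lt_trans (hN k x Nk))// ltr_pdivrMr// ltr_pMr// ltr1n.
Qed.

Lemma inv_density_unif (d : R) : 0 < d -> exists N, forall k x, (N <= k)%N ->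
  `|inv_density x - iter_one q k x| <= d.
Proof.
move=> d0; have [|N hN] := iter_one_cauchy q1 (_ : 0 < d / 2); first exact: divr_gt0.
exists N => k x Nk; have h1 := hN k x Nk.
have h2 : `|inv_density x - iter_one q N x| <= d / 2.
  rewrite ler_distl; apply/andP; split.
    apply: (limr_ge (@iter_one_cvg x)); exists N => // j /= Nj.
    by have := hN j x Nj; rewrite ler_distl => /andP[].
  apply: (limr_le (@iter_one_cvg x)); exists N => // j /= Nj.
  by have := hN j x Nj; rewrite ler_distl => /andP[].
rewrite (_ : _ - _ = (inv_density x - iter_one q N x) - (iter_one q k x - iter_one q N x)); last by ring.
by apply: le_trans (ler_normB _ _) _; lra.
Qed.

Lemma inv_density_out x : ~ Iunit x -> inv_density x = 0.
Proof.
move=> nx; rewrite /inv_density (_ : (fun k => _) = fun=> 0); first exact: lim_cst.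
by apply/funext => k; rewrite iter_one_out.
Qed.

Let B := iter_one_bound q.

Lemma inv_density_ge0 x : 0 <= inv_density x.
Proof.
by apply: (limr_ge (@iter_one_cvg x)); apply: nearW => k; exact: iter_one_ge0.
Qed.

Lemma inv_density_le x : inv_density x <= B.
Proof.
apply: (limr_le (@iter_one_cvg x)); apply: nearW => k.
have := bvle_bound x (bvle_iter_one q1 k); rewrite ncR; apply: le_trans; exact: ler_norm.
Qed.

Lemma L1on_inv_density : L1on (@Iunit R) (fun x => (inv_density x)%:C).
Proof.
split; last by move=> x /inv_density_out ->.
apply: (cintegrable_le _ (cintegrableZ B%:C (cintegrable_one R))).
  apply: cmeasR; apply: measurable_limn => k.
  by have [[/cintegrable_cmeas[m1 _] _] _] := bvle_iter_one q1 k.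
move=> x; have [Ix|nx] := pselect (Iunit x); last first.
  by rewrite inv_density_out// nc0; exact: nc_ge0.
rewrite (one_in Ix) mulr1 !ncR (ger0_norm (inv_density_ge0 x)).
apply: le_trans (inv_density_le x) _; exact: ler_norm.
Qed.

Lemma inv_density_integral : \int[mu]_(x in @Iunit R) inv_density x = 1.
Proof.
apply/eqP; rewrite -subr_eq0 -normr_le0; apply/ler_addgt0Pr => d d0; rewrite add0r.
have [N hN] := inv_density_unif d0.
have [[ri _] _] := L1on_inv_density.
have [[[gi _] _] _] := bvle_iter_one q1 N.
have mI := @measurable_Iunit R.
have ri' : mu.-integrable (@Iunit R) (EFin \o inv_density) by apply: integrableS ri.
have gi' : mu.-integrable (@Iunit R) (EFin \o iter_one q N) by apply: integrableS gi.
rewrite -(integral_iter_one q1 N) -RintegralB//.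
have bi : mu.-integrable (@Iunit R) (EFin \o (fun x => inv_density x - iter_one q N x)).
  have -> : EFin \o (fun x => inv_density x - iter_one q N x) =
    ((EFin \o inv_density) \- (EFin \o iter_one q N))%E by [].
  by apply: integrableB.
apply: le_trans (le_normr_Rintegral _ bi) _; first exact: measurable_Iunit.
have -> : d = \int[mu]_(x in @Iunit R) d.
  rewrite Rintegral_cst//.
  by rewrite [X in fine X](lebesgue_measure_itv `]0%R, 1%R[)/= lte_fin ltr01 sube0 mulr1.
apply: le_Rintegral => //; last by move=> x _; exact: hN.
  exact: integrable_norm bi.
apply/integrableP; split; first exact/measurable_EFinP/measurable_cst.
under eq_integral do rewrite abse_EFin.
rewrite integral_cst//= [X in (_ * X)%E](lebesgue_measure_itv `]0%R, 1%R[)/=.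
by case: ifP => _; rewrite ?mule0// -EFinB -EFinM ltry.
Qed.

(** Uniform convergence passes through the operator. *)
Lemma inv_density_fix x : Lop 1 q (fun x => (inv_density x)%:C) x = (inv_density x)%:C.
Proof.
apply/eqP; rewrite -subr_eq0; apply/eqP/nc0_eq0.
apply/le_anti; rewrite nc_ge0 andbT; apply/ler_addgt0Pr => d d0; rewrite add0r.
pose c := 2 * q + 2; have c0 : 0 < c by rewrite addr_gt0// mulr_gt0.
have [|N hN] := inv_density_unif (_ : 0 < d / c); first exact: divr_gt0.
pose rC y := (inv_density y)%:C : C; pose gC y := (iter_one q N y)%:C : C.
have n1 : `|1 : C| = 1 by exact: normr1.
have rb : bounded rC.
  by exists B => y; rewrite ncR (ger0_norm (inv_density_ge0 y)) inv_density_le.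
have gb : bounded gC := bvle_bounded (bvle_iter_one q1 N).
have E := LopB_bounded q1 x n1 rb gb.
have db y : 0 <= nc (rC y - gC y) <= d / c.
  by rewrite nc_ge0 -rmorphB ncR hN.
have A1 : nc (Lop 1 q (fun y => rC y - gC y) x) <= 2 * (q * (d / c)).
  apply: (le_trans (Lop_le_Lreal q1 x n1 (ex_intro _ (d / c) db) (fun y => lexx _))).
  by have /andP[] := Lreal_bounded q1 x db.
have A2 : nc ((iter_one q N.+1 x)%:C - rC x) <= d / c.
  by rewrite ncB -rmorphB ncR hN.
have S : Lop 1 q gC x = (iter_one q N.+1 x)%:C by rewrite /gC Lop1_real.
have -> : Lop 1 q rC x - rC x = (Lop 1 q rC x - Lop 1 q gC x) + ((iter_one q N.+1 x)%:C - rC x).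
  by rewrite S; ring.
rewrite -E; apply: le_trans (ncD _ _) _; apply: le_trans (lerD A1 A2) _.
rewrite (_ : 2 * (q * (d / c)) + d / c = (2 * q + 1) * (d / c)); last by ring.
rewrite mulrCA ger_pMr// ler_pdivrMr// mul1r /c; lra.
Qed.

(** The iterates of 1 have norm 1 and bounded variation, hence a common lower
    bound after finitely many further steps. *)
Lemma inv_density_pos : exists2 e : R, 0 < e & forall x, Iunit x -> e <= inv_density x.
Proof.
have B0 : 0 < B.
  by rewrite /B /iter_one_bound addr_gt0// divr_gt0// subr_gt0 rate_lt1.
have [N0 low] := iter_Lreal_lower q1 B0; have [e e0 he] := low N0 (leqnn _).
exists e => // x Ix; apply: (limr_ge (@iter_one_cvg x)); exists N0 => // k /= Nk.
have := he (iter_one q (k - N0)) (iter_one_ge0 q1 (k - N0)).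
rewrite /= (l1_iter_one q1) !mulr1 => /(_ (bvle_iter_one q1 _) x Ix).
by rewrite /iter_one -iterD subnKC.
Qed.

(** The variation over a given partition passes to pointwise limits. *)
Lemma inv_density_bv : BVunit inv_density.
Proof.
exists B => a b a0 ab b1; apply: ge_ereal_sup => _ [_ [s ps <-] <-]; rewrite lee_fin.
have V k : variation a b (iter_one q k) s <= B.
  have [_ [v [v1 vm hv] vB]] := bvle_iter_one q1 k.
  have vv : {in `[a, b] &, nonincreasing_fun v}.
    move=> x y; rewrite !in_itv/= => /andP[ax _] /andP[ay _] xy; apply: vm => //.
    by apply: ltW; apply: lt_le_trans a0 _.
  have := nonincreasing_variation vv ps.
  have vs : variation a b (iter_one q k) s <= variation a b v s.
    apply: ler_sum_nat => i /andP[_ ils]; rewrite /=.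
    have p1 := @itv_partition_nth_ge _ _ a b s i (ltnW ils) ps.
    have p2 : nth b (a :: s) i <= nth b (a :: s) i.+1.
      case: ps => /(pathP b) /(_ i ils) /ltW //.
    have := hv _ _ (lt_le_trans a0 p1) p2; rewrite -rmorphB ncR distrC => /le_trans; apply.
    by rewrite distrC ler_norm.
  move=> E; apply: le_trans vs _; rewrite E.
  apply: (@le_trans _ _ (v 0)) => //; rewrite lerBlDr.
  have hb : 0 <= v b by rewrite -(v1 1)// vm// ltW// (lt_le_trans a0).
  by apply: ler_wpDr => //; rewrite vm// ltW.
have L : (fun k => variation a b (iter_one q k) s) @ \oo --> variation a b inv_density s.
  rewrite /variation /=; elim: (size s) => [|i IH].
    by under eq_fun do rewrite big_geq//; rewrite big_geq//; exact: cvg_cst.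
  under eq_fun do rewrite big_nat_recr//; rewrite big_nat_recr//=.
  by apply: cvgD IH _; apply: cvg_norm; apply: cvgB; exact: iter_one_cvg.
rewrite -(cvg_lim _ L)//; apply: limr_le; first by apply/cvg_ex; eexists; exact: L.
exact: nearW.
Qed.

Lemma is_inv_density_exists : is_inv_density q inv_density.
Proof.
split; [exact: L1on_inv_density|exact: inv_density_bv| | |exact: inv_density_integral].
  by apply/eqaeT; apply: aeW => x; exact: inv_density_fix.
have [e e0 he] := inv_density_pos; apply: aeW => x Ix; exact: lt_le_trans e0 (he x Ix).
Qed.

End InvDensity.

(** * Density of functions of bounded variation *)

Section BvDense.
Variable R : realType.
Local Notation mu := (@lebesgue_measure R).
Local Notation C := R[i].
Implicit Types f g : R -> R.

(** The step function with the values of [g] at the points j / K. *)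
Definition step_of g (K : nat) (x : R) : C :=
  \sum_(0 <= j < K) (g (j%:R / K%:R))%:C *
    (initial (j.+1%:R / K%:R) x + -1 * initial (j%:R / K%:R) x).

Lemma bvle_zero : bvle (fun=> 0 : C) 0.
Proof.
split; first by split => //; exact: cintegrable0.
exists (fun=> 0) => //; split=> // *; by rewrite !subrr nc0.
Qed.

Lemma bvle_sum (F : nat -> R -> C) (M : nat -> R) K :
  (forall j, (j < K)%N -> bvle (F j) (M j)) ->
  bvle (fun x => \sum_(0 <= j < K) F j x) (\sum_(0 <= j < K) M j).
Proof.
elim: K => [|K IH] FM.
  by rewrite big_geq//; under eq_fun do rewrite big_geq//; exact: bvle_zero.
rewrite big_nat_recr//; under eq_fun do rewrite big_nat_recr//.
by apply: bvleD; [apply: IH => j jK; apply: FM; exact: ltnW|exact: FM].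
Qed.

Lemma bvle_step g K : exists M, bvle (step_of g K) M.
Proof.
case: K => [|K].
  by exists 0; rewrite /step_of; under eq_fun do rewrite big_geq//; exact: bvle_zero.
eexists; apply: (@bvle_sum _ (fun j => nc (g (j%:R / K.+1%:R))%:C * (1 + nc (-1 : C) * 1))) => j jK.
have le1 i : (i <= K.+1)%N -> i%:R / K.+1%:R <= 1 :> R.
  by move=> iK; rewrite ler_pdivrMr// mul1r ler_nat.
apply: bvleZ; apply: bvleD; first by apply: bvle_initial; exact: le1.
by apply: bvleZ; apply: bvle_initial; apply: le1; exact: ltnW.
Qed.

Lemma step_ofE g K x : Iunit x -> (0 < K)%N ->
  step_of g K x = (g ((Num.truncn (x * K%:R))%:R / K%:R))%:C.
Proof.
move=> /IunitE/andP[x0 x1] K0; have K0' : 0 < K%:R :> R by rewrite ltr0n.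
pose j := Num.truncn (x * K%:R).
have /andP[j1 j2] := @truncn_itv R (x * K%:R) (mulr_ge0 (ltW x0) (ltW K0')).
have jK : (j < K)%N.
  by rewrite -(ltr_nat R); apply: le_lt_trans j1 _; rewrite gtr_pMl.
rewrite /step_of (bigD1_seq j)/= ?mem_index_iota ?iota_uniq// big1 => [|i ij].
  rewrite addr0 -/j initial_in; last by rewrite x0 ltr_pdivlMr.
  by rewrite initial_out ?mulr0 ?addr0 ?mulr1// negb_and -!leNgt ler_pdivrMr// j1 orbT.
case: (ltngtP i j) ij => // ij _.
  rewrite !initial_out ?mulr0 ?addr0 ?mulr0// negb_and -!leNgt ler_pdivrMr//; apply/orP; right.
    by apply: le_trans j1; rewrite ler_nat ltnW.
  by apply: le_trans j1; rewrite ler_nat.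
have xi : x < i%:R / K%:R.
  by rewrite ltr_pdivlMr//; apply: lt_le_trans j2 _; rewrite ler_nat.
rewrite !initial_in ?mulr1 ?subrr ?mulr0// x0//=.
by apply: lt_trans xi _; rewrite ltr_pM2r ?invr_gt0// ltr_nat.
Qed.

Lemma grid_dist K (x : R) : 0 <= x -> (0 < K)%N ->
  let t := (Num.truncn (x * K%:R))%:R / K%:R in t <= x /\ x - t <= K%:R^-1.
Proof.
move=> x0 K0 t; have K0' : 0 < K%:R :> R by rewrite ltr0n.
have /andP[j1 j2] := @truncn_itv R (x * K%:R) (mulr_ge0 x0 (ltW K0')).
split; first by rewrite ler_pdivrMr.
rewrite lerBlDl -[K%:R^-1]mul1r -mulrDl ler_pdivlMr// natr1; exact: ltW.
Qed.

Lemma step_cvg g x : continuous g -> Iunit x ->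
  (fun n => complex.Re (step_of g n.+1 x)) @ \oo --> g x.
Proof.
move=> cg Ix; have /IunitE/andP[x0 x1] := Ix.
under eq_fun do rewrite step_ofE//.
apply: (@cvg_comp _ _ _ (fun n => (Num.truncn (x * n.+1%:R))%:R / n.+1%:R) g _ (nbhs x)); last exact: cg.
apply/cvgrPdist_le => e e0; exists (Num.truncn e^-1) => // n /= Nn.
have [t1 t2] := @grid_dist n.+1 x (ltW x0) isT.
rewrite ger0_norm ?subr_ge0//; apply: le_trans t2 _.
rewrite invf_ple ?posrE//; apply: le_trans (ltW (truncnS_gt _)) _.
by rewrite ler_nat ltnS.
Qed.

Lemma fine_le_fin (x : \bar R) (d : R) : x \is a fin_num -> `|fine x| <= d -> (x <= d%:E)%E.
Proof. by move=> xf xd; rewrite -(fineK xf) lee_fin; exact: le_trans (ler_norm _) xd. Qed.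

Lemma continuous_step g (d : R) : continuous g -> 0 < d -> exists K,
  (\int[mu]_(x in @Iunit R) (nc ((g x)%:C - step_of g K x))%:E <= d%:E)%E.
Proof.
move=> cg d0; have mI := @measurable_Iunit R.
have [c _ hc] : exists2 c, c \in `[0, 1] & forall t, t \in `[0, 1] -> `|g t| <= `|g c|.
  apply: EVT_max => //; apply: continuous_subspaceT => x.
  by apply: continuous_comp; [exact: cg|exact: norm_continuous].
have ms n : measurable_fun (@Iunit R) (EFin \o (fun x => complex.Re (step_of g n.+1 x))).
  have [M [[/cintegrable_cmeas[m1 _] _] _]] := bvle_step g n.+1.
  by apply/measurable_EFinP; exact: measurable_funS m1.
have mg : measurable_fun (@Iunit R) (EFin \o g).
  apply/measurable_EFinP; apply: measurable_funS (continuous_measurable_fun cg) => //.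
have [] := @dominated_convergence _ _ _ mu (@Iunit R) mI
  (fun n => EFin \o (fun x => complex.Re (step_of g n.+1 x))) (EFin \o g)
  (EFin \o cst `|g c|) ms mg.
- apply: aeW => x Ix; apply/fine_cvgP; split; first by apply: nearW.
  exact: step_cvg.
- apply/integrableP; split; first exact/measurable_EFinP/measurable_cst.
  under eq_integral do rewrite abse_EFin normr_id.
  rewrite integral_cst//= [X in (_ * X)%E](lebesgue_measure_itv `]0%R, 1%R[)/=.
  by case: ifP => _; rewrite ?mule0// -EFinB -EFinM ltry.
- apply: aeW => x n Ix; rewrite /= lee_fin step_ofE//.
  have /IunitE/andP[x0 x1] := Ix.
  have [t1 t2] := @grid_dist n.+1 x (ltW x0) isT.
  by apply: hc; rewrite in_itv/= divr_ge0//= (le_trans t1)// ltW.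
move=> _ /fine_cvgP[[N1 _ f1] /cvgrPdist_le /(_ d d0)[N2 _ f2]] _.
pose n := maxn N1 N2; exists n.+1.
have := f2 n (leq_maxr _ _); rewrite sub0r normrN => f3.
have fn := f1 n (leq_maxl _ _).
rewrite (_ : (\int[mu]_(x in @Iunit R) _)%E = (\int[mu]_(x in @Iunit R)
  `|(EFin \o (fun x => complex.Re (step_of g n.+1 x))) x - (EFin \o g) x|)%E).
  exact: fine_le_fin fn f3.
apply: eq_integral => x; rewrite inE => Ix.
change ((nc ((g x)%:C - step_of g n.+1 x))%:E = `|complex.Re (step_of g n.+1 x) - g x|%:E).
by rewrite (step_ofE g Ix)// -rmorphB ncR distrC.
Qed.

(** Continuous functions are dense, and are bounded pointwise limits of step
    functions. *)
Lemma real_dense (f : R -> R) (d : R) : L1on (@Iunit R) (fun x => (f x)%:C) -> 0 < d ->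
  exists h M, bvle h M /\ l1 (fun x => (f x)%:C - h x) <= d.
Proof.
move=> [fi f0] d0; have mI := @measurable_Iunit R.
have d2 : 0 < d / 2 by rewrite divr_gt0.
have [fr _] := fi.
have fI : mu.-integrable (@Iunit R) (EFin \o f) by apply: integrableS fr.
have I1 : (mu (@Iunit R) < +oo)%E.
  by rewrite [X in (X < _)%E](lebesgue_measure_itv `]0%R, 1%R[)/= lte_fin ltr01 sube0 ltry.
have [g_ [cg ig /fine_cvgP[[N1 _ f1] /cvgrPdist_le /(_ _ d2)[N2 _ f2]]]] :=
  approximation_continuous_integrable mI I1 fI.
pose n := maxn N1 N2; pose g := g_ n.
have f3 := f2 n (leq_maxr _ _); have fn := f1 n (leq_maxl _ _).
have [K hK] := continuous_step (cg n) d2.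
have [M hM] := bvle_step g K; exists (step_of g K), M; split => //.
have [[hi h0] _] := hM.
rewrite -lee_fin -L1normE; last exact: cintegrableB.
rewrite (L1norm_on mI); last by move=> x nx; rewrite f0// h0// subrr.
have A : (\int[mu]_(x in @Iunit R) `|(f x - g x)%:E| <= (d / 2)%:E)%E.
  by apply: (fine_le_fin fn); rewrite sub0r normrN in f3.
have -> : d%:E = ((d / 2)%:E + (d / 2)%:E)%E by rewrite -EFinD; congr _%:E; field.
have m1 : measurable_fun (@Iunit R) (fun x => `|(f x - g x)%:E|%E).
  apply: measurableT_comp => //; apply/measurable_EFinP; apply: measurable_funB.
    by have /integrableP[/measurable_EFinP] := fI.
  by have /integrableP[/measurable_EFinP] := ig n.
have m2 : measurable_fun (@Iunit R) (fun x => (nc ((g x)%:C - step_of g K x))%:E).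
  have mc : cmeas (fun x => (g x)%:C - step_of g K x).
    apply: cmeasB; last exact: cintegrable_cmeas.
    by apply: cmeasR; exact: (continuous_measurable_fun (cg n)).
  by apply: measurable_funS (emeasurable_nc mc).
have m3 : measurable_fun (@Iunit R) (fun x => (nc ((f x)%:C - step_of g K x))%:E).
  apply: measurable_funS (emeasurable_nc (cintegrable_cmeas (cintegrableB fi hi))) => //.
have n2 x : (0 <= (nc ((g x)%:C - step_of g K x))%:E)%E by rewrite lee_fin; exact: nc_ge0.
apply: le_trans (leeD A hK); rewrite -ge0_integralD//.
apply: ge0_le_integral => //.
- by move=> x _; rewrite lee_fin; exact: nc_ge0.
- exact: emeasurable_funD.
move=> x _; change ((nc ((f x)%:C - step_of g K x))%:E <=
  (`|f x - g x| + nc ((g x)%:C - step_of g K x))%:E)%E.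
rewrite lee_fin -[X in _ <= X + _]ncR rmorphB; apply: le_trans (ncD _ _).
by rewrite addrA subrK.
Qed.

Lemma bvle_dense (F : R -> C) (d : R) : L1on (@Iunit R) F -> 0 < d ->
  exists h M, bvle h M /\ l1 (fun x => F x - h x) <= d.
Proof.
move=> [Fi F0] d0; have d2 : 0 < d / 2 by rewrite divr_gt0.
have [i1 i2] := Fi.
have L1 : L1on (@Iunit R) (fun x => (complex.Re (F x))%:C).
  split; first by split => //; exact: integrable0.
  by move=> x nx; rewrite F0.
have L2 : L1on (@Iunit R) (fun x => (complex.Im (F x))%:C).
  split; first by split => //; exact: integrable0.
  by move=> x nx; rewrite F0.
have [h1 [M1 [b1 e1]]] := real_dense L1 d2.
have [h2 [M2 [b2 e2]]] := real_dense L2 d2.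
have b3 := bvleZ (0 +i* 1) b2.
exists (fun x => h1 x + (0 +i* 1) * h2 x), (M1 + nc (0 +i* 1 : C) * M2); split.
  exact: bvleD.
have [[c1 _] _] := b1; have [[c2 _] _] := b2; have [a1 _] := L1; have [a2 _] := L2.
have -> : (fun x => F x - (h1 x + (0 +i* 1) * h2 x)) =
  (fun x => ((complex.Re (F x))%:C - h1 x) + (0 +i* 1) * ((complex.Im (F x))%:C - h2 x)).
  apply/funext => x; have E : F x = (complex.Re (F x))%:C + (0 +i* 1) * (complex.Im (F x))%:C.
    by apply: complex_ext; rewrite ?cReD ?cImD ?cReM ?cImM /=; ring.
  by rewrite {1}E; ring.
have d1 := cintegrableB a1 c1; have d3 := cintegrableB a2 c2.
apply: le_trans (l1D d1 (cintegrableZ _ d3)) _; rewrite l1Z//.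
have -> : nc (0 +i* 1 : C) = 1 by rewrite /= expr0n expr1n add0r sqrtr1.
rewrite mul1r; apply: le_trans (lerD e1 e2) _; lra.
Qed.

End BvDense.

(** * Decay on integrable functions *)

Section PowersL1.
Variable R : realType.
Local Notation mu := (@lebesgue_measure R).
Local Notation C := R[i].
Variable q : R.
Hypothesis q1 : 1 < q.
Let q0 : 0 < q. Proof. exact: lt_trans q1. Qed.
Implicit Types (ws : seq C) (h f F : R -> C).

Lemma Lops_lin (c : C) ws h f : (forall z, z \in ws -> `|z| = 1) ->
  cintegrable h -> cintegrable f ->
  eqae (Lops q ws (fun x => c * h x + f x)) (fun x => c * Lops q ws h x + Lops q ws f x).
Proof.
elim: ws => [|z ws IH] zws hi fi; first exact: eqae_refl.
have z1 : `|z| = 1 by apply: zws; rewrite mem_head.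
have zws' u : u \in ws -> `|u| = 1 by move=> uw; apply: zws; rewrite in_cons uw orbT.
have [ch _] := Lops_l1 q1 zws' hi; have [cf _] := Lops_l1 q1 zws' fi.
have [cb _] := Lops_l1 q1 zws' (cintegrableD (cintegrableZ c hi) fi).
apply: eqae_trans (Lop_eqae q0 z1 cb (cintegrableD (cintegrableZ c ch) cf) (IH zws' hi fi)) _.
apply: eqae_trans (LopD q0 z1 (cintegrableZ c ch) cf) _.
by apply: aeS (LopZ q0 z1 c ch) => x E _; rewrite /= E.
Qed.

Lemma Lops_eqae ws h f : (forall z, z \in ws -> `|z| = 1) ->
  cintegrable h -> cintegrable f -> eqae h f -> eqae (Lops q ws h) (Lops q ws f).
Proof.
elim: ws => [//|z ws IH] zws hi fi hf.
have z1 : `|z| = 1 by apply: zws; rewrite mem_head.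
have zws' u : u \in ws -> `|u| = 1 by move=> uw; apply: zws; rewrite in_cons uw orbT.
have [ch _] := Lops_l1 q1 zws' hi; have [cf _] := Lops_l1 q1 zws' fi.
by apply: Lop_eqae => //; exact: IH.
Qed.

(** Smallness passes to nearby functions because the operators do not increase
    the L1 norm. *)
Lemma Lops_l1_near ws h f : (forall z, z \in ws -> `|z| = 1) ->
  cintegrable h -> cintegrable f ->
  l1 (Lops q ws h) <= l1 (fun x => h x - f x) + l1 (Lops q ws f).
Proof.
move=> zws hi fi; have [ch _] := Lops_l1 q1 zws hi; have [cf _] := Lops_l1 q1 zws fi.
have [cb lb] := Lops_l1 q1 zws (cintegrableB hi fi).
have cB := cintegrableB ch cf.
have -> : Lops q ws h = (fun x => (Lops q ws h x - Lops q ws f x) + Lops q ws f x).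
  by apply/funext => x; rewrite subrK.
apply: le_trans (l1D cB cf) _; rewrite lerD2r; apply: le_trans lb.
by rewrite (l1_eqae (cintegrable_cmeas cb) (cintegrable_cmeas cB) (Lops_eqaeB q1 zws hi fi)).
Qed.

Lemma iter_Qop_mono (z e : C) h n m : `|z| = 1 -> `|e| = 1 -> cintegrable h -> (n <= m)%N ->
  l1 (iter m (Qop q z e) h) <= l1 (iter n (Qop q z e) h).
Proof.
move=> z1 e1 hi nm; rewrite -(subnK nm) iterD.
have [c _] := iter_Qop_l1 q1 z1 e1 n hi.
by have [] := iter_Qop_l1 q1 z1 e1 (m - n) c.
Qed.

Lemma Q_vanish (z e : C) F d : `|z| = 1 -> `|e| = 1 -> (z, e) <> (1, 1) ->
  L1on (@Iunit R) F -> 0 < d ->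
  exists N, forall n, (N <= n)%N -> l1 (iter n (Qop q z e) F) <= d.
Proof.
move=> z1 e1 ze FI d0; have [Fi _] := FI.
have d2 : 0 < d / 2 by rewrite divr_gt0.
have [h [M [hM hF]]] := bvle_dense FI d2; have [[hi _] _] := hM.
have [N hN] := Q_small_bv q1 z1 e1 ze hM d2.
exists N => n Nn; apply: (le_trans (iter_Qop_mono z1 e1 Fi Nn)).
move: hN; rewrite !iter_Qop => hN.
apply: le_trans (Lops_l1_near (@qword_unit R z e z1 e1 N) Fi hi) _.
by apply: le_trans (lerD hF hN) _; lra.
Qed.

Section MeanZero.

Lemma bvle_Re h (M : R) : bvle h M -> bvle (fun x => (complex.Re (h x))%:C) M.
Proof.
move=> [[[h1 h2] h0] [v [v1 vm vv] vM]]; split.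
  split; first by split => //; exact: integrable0.
  by move=> x nx; rewrite h0.
exists v => //; split => // s t s0 st; apply: le_trans (vv s t s0 st).
by rewrite -rmorphB ncR -cReN -cReD; exact: Re_le_nc.
Qed.

Lemma bvle_Im h (M : R) : bvle h M -> bvle (fun x => (complex.Im (h x))%:C) M.
Proof.
move=> hM; have := bvle_Re (bvleZ (0 -i* 1) hM).
have -> : nc (0 -i* 1 : C) = 1 by rewrite /= expr0n sqrrN expr1n add0r sqrtr1.
rewrite mul1r; congr bvle; apply/funext => x; congr (_%:C).
by rewrite cReM /=; ring.
Qed.

Lemma complex_split (w : C) : w = (complex.Re w)%:C + (0 +i* 1) * (complex.Im w)%:C.
Proof. by apply: complex_ext; rewrite ?cReD ?cImD ?cReM ?cImM /=; ring. Qed.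

Let u1 N : forall z, z \in nseq N (1 : C) -> `|z| = 1. Proof. exact: nseq1_unit. Qed.

Lemma Lop1_small_bv h M d : bvle h M -> cintegral (@Iunit R) h = 0 -> 0 < d ->
  exists n, l1 (Lops q (nseq n 1) h) <= d.
Proof.
move=> hM h0 d0; have [m [K [t [K0 t01 H]]]] := Lop1_decay q1.
have bR := bvle_Re hM; have bI := bvle_Im hM.
have [hI _] := hM; have [hi _] := hI.
have zR : real_zero (fun x => (complex.Re (h x))%:C).
  split; [by case: bR|by []|].
  have := congr1 (@complex.Re R) h0; rewrite /cintegral /= => ->.
  by apply: complex_ext => //=; exact: (congr1 fine (integral0 _ _)).
have zI : real_zero (fun x => (complex.Im (h x))%:C).
  split; [by case: bI|by []|].
  have := congr1 (@complex.Im R) h0; rewrite /cintegral /= => ->.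
  by apply: complex_ext => //=; exact: (congr1 fine (integral0 _ _)).
have d2 : 0 < d / 2 by rewrite divr_gt0.
have [|n hn] := geometric_small t01 (_ : 0 <= K * M) d2.
  by rewrite mulr_ge0// (bvle_ge0 hM).
have I f : iter n (Lops q (nseq m.+1 1)) f = Lops q (nseq (n * m.+1) 1) f.
  by elim: n {hn} => // n IH; rewrite iterS IH mulSn nseqD /Lops foldr_cat.
have B1 := bvle_l1 (H _ _ n zR bR); have B2 := bvle_l1 (H _ _ n zI bI).
rewrite I in B1; rewrite I in B2.
exists (n * m.+1)%N.
have [[ciR _] _] := bR; have [[ciI _] _] := bI.
have [cR _] := Lops_l1 q1 (@u1 (n * m.+1)) ciR; have [cI _] := Lops_l1 q1 (@u1 (n * m.+1)) ciI.
have [ch _] := Lops_l1 q1 (@u1 (n * m.+1)) hi.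
have E : h = (fun x => (0 +i* 1) * (complex.Im (h x))%:C + (complex.Re (h x))%:C).
  by apply/funext => x; rewrite {1}(complex_split (h x)) addrC.
have L := Lops_lin (0 +i* 1) (@u1 (n * m.+1)) ciI ciR; rewrite -E in L.
rewrite (l1_eqae (cintegrable_cmeas ch) _ L); last first.
  exact: cintegrable_cmeas (cintegrableD (cintegrableZ _ cI) cR).
apply: le_trans (l1D (cintegrableZ _ cI) cR) _; rewrite l1Z//.
have -> : nc (0 +i* 1 : C) = 1 by rewrite /= expr0n expr1n add0r sqrtr1.
rewrite mul1r; have hn' : K * t ^+ n * M <= d / 2 by rewrite mulrAC.
apply: le_trans (lerD B2 B1) _; apply: le_trans (lerD hn' hn') _; lra.
Qed.

Lemma nc_cintegral_le f : cintegrable f -> nc (cintegral (@Iunit R) f) <= 2 * l1 f.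
Proof.
move=> fi; have [f1 f2] := fi; have mI := @measurable_Iunit R.
have nf := integrable_nc fi.
have nfI : mu.-integrable (@Iunit R) (EFin \o (fun x => nc (f x))) by apply: integrableS nf.
have bnd (u : R -> R) : mu.-integrable setT (EFin \o u) -> (forall x, `|u x| <= nc (f x)) ->
    `|\int[mu]_(x in @Iunit R) u x| <= l1 f.
  move=> ui uf.
  have uI : mu.-integrable (@Iunit R) (EFin \o u) by apply: integrableS ui.
  apply: le_trans (le_normr_Rintegral _ uI) _ => //.
  apply: (@le_trans _ _ (\int[mu]_(x in @Iunit R) nc (f x))).
    apply: le_Rintegral => //; first exact: integrable_norm uI.
  rewrite /Rintegral /l1 /L1norm fine_le//.
  - exact: integrable_fin_num.
  - exact: integrable_fin_num.
  - apply: ge0_subset_integral => //; first exact: emeasurable_nc (cintegrable_cmeas fi).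
    by move=> x _; rewrite lee_fin; exact: nc_ge0.
have b1 := bnd _ f1 (fun x => Re_le_nc (f x)); have b2 := bnd _ f2 (fun x => Im_le_nc (f x)).
by apply: le_trans (nc_le _) _; rewrite mulr2n mulrDl mul1r; exact: lerD.
Qed.

(** The approximation by a function of bounded variation is corrected by a
    constant to have mean zero. *)
Lemma Lop1_vanish F d : L1on (@Iunit R) F -> cintegral (@Iunit R) F = 0 -> 0 < d ->
  exists N, forall n, (N <= n)%N -> l1 (iter n (Qop q 1 1) F) <= d.
Proof.
move=> FI F0 d0; have [Fi _] := FI; have mI := @measurable_Iunit R.
have d4 : 0 < d / 4 by rewrite divr_gt0.
have [h [M [hM hF]]] := bvle_dense FI d4; have [[hi _] _] := hM.
pose c := cintegral (@Iunit R) h.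
have io := cintegrable_one R.
have dE : c = - cintegral (@Iunit R) (fun x => F x + -1 * h x).
  by rewrite (cintegralD mI Fi (cintegrableZ (-1) hi)) (cintegralZ mI _ hi) F0 add0r mulN1r opprK.
have hF' : l1 (fun x => F x + -1 * h x) <= d / 4.
  by under eq_fun do rewrite mulN1r.
have lc : nc c <= d / 2.
  rewrite dE ncN; apply: le_trans (nc_cintegral_le (cintegrableD Fi (cintegrableZ (-1) hi))) _.
  lra.
pose k x := h x + - c * one_unit x.
have kM : bvle k (M + nc (- c) * 1) by apply: bvleD => //; apply: bvleZ; exact: bvle_one.
have k0 : cintegral (@Iunit R) k = 0.
  rewrite (cintegralD mI hi (cintegrableZ _ io)) (cintegralZ mI _ io) (cintegral_one R).
  by rewrite mulr1 subrr.
have [N hN] := Lop1_small_bv kM k0 d4; have [[ki _] _] := kM.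
exists N => n Nn; rewrite iter_Qop.
have -> : qword 1 1 n = nseq (n.*2 - N) (1 : C) ++ nseq N 1.
  rewrite -nseqD subnK; last by rewrite -addnn (leq_trans Nn)// leq_addl.
  by elim: n {Nn} => //= n ->.
rewrite /Lops foldr_cat -/(Lops q _ _) -/(Lops q _ _).
have [cF _] := Lops_l1 q1 (@u1 N) Fi.
have [_ le1] := Lops_l1 q1 (@u1 (n.*2 - N)) cF.
apply: le_trans le1 _; apply: le_trans (Lops_l1_near (@u1 N) Fi ki) _.
have -> : (fun x => F x - k x) = (fun x => (F x - h x) + c * one_unit x).
  by apply/funext => x; rewrite /k; ring.
have l3 := l1D (cintegrableB Fi hi) (cintegrableZ c io).
rewrite (l1Z c io) in l3.
have l4 : nc c * l1 (@one_unit R) <= d / 2.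
  apply: le_trans lc; rewrite ler_piMr ?nc_ge0//; exact: (bvle_l1 (bvle_one R)).
apply: le_trans (lerD (le_trans l3 (lerD hF l4)) hN) _; lra.
Qed.

End MeanZero.

End PowersL1.

(** * The Green operator *)

Section GreenSection.
Variable R : realType.
Local Notation mu := (@lebesgue_measure R).
Local Notation C := R[i].
Variables (q : R) (z e : C).
Hypotheses (q1 : 1 < q) (z1 : `|z| = 1) (e1 : `|e| = 1).
Let q0 : 0 < q. Proof. exact: lt_trans q1. Qed.
Implicit Types (h f F g v : R -> C).
Local Notation Q := (Qop q z e).
Local Notation A := (Aop q z e).
Local Notation G := (GreenN q z e).

Let cm f : cintegrable f -> cmeas f. Proof. exact: cintegrable_cmeas. Qed.

Let Qi n h : cintegrable h -> cintegrable (iter n Q h).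
Proof. by move=> hi; have [] := iter_Qop_l1 q1 z1 e1 n hi. Qed.

Let Ql n h : cintegrable h -> l1 (iter n Q h) <= l1 h.
Proof. by move=> hi; have [] := iter_Qop_l1 q1 z1 e1 n hi. Qed.

Let Qlin (c : C) n h f : cintegrable h -> cintegrable f ->
  eqae (iter n Q (fun x => c * h x + f x)) (fun x => c * iter n Q h x + iter n Q f x).
Proof. by move=> hi fi; rewrite !iter_Qop; apply: Lops_lin => //; exact: qword_unit. Qed.

Let Qeqae n h f : cintegrable h -> cintegrable f -> eqae h f -> eqae (iter n Q h) (iter n Q f).
Proof. by move=> hi fi; rewrite !iter_Qop; apply: Lops_eqae => //; exact: qword_unit. Qed.

Lemma eqae_l1B f g : cintegrable f -> cintegrable g ->
  eqae f g <-> l1 (fun x => f x - g x) = 0.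
Proof.
move=> fi gi; split=> [fg|E].
  rewrite -(@l1_0 R); apply: l1_eqae; [exact: cm (cintegrableB fi gi)|exact: cmeas_cst|].
  by apply: aeS fg => x E _; rewrite E// subrr.
by apply: aeS (l1_eq0 (cintegrableB fi gi) E) => x /(_ I)/eqP; rewrite subr_eq0 => /eqP.
Qed.

Lemma cintegrable_GreenN N v : cintegrable v -> cintegrable (G N v).
Proof. by move=> vi; apply: cintegrable_sum => j; apply: Qi; exact: cintegrable_Aop. Qed.

Lemma l1_Aop v : cintegrable v -> l1 (A v) <= 2 * l1 v.
Proof.
move=> vi; have Ji := cintegrable_Jop q0 vi.
have i1 : cintegrable (Sop z v) by exact: cintegrable_Sop.
have i2 : cintegrable (Sop e (Jop q v)) by exact: cintegrable_Sop.
apply: le_trans (l1D (cintegrableN i1) (cintegrable_Lop q0 z1 i2)) _.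
rewrite l1N mulr2n mulrDl mul1r; apply: lerD; first exact: l1_Sop.
apply: le_trans (l1_Lop q0 z1 i2) _; apply: le_trans (l1_Sop e1 Ji) _.
exact: l1_Jop.
Qed.

Lemma is_greenP v g : cintegrable v -> is_green q z e v g <->
  L1on (@Iunit R) g /\ forall d : R, 0 < d ->
    exists N, forall n, (N <= n)%N -> l1 (fun x => G n v x - g x) <= d.
Proof.
move=> vi; have Gi n := cintegrable_GreenN n vi.
have E g' n : cintegrable g' -> L1norm (G n v \- g') = (l1 (fun x => G n v x - g' x))%:E.
  by move=> g'i; rewrite L1normE//; exact: cintegrableB.
split=> -[gI cv]; split => //; have [gi _] := gI.
  move=> d d0; move: cv => /fine_cvgP[_ /cvgrPdist_le /(_ d d0)[N _ hN]].
  exists N => n Nn; have := hN n Nn; rewrite /= sub0r normrN.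
  by apply: le_trans; exact: ler_norm.
apply/fine_cvgP; split; first by apply: nearW => n; rewrite E.
apply/cvgrPdist_le => d d0; have [N hN] := cv d d0; exists N => // n Nn.
rewrite sub0r normrN; change (`|l1 (fun x => G n v x - g x)| <= d).
by rewrite ger0_norm ?l1_ge0//; exact: hN.
Qed.

Lemma is_green_unique v g f : cintegrable v -> is_green q z e v g -> is_green q z e v f ->
  eqae g f.
Proof.
move=> vi /(is_greenP _ vi)[[gi _] cg] /(is_greenP _ vi)[[fi _] cf].
apply/(eqae_l1B gi fi)/le_anti; rewrite l1_ge0 andbT.
apply/ler_addgt0Pr => d d0; rewrite add0r; have d2 : 0 < d / 2 by rewrite divr_gt0.
have [N1 h1] := cg _ d2; have [N2 h2] := cf _ d2.
pose n := maxn N1 N2; have Gi := cintegrable_GreenN n vi.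
have -> : (fun x => g x - f x) = (fun x => (G n v x - f x) - (G n v x - g x)).
  by apply/funext => x; ring.
apply: le_trans (l1B (cintegrableB Gi fi) (cintegrableB Gi gi)) _.
apply: le_trans (lerD (h2 n (leq_maxr _ _)) (h1 n (leq_maxl _ _))) _; lra.
Qed.

(** The Green equation says that [Aop q z e v] is h - Q h. *)
Lemma GreenN_telescope v h N : cintegrable v -> cintegrable h ->
  eqae h (fun x => Q h x + A v x) ->
  eqae (fun x => G N v x - h x) (fun x => - iter N Q h x).
Proof.
move=> vi hi E; have Ai := cintegrable_Aop q1 z1 e1 vi.
elim: N => [|N IH].
  by apply: aeW => x _; rewrite /GreenN big_geq// sub0r.
have Qhi : cintegrable (Q h) by exact: (Qi 1).
have AE : eqae (A v) (fun x => -1 * Q h x + h x).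
  by apply: aeS E => x Ex _; rewrite mulN1r [X in _ = _ + X]Ex// addrA addNr add0r.
have := eqae_trans (Qeqae N Ai (cintegrableD (cintegrableZ (-1) Qhi) hi) AE) (Qlin (-1) N Qhi hi).
move: IH; apply: aeS2 => x IH S _.
have {}IH := IH I; have {}S := S I.
rewrite /GreenN big_nat_recr// -/(G N v x) S mulN1r -iterSr addrAC IH.
by rewrite addrCA addNr addr0.
Qed.

Lemma GreenN_rec v N : cintegrable v ->
  eqae (G N.+1 v) (fun x => Q (G N v) x + A v x).
Proof.
move=> vi; have Ai := cintegrable_Aop q1 z1 e1 vi.
have GS n : G n.+1 v = (fun x => 1 * iter n Q (A v) x + G n v x).
  by apply/funext => x; rewrite /GreenN big_nat_recr//= mul1r addrC.
elim: N => [|N IH].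
  have -> : G 0 v = (fun=> 0) by apply/funext => x; rewrite /GreenN big_geq.
  have Z := Qlin (-1) 1 (cintegrable0 R) (cintegrable0 R).
  have Z0 : (fun x : R => -1 * 0 + 0 : C) = (fun=> 0).
    by apply/funext => x; rewrite mulr0 addr0.
  rewrite Z0 in Z; move: Z; apply: aeS => x Z _; have {}Z := Z I.
  change (Q (fun=> 0) x = -1 * Q (fun=> 0) x + Q (fun=> 0) x) in Z.
  rewrite /GreenN big_nat1; change (A v x = Q (fun=> 0) x + A v x).
  by rewrite {}Z; set y := (X in -1 * X); rewrite mulN1r addNr add0r.
have GNi := cintegrable_GreenN N vi.
have L := Qlin 1 1 (Qi N Ai) GNi; rewrite -GS in L.
move: IH L; apply: aeS2 => x IH L _.
have {}IH := IH I; have {}L := L I.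
have E : G N.+2 v x = 1 * iter N.+1 Q (A v) x + G N.+1 v x by rewrite GS.
change (Q (G N.+1 v) x = 1 * iter N.+1 Q (A v) x + Q (G N v) x) in L.
by rewrite E L IH addrA.
Qed.

(** The limit of the recursion [GreenN_rec]. *)
Lemma green_fixed v g : cintegrable v -> is_green q z e v g ->
  eqae g (fun x => Q g x + A v x).
Proof.
move=> vi /(is_greenP _ vi)[[gi _] cg].
have Ai := cintegrable_Aop q1 z1 e1 vi; have Qg := Qi 1 gi.
apply/(eqae_l1B gi (cintegrableD Qg Ai))/le_anti; rewrite l1_ge0 andbT.
apply/ler_addgt0Pr => d d0; rewrite add0r; have d2 : 0 < d / 2 by rewrite divr_gt0.
have [N h] := cg _ d2; have GNi n := cintegrable_GreenN n vi.
have QG := Qi 1 (GNi N).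
have S : eqae (fun x => g x - (Q g x + A v x))
  (fun x => Q (fun y => G N v y - g y) x - (G N.+1 v x - g x)).
  have := Qlin (-1) 1 gi (GNi N).
  have -> : (fun x => -1 * g x + G N v x) = (fun y => G N v y - g y).
    by apply/funext => x; rewrite mulN1r addrC.
  move: (GreenN_rec N vi); apply: aeS2 => x S1 S2 _.
  have {}S1 := S1 I; have {}S2 := S2 I.
  change (Q (fun y => G N v y - g y) x = -1 * Q g x + Q (G N v) x) in S2.
  by rewrite S1 S2; ring.
have i1 := Qi 1 (cintegrableB (GNi N) gi); have i2 := cintegrableB (GNi N.+1) gi.
rewrite (l1_eqae (cm (cintegrableB gi (cintegrableD Qg Ai))) (cm (cintegrableB i1 i2)) S).
apply: le_trans (l1B i1 i2) _.
have l2 := Ql 1 (cintegrableB (GNi N) gi).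
apply: le_trans (lerD (le_trans l2 (h N (leqnn _))) (h N.+1 (leqnSn _))) _; lra.
Qed.

Lemma Green_is_green v : green_domain q z e v -> is_green q z e v (Green q z e v).
Proof. by move=> [_ ex]; exact: (xgetPex (fun=> 0) ex). Qed.

Lemma Phi_lin (c : C) h f v : cintegrable h -> cintegrable f -> cintegrable v ->
  eqae (Phi q e (fun x => c * h x + f x) v)
       (fun x => c * Phi q e h (fun=> 0) x + Phi q e f v x).
Proof.
move=> hi fi vi; have fv := cintegrableD fi vi.
have Jh := cintegrable_Jop q0 hi; have Jfv := cintegrable_Jop q0 fv.
have E1 := SopD e1 (cintegrableZ c Jh) Jfv; have E2 := SopZ e1 c Jh.
have S : eqae (Sop e (Jop q ((fun x => c * h x + f x) \+ v)))
  (fun x => c * Sop e (Jop q h) x + Sop e (Jop q (f \+ v)) x).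
  have -> : Jop q ((fun x => c * h x + f x) \+ v) = (fun x => c * Jop q h x + Jop q (f \+ v) x).
    have -> : (fun x => c * h x + f x) \+ v = (fun x => c * h x + (f \+ v) x).
      by apply/funext => x; rewrite /= addrA.
    by rewrite JopD JopZ.
  by move: E1 E2; apply: aeS2 => x /(_ I) -> /(_ I) ->.
have Sh := cintegrable_Sop e1 Jh; have Sfv := cintegrable_Sop e1 Jfv.
have Sl : cintegrable (Sop e (Jop q ((fun x => c * h x + f x) \+ v))).
  apply: cintegrable_Sop => //; apply: cintegrable_Jop => //.
  exact: (cintegrableD (cintegrableD (cintegrableZ c hi) fi) vi).
have := Jop_eqae q0 Sl (cintegrableD (cintegrableZ c Sh) Sfv) S.
rewrite JopD JopZ; apply: aeS => x /(_ I) E _.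
have h0 : h \+ (fun=> 0) = h by apply/funext => y; rewrite /= addr0.
by rewrite /Phi /Bop E h0; ring.
Qed.

Lemma Phi_eqae h f v : cintegrable h -> cintegrable f -> cintegrable v -> eqae h f ->
  eqae (Phi q e h v) (Phi q e f v).
Proof.
move=> hi fi vi hf.
have hv := cintegrableD hi vi; have fv := cintegrableD fi vi.
have S : eqae (h \+ v) (f \+ v) by apply: aeS hf => x E _; rewrite /= E.
have Jhv := cintegrable_Jop q0 hv; have Jfv := cintegrable_Jop q0 fv.
have J := Sop_eqae e1 Jhv Jfv (Jop_eqae q0 hv fv S).
have := Jop_eqae q0 (cintegrable_Sop e1 Jhv) (cintegrable_Sop e1 Jfv) J.
by move: hf; apply: aeS2 => x E1 E2 _; rewrite /Phi /Bop E1// E2.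
Qed.

(** The three supports are disjoint and the last part of [Phi] is a
    nonexpansive image of the first two. *)
Lemma Phi_norm h v : L1on (@Iunit R) h -> L1on `]1, q[ v ->
  l1 v + l1 h <= l1 (Phi q e h v) <= 2 * (l1 v + l1 h).
Proof.
move=> [hi h0] [vi v0]; have hvi := cintegrableD hi vi.
have Pi := cintegrable_Phi q1 e1 hi vi.
apply/andP; split; last first.
  apply: le_trans (l1D hvi (cintegrable_Bop q1 e1 hvi)) _.
  have b1 := l1_Bop q1 e1 hvi; have b2 := l1D hi vi.
  apply: le_trans (lerD b2 (le_trans b1 b2)) _.
  by rewrite mulr2n mulrDl mul1r (addrC (l1 v)).
rewrite -lee_fin EFinD -!L1normE// /L1norm -ge0_integralD//=; first last.
- exact: emeasurable_nc (cm hi).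
- by move=> x _; rewrite lee_fin; exact: nc_ge0.
- exact: emeasurable_nc (cm vi).
- by move=> x _; rewrite lee_fin; exact: nc_ge0.
apply: ge0_le_integral => //=.
- by move=> x _; rewrite -EFinD lee_fin addr_ge0//; exact: nc_ge0.
- by apply: emeasurable_funD; apply: emeasurable_nc; exact: cm.
- exact: emeasurable_nc (cm Pi).
move=> x _; change ((nc (v x) + nc (h x))%:E <= (nc (h x + v x + Bop q e (h \+ v) x))%:E)%E.
rewrite lee_fin; have [qx|xq] := ltP q x.
  rewrite h0 ?v0 ?nc0 ?addr0; first exact: nc_ge0.
    by move=> /MidE/andP[_ x1]; have := lt_trans x1 qx; rewrite ltxx.
  by move=> /IunitE/andP[_ x1]; have := lt_trans x1 (lt_trans q1 qx); rewrite ltxx.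
rewrite Bop_out ?addr0; last by apply/negP; rewrite -leNgt.
have [x1|x1] := ltP 1 x.
  by rewrite h0 ?nc0 ?addr0 ?add0r// => /IunitE/andP[_]; rewrite ltNge (ltW x1).
by rewrite v0 ?nc0 ?addr0 ?add0r// => /MidE/andP[]; rewrite ltNge x1.
Qed.

Lemma Eop_norm v : green_domain q z e v ->
  (normD q z e v <= L1norm (Eop q z e v))%E /\
  (L1norm (Eop q z e v) <= 2%:E * normD q z e v)%E.
Proof.
move=> vD; have [vM _] := vD; have [vi _] := vM.
have [gI _] := Green_is_green vD; have [gi _] := gI.
have /andP[l u] := Phi_norm gI vM.
by rewrite /normD /Eop !L1normE//= ?lee_fin//; exact: cintegrable_Phi.
Qed.

Lemma preann_Eop v : green_domain q z e v -> preann q z e (Eop q z e v).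
Proof.
move=> vD; have [vM _] := vD; have [vi _] := vM.
have gG := Green_is_green vD; have [gI _] := gG.
by apply: preann_Phi => //; exact: green_fixed.
Qed.

End GreenSection.

(** * Description of the pre-annihilator *)

Section Classes.
Variable R : realType.
Local Notation mu := (@lebesgue_measure R).
Local Notation C := R[i].
Variable q : R.
Hypothesis q1 : 1 < q.
Let q0 : 0 < q. Proof. exact: lt_trans q1. Qed.
Implicit Types (h f F g v : R -> C).

(** The remainder Q^N h of the Green sums tends to 0. *)
Lemma same_classes_twisted (z e : C) : `|z| = 1 -> `|e| = 1 -> (z, e) <> (1, 1) ->
  same_classes (preann q z e) (Eop q z e @` green_domain q z e).
Proof.
move=> z1 e1 ze; split=> [F|_ [v vD <-]]; last first.
  by exists (Eop q z e v); [exact: preann_Eop|exact: eqae_refl].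
move=> /(preann_decomp q1 z1 e1)[h [v [hI vM FE hE]]].
have [hi _] := hI; have [vi _] := vM.
have gh : is_green q z e v h.
  apply/(is_greenP q1 z1 e1 h vi); split => // d d0.
  have [N hN] := Q_vanish q1 z1 e1 ze hI d0; exists N => n Nn.
  have [Qi _] := iter_Qop_l1 q1 z1 e1 n hi.
  have GNi := cintegrable_GreenN q1 z1 e1 n vi.
  rewrite (l1_eqae (cintegrable_cmeas (cintegrableB GNi hi)) (cintegrable_cmeas (cintegrableN Qi))
    (GreenN_telescope q1 z1 e1 n vi hi hE)).
  by rewrite l1N; exact: hN.
have vD : green_domain q z e v by split => //; exists h.
exists (Eop q z e v); first by exists v.
have gG := Green_is_green vD; have [[gi _] _] := gG.
apply: eqae_trans FE _; apply: (Phi_eqae q1 e1 hi gi vi).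
exact: is_green_unique gh gG.
Qed.

Section Untwisted.

Let n1 : `|1 : C| = 1. Proof. exact: normr1. Qed.
Let r x : C := (rho q x)%:C.
Local Notation Q := (Qop q 1 1).

Let rP : is_inv_density q (rho q).
Proof.
by apply: (xgetPex (fun=> 0)); exists (inv_density q); exact: is_inv_density_exists.
Qed.

Let rI : L1on (@Iunit R) r. Proof. by case: rP. Qed.
Let ri : cintegrable r. Proof. by case: rI. Qed.

Let r_fix n : eqae (iter n Q r) r.
Proof.
have [_ _ fix1 _ _] := rP.
have Li := cintegrable_Lop q0 n1 ri.
have QE : eqae (Q r) r by exact: eqae_trans (Lop_eqae q0 n1 Li ri fix1) fix1.
elim: n => [|n IH]; first exact: eqae_refl.
have [Qi _] := iter_Qop_l1 q1 n1 n1 n ri.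
rewrite iterS; apply: eqae_trans QE.
have := Lops_eqae q1 (@qword_unit R 1 1 n1 n1 1) Qi ri IH.
by [].
Qed.

Let r_int : cintegral (@Iunit R) r = 1.
Proof.
have [_ _ _ _ int1] := rP; apply: complex_ext; first exact: int1.
exact: (congr1 fine (integral0 _ _)).
Qed.

Lemma preann_density_Eop (c : C) v : green_domain q 1 1 v ->
  exists2 F, preann q 1 1 F & eqae (fun x => c * Psi q x + Eop q 1 1 v x) F.
Proof.
move=> vD; have [vM _] := vD; have [vi _] := vM.
have gG := Green_is_green vD; have [gI _] := gG; have [gi g0] := gI.
set g := Green q 1 1 v in gG gI gi g0.
exists (Phi q 1 (fun x => c * r x + g x) v); last first.
  exact: eqae_sym (Phi_lin q1 n1 c ri gi vi).
apply: preann_Phi => //.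
  split; first exact: cintegrableD (cintegrableZ c ri) gi.
  by move=> x nx; have [_ r0] := rI; rewrite r0// g0// mulr0 addr0.
have L := Lops_lin q1 c (@qword_unit R 1 1 n1 n1 1) ri gi.
have GF := green_fixed q1 n1 n1 vi gG.
move: (aeI L (aeI GF (r_fix 1))); apply: aeS => x [/(_ I) e1 [/(_ I) e2 /(_ I) e3]] _.
change (Q (fun x => c * r x + g x) x = c * Q r x + Q g x) in e1.
change (Q r x = r x) in e3.
by rewrite e1 e3 [in LHS]e2 addrA.
Qed.

(** Only the part of h of mean zero is recovered from the Green sums; the rest is
    a multiple of the density. *)
Lemma same_classes_untwisted :
  same_classes (preann q 1 1) [set F | exists (c : C) (v : R -> C),
    green_domain q 1 1 v /\ F = (fun x => c * Psi q x + Eop q 1 1 v x)].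
Proof.
split=> [F|_ [c [v [vD ->]]]]; last exact: preann_density_Eop.
move=> /(preann_decomp q1 n1 n1)[h [v [hI vM FE hE]]].
have [hi h0] := hI; have [vi _] := vM.
pose c := cintegral (@Iunit R) h.
pose D x := - c * r x + h x.
have DI : L1on (@Iunit R) D.
  split; first exact: cintegrableD (cintegrableZ _ ri) hi.
  by move=> x nx; have [_ r0] := rI; rewrite /D r0// h0// mulr0 addr0.
have [Di _] := DI.
have D0 : cintegral (@Iunit R) D = 0.
  have mI := @measurable_Iunit R.
  by rewrite (cintegralD mI (cintegrableZ _ ri) hi) (cintegralZ mI _ ri) r_int mulr1 addNr.
have gD : is_green q 1 1 v D.
  apply/(is_greenP q1 n1 n1 D vi); split => // d d0.
  have [N hN] := Lop1_vanish q1 DI D0 d0; exists N => n Nn.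
  have GNi := cintegrable_GreenN q1 n1 n1 n vi.
  have [Qi _] := iter_Qop_l1 q1 n1 n1 n Di.
  have T := GreenN_telescope q1 n1 n1 n vi hi hE.
  have L := Lops_lin q1 (- c) (@qword_unit R 1 1 n1 n1 n) ri hi.
  rewrite -!iter_Qop -/D in L.
  have E : eqae (fun x => GreenN q 1 1 n v x - D x) (fun x => - iter n Q D x).
    move: (aeI T (aeI L (r_fix n))); apply: aeS => x [/(_ I) e1 [/(_ I) e2 /(_ I) e3]] _.
    rewrite e2 e3 /D; move: e1; move: (GreenN q 1 1 n v x) (iter n Q h x) => a b e1.
    by rewrite !opprD addrCA e1.
  rewrite (l1_eqae (cintegrable_cmeas (cintegrableB GNi Di)) (cintegrable_cmeas (cintegrableN Qi)) E).
  by rewrite l1N; exact: hN.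
have vD : green_domain q 1 1 v by split => //; exists D.
exists (fun x => c * Psi q x + Eop q 1 1 v x); first by exists c, v.
have gG := Green_is_green vD; have [[gi _] _] := gG.
have hE2 : h = (fun x => c * r x + D x) by apply/funext => x; rewrite /D; ring.
apply: eqae_trans FE _; rewrite hE2.
apply: eqae_trans (Phi_lin q1 n1 c ri Di vi) _.
have := Phi_eqae q1 n1 Di gi vi (is_green_unique q1 n1 n1 vi gD gG).
by apply: aeS => x E _; rewrite E.
Qed.

(** On the middle interval the left side vanishes and the right side is [v]. *)
Lemma density_Eop_direct (c : C) v : green_domain q 1 1 v ->
  eqae (fun x => c * Psi q x) (Eop q 1 1 v) -> eqae (fun x => c * Psi q x) (fun=> 0).
Proof.
move=> vD E; have [vM _] := vD; have [vi v0] := vM.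
have gG := Green_is_green vD; have [[gi g0] _] := gG; have [_ r0] := rI.
have zi := cintegrable0 R.
have vz : eqae v (fun=> 0).
  move: E; apply: aeS => x /(_ I) Ex _; have [Mx|nM] := pselect (Mid q x); last exact: v0.
  have /MidE/andP[x1 xq] := Mx.
  have nI : ~ Iunit x by move=> /IunitE/andP[_]; rewrite ltNge (ltW x1).
  have nq : ~ q < x by apply/negP; rewrite -leNgt ltW.
  move: Ex; rewrite /Psi /Eop /Phi !Bop_out// g0// -/(r x) r0// !addr0 mulr0 add0r.
  by move->.
have lv : l1 v = 0.
  by rewrite -(@l1_0 R); apply: l1_eqae vz; [exact: cintegrable_cmeas|exact: cmeas_cst].
have Ai := cintegrable_Aop q1 n1 n1 vi.
have A0 : eqae (Aop q 1 1 v) (fun=> 0).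
  apply: l1_eq0 => //; apply/le_anti; rewrite l1_ge0 andbT.
  by have := l1_Aop q1 n1 n1 vi; rewrite lv mulr0.
have Q0 n : cintegrable (iter n Q (fun=> 0)) /\ l1 (iter n Q (fun=> 0)) = 0.
  have [i1 l1'] := iter_Qop_l1 q1 n1 n1 n zi; split => //.
  by apply/le_anti; rewrite l1_ge0 andbT; rewrite (@l1_0 R) in l1'.
have g00 : is_green q 1 1 v (fun=> 0).
  apply/(is_greenP q1 n1 n1 _ vi); split => // d d0; exists 0%N => n _.
  have GNi := cintegrable_GreenN q1 n1 n1 n vi; have [Qi Ql] := Q0 n.
  have [Qi1 Ql1] := Q0 1%N.
  have hE : eqae (fun=> 0) (fun x => Q (fun=> 0) x + Aop q 1 1 v x).
    move: (l1_eq0 Qi1 Ql1) A0; apply: aeS2 => x /(_ I) e1 /(_ I) e2 _.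
    by change (Q (fun=> 0) x = 0) in e1; rewrite e1 e2 addr0.
  have T := GreenN_telescope q1 n1 n1 n vi zi hE.
  rewrite (l1_eqae (cintegrable_cmeas (cintegrableB GNi zi)) (cintegrable_cmeas (cintegrableN Qi)) T).
  by rewrite l1N Ql ltW.
have gz := is_green_unique q1 n1 n1 vi gG g00.
have lg : l1 (Green q 1 1 v) = 0.
  by rewrite -(@l1_0 R); apply: l1_eqae gz; [exact: cintegrable_cmeas|exact: cmeas_cst].
apply: eqae_trans E _; apply: l1_eq0; first exact: cintegrable_Phi.
apply/le_anti; rewrite l1_ge0 andbT.
have /andP[_] := Phi_norm q1 n1 (proj1 gG) vM.
by rewrite lv lg addr0 mulr0.
Qed.

End Untwisted.

End Classes.

Theorem corollary5p4 (R : realType) (q : R) (zeta eta : R[i])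
    (hq : 1 < q) (hzeta : `|zeta| = 1) (heta : `|eta| = 1) :
  [/\ (zeta, eta) <> (1, 1) ->
        same_classes (preann q zeta eta)
          (Eop q zeta eta @` green_domain q zeta eta),
      (zeta, eta) = (1, 1) ->
        same_classes (preann q zeta eta)
          [set F | exists (c : R[i]) (v : R -> R[i]),
             green_domain q 1 1 v /\
             F = (fun x => c * Psi q x + Eop q 1 1 v x)] /\
        (forall (c : R[i]) (v : R -> R[i]), green_domain q 1 1 v ->
           eqae (fun x => c * Psi q x) (Eop q 1 1 v) ->
           eqae (fun x => c * Psi q x) (fun=> 0)) &
      forall v : R -> R[i], green_domain q zeta eta v ->
        (normD q zeta eta v <= L1norm (Eop q zeta eta v))%E /\
        (L1norm (Eop q zeta eta v) <= 2%:E * normD q zeta eta v)%E].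
Proof.
split; first exact: same_classes_twisted.
- move=> [-> ->]; split; first exact: same_classes_untwisted.
  exact: density_Eop_direct.
- by move=> v; exact: Eop_norm.
Qed.
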